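(* Let $\mathfrak g$, $m\in\mathbb Z_{>1}$, $Q_m(\mathfrak g)$ and $R_i$ ($i\in S$) be as in the context. (1) The elements $R_i$ of the cluster modular group $\Gamma_{Q_m(\mathfrak g)}$ satisfy $(R_iR_j)^{m_{ij}}=1$ for all $i,j\in S$, so $s_i\mapsto R_i$ defines an action of the Weyl group $W(\mathfrak g)$ on the seed. (2) If $s_{i_p}s_{i_{p-1}}\cdots s_{i_1}$ is a reduced expression of $w\in W(\mathfrak g)$, then $R(w):=R_{i_p}R_{i_{p-1}}\cdots R_{i_1}$ is a green sequence for $Q_m(\mathfrak g)$; if $w$ is the longest element of $W(\mathfrak g)$, then $R(w)$ is a maximal green sequence for $Q_m(\mathfrak g)$.
   Context: Let $\mathfrak g$ be a finite-dimensional complex simple Lie algebra of rank $\ell$, $S=\{1,\dots,\ell\}$, of type $A_\ell$, $B_\ell$, $C_\ell$, $D_\ell$ ($\ell\ge4$), $E_{6,7,8}$, $F_4$ or $G_2$, with simple roots labelled: for $A_\ell,B_\ell,C_\ell$ the chain $1-2-\cdots-\ell$ ($\alpha_\ell$ short in $B_\ell$, long in $C_\ell$); $D_\ell$: chain $1-\cdots-(\ell-1)$ plus edge $(\ell-2)-\ell$; $E_\ell$: chain $1-2-3-5-\cdots-\ell$ plus edge $3-4$; $F_4$: chain $1-2-3-4$, $\alpha_1,\alpha_2$ long; $G_2$: $\alpha_2$ long. $d_i=(\alpha_i,\alpha_i)/2$ normalized: $d_i=1$ in types $A,D,E$; $(1,\dots,1,\frac12)$ for $B_\ell$; $(1,\dots,1,2)$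 for $C_\ell$; $(1,1,\frac12,\frac12)$ for $F_4$; $(1,3)$ for $G_2$; $d=\min d_i$, $d'=\max d_i$; $C_{ij}=2(\alpha_i,\alpha_j)/(\alpha_i,\alpha_i)$. The Weyl group is $W(\mathfrak g)=\langle s_i,\ i\in S\mid (s_is_j)^{m_{ij}}=1\rangle$ with $m_{ii}=1$ and, for $i\ne j$, $m_{ij}=2,3,4,6$ according as $C_{ij}C_{ji}=0,1,2,3$. Quiver $Q(\mathfrak g)$ on $\{v^i_n: i\in S, n\in d\mathbb Z\}$, arrows for all $n$: (simply-laced) orient Dynkin edges from larger to smaller label ($C(\mathfrak g)$); $v^i_n\to v^i_{n+1}$, and for each $i\to j$ in $C(\mathfrak g)$, $v^i_n\to v^j_n$ and $v^j_{n+1}\to v^i_n$. ($B_\ell$) $v^i_n\to v^i_{n+1}$ ($i\le\ell-1$); $v^i_n\to v^{i-1}_n$, $v^{i-1}_{n+1}\to v^i_n$ ($2\le i\le\ell-1$); $v^\ell_n\to v^\ell_{n+1/2}$, $v^\ell_n\to v^{\ell-1}_{n-1/2}$, $v^{\ell-1}_{n+1/2}\to v^\ell_n$. ($C_\ell$) $v^i_n\to v^i_{n+1}$ ($i\le\ell-1$); $v^i_n\to v^{i-1}_n$, $v^{i-1}_{n+1}\to v^i_n$ ($2\le i\le\ell-1$); $v^\ell_n\to v^\ell_{n+2}$, $v^\ell_n\to v^{\ell-1}_n$, $v^{\ell-1}_{n+2}\to v^\ell_n$. ($F_4$) $v^i_n\to v^i_{n+1}$ ($i=1,2$); $v^2_n\to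 v^1_n$, $v^1_{n+1}\to v^2_n$; $v^3_n\to v^3_{n+1/2}$, $v^3_n\to v^2_{n-1/2}$, $v^2_{n+1/2}\to v^3_n$; $v^4_n\to v^4_{n+1/2}$, $v^4_n\to v^3_n$, $v^3_{n+1/2}\to v^4_n$. ($G_2$) $v^1_n\to v^1_{n+1}$, $v^2_n\to v^2_{n+3}$, $v^2_n\to v^1_n$, $v^1_{n+3}\to v^2_n$. For $m\in\mathbb Z_{>1}$, $Q_m(\mathfrak g)$ has vertex set $I=\{v^i_n: n\in d\mathbb Z/d'm\mathbb Z\}$ and the same arrows with $n$ mod $d'm$. $\varepsilon_{uv}=\#\{u\to v\}-\#\{v\to u\}$. Mutation at $k$ of a seed (exchange matrix $\varepsilon$, variables $X_v,A_v$): $\varepsilon'_{ij}=-\varepsilon_{ij}$ if $k\in\{i,j\}$, else $\varepsilon_{ij}+(|\varepsilon_{ik}|\varepsilon_{kj}+\varepsilon_{ik}|\varepsilon_{kj}|)/2$; $X'_k=X_k^{-1}$, $X'_i=X_i(1+X_k^{-\mathrm{sgn}(\varepsilon_{ik})})^{-\varepsilon_{ik}}$; $A'_k=A_k^{-1}(\prod_{\varepsilon_{kj}>0}A_j^{\varepsilon_{kj}}+\prod_{\varepsilon_{kj}<0}A_j^{-\varepsilon_{kj}})$, $A'_i=A_i$. The cluster modular group $\Gamma_Q$ consists of mutation sequences (mutations and vertex permutations) preserving $Q$, modulo those preserving the seed. For each $i$ the arrows $v^i_n\to v^i_{n+d_i}$ form $d_i/d$ oriented cycles $P_{i,\gamma}$;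 for an oriented cycle $P: v_1\to\cdots\to v_p\to v_1$, $R(P)=M(P)^{-1}\circ(v_{p-1},v_p)\circ\mu_{v_p}\mu_{v_{p-1}}\circ M(P)$, $M(P)=\mu_{v_{p-2}}\cdots\mu_{v_1}$, $(v_{p-1},v_p)$ the transposition of labels; $R_i=R(P_{i,1})\circ\cdots\circ R(P_{i,d_i/d})\in\Gamma_{Q_m(\mathfrak g)}$. Green sequences: let $\mathbb P=\mathbb P_{\mathrm{trop}}(\mathbf u)$ be the tropical semifield (Laurent monomials in $\mathbf u=(u_v)_{v\in I}$, $\oplus$ = exponentwise minimum; positive/negative = all exponents $\ge0$/$\le0$), with tropical mutation $x'_k=x_k^{-1}$, $x'_i=x_i(1\oplus x_k^{-\mathrm{sgn}(\varepsilon_{ik})})^{-\varepsilon_{ik}}$. A mutation sequence mutating successively at vertices $i_1,\dots,i_N$ (with vertex permutations interspersed) is green if, starting from $(Q,\mathbf u)$ and writing $\mathbf x[k]$ for the tropical variables after $k$ mutations, $x[k]_{i_{k+1}}$ is positive for $k=0,\dots,N-1$; it is maximal green if moreover all entries of $\mathbf x[N]$ are negative. *)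

(* Defs.v *)
From HB Require Import structures.
From mathcomp Require Import all_boot all_order all_algebra.
From mathcomp Require Import fraction.
From mathcomp Require Import mpoly.
From mathcomp Require Import all_fingroup.

Set Implicit Arguments.
Unset Strict Implicit.
Unset Printing Implicit Defensive.

Import Order.TTheory GRing.Theory Num.Theory.

(* Cartan types.  Simple roots are labelled 1..l (nat labels).              *)
(* Times n in dZ / d'mZ are stored in scaled units t = n/d, i.e. in         *)
(* Z / (r m) Z with r = d'/d.                                              *)

Inductive ctype :=
  | TA of nat | TB of nat | TC of nat | TD of nat
  | TE6 | TE7 | TE8 | TF4 | TG2.

Definition valid_ctype (t : ctype) : bool :=
  match t with
  | TA l => (0 < l)%N | TB l => (1 < l)%N | TC l => (1 < l)%N | TD l => (3 < l)%N
  | _ => true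
  end.

Definition rank (t : ctype) : nat :=
  match t with
  | TA l | TB l | TC l | TD l => l
  | TE6 => 6 | TE7 => 7 | TE8 => 8 | TF4 => 4 | TG2 => 2
  end.

(* s t a = d_a / d  (a = label) *)
Definition sc (t : ctype) (a : nat) : nat :=
  match t with
  | TB l => if (a < l)%N then 2%N else 1%N
  | TC l => if (a < l)%N then 1%N else 2%N
  | TF4 => if (a <= 2)%N then 2%N else 1%N
  | TG2 => if a == 2%N then 3%N else 1%N
  | _ => 1%N
  end.

(* r t = d' / d *)
Definition rr (t : ctype) : nat :=
  match t with
  | TB _ | TC _ | TF4 => 2%N
  | TG2 => 3%N
  | _ => 1%N
  end.

(* Dynkin edges (a,b) with a > b; for simply-laced types this is the
   orientation a -> b of C(g) (from larger to smaller label). *)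
Definition dynkin_edges (t : ctype) : seq (nat * nat) :=
  match t with
  | TA l | TB l | TC l => [seq (i.+1, i) | i <- iota 1 (l - 1)]
  | TD l => [seq (i.+1, i) | i <- iota 1 (l - 2)] ++ [:: (l, l - 2)]
  | TE6 | TE7 | TE8 =>
      [:: (2, 1); (3, 2); (5, 3); (4, 3)] ++
      [seq (k.+1, k) | k <- iota 5 (rank t - 5)]
  | TF4 => [:: (2, 1); (3, 2); (4, 3)]
  | TG2 => [:: (2, 1)]
  end.

Definition adjacent (t : ctype) (a b : nat) : bool :=
  ((a, b) \in dynkin_edges t) || ((b, a) \in dynkin_edges t).

(* Cartan matrix C_ab = 2(alpha_a,alpha_b)/(alpha_a,alpha_a) = (alpha_a,alpha_b)/d_a *)
Definition cartan (t : ctype) (a b : nat) : int :=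
  if a == b then 2%Z
  else if adjacent t a b then (- Posz (maxn (sc t a) (sc t b) %/ sc t a))%R
  else 0%Z.

Definition coxm (t : ctype) (a b : nat) : nat :=
  if a == b then 1%N else
  match `|(cartan t a b * cartan t b a)%R|%N with
  | 0 => 2%N | 1 => 3%N | 2 => 4%N | _ => 6%N
  end.

(* Arrow generators (a, x, b, y): for every time n (scaled) there is an
   arrow v^a_{n+x} -> v^b_{n+y}. *)
Definition gens (t : ctype) : seq (nat * int * nat * int) :=
  let sl (es : seq (nat * nat)) :=
    [seq (i, 0%Z, i, 1%Z) | i <- iota 1 (rank t)] ++
    flatten [seq [:: (e.1, 0%Z, e.2, 0%Z); (e.2, 1%Z, e.1, 0%Z)] | e <- es] in
  match t with
  | TA _ | TD _ | TE6 | TE7 | TE8 => sl (dynkin_edges t)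
  | TB l =>
      [seq (i, 0%Z, i, 2%Z) | i <- iota 1 (l - 1)] ++
      flatten [seq [:: (i, 0%Z, i - 1, 0%Z); (i - 1, 2%Z, i, 0%Z)]
                | i <- iota 2 (l - 2)] ++
      [:: (l, 0%Z, l, 1%Z); (l, 0%Z, l - 1, (-1)%Z); (l - 1, 1%Z, l, 0%Z)]
  | TC l =>
      [seq (i, 0%Z, i, 1%Z) | i <- iota 1 (l - 1)] ++
      flatten [seq [:: (i, 0%Z, i - 1, 0%Z); (i - 1, 1%Z, i, 0%Z)]
                | i <- iota 2 (l - 2)] ++
      [:: (l, 0%Z, l, 2%Z); (l, 0%Z, l - 1, 0%Z); (l - 1, 2%Z, l, 0%Z)]
  | TF4 =>
      [:: (1, 0%Z, 1, 2%Z); (2, 0%Z, 2, 2%Z); (2, 0%Z, 1, 0%Z);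
          (1, 2%Z, 2, 0%Z); (3, 0%Z, 3, 1%Z); (3, 0%Z, 2, (-1)%Z);
          (2, 1%Z, 3, 0%Z); (4, 0%Z, 4, 1%Z); (4, 0%Z, 3, 0%Z);
          (3, 1%Z, 4, 0%Z)]
  | TG2 =>
      [:: (1, 0%Z, 1, 1%Z); (2, 0%Z, 2, 3%Z); (2, 0%Z, 1, 0%Z);
          (1, 3%Z, 2, 0%Z)]
  end.

(* The quiver Q_m(g).  Vertex (i, k) : 'I_l * 'I_(r m) is v^{i+1}_{k d}.   *)

Definition vert (t : ctype) (m : nat) : finType :=
  ('I_(rank t) * 'I_(rr t * m))%type.

Definition is_vert (t : ctype) (m : nat) (a : nat) (x : int) (u : vert t m) : bool :=
  (a == (u.1 : nat).+1) && ((x %% Posz (rr t * m))%Z == Posz (u.2 : nat)).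

Definition narrows (t : ctype) (m : nat) (u v : vert t m) : nat :=
  \sum_(n < rr t * m)
    count (fun g : nat * int * nat * int =>
             is_vert g.1.1.1 (Posz n + g.1.1.2)%R u &&
             is_vert g.1.2 (Posz n + g.2)%R v) (gens t).

Definition epsQ (t : ctype) (m : nat) (u v : vert t m) : int :=
  (Posz (narrows u v) - Posz (narrows v u))%R.

Inductive mstep (V : finType) :=
  | Mu of V
  | Perm of {perm V}.

Record seed (V : finType) (K : fieldType) := Seed {
  seps : V -> V -> int;
  sX : V -> K;
  sA : V -> K }.

Definition mut_eps (V : finType) (e : V -> V -> int) (k : V) : V -> V -> int :=
  fun i j =>
    (if (i == k) || (j == k) then - e i j
    else e i j + ((`|e i k| * e k j + e i k * `|e k j|) %/ 2)%Z)%R.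

Definition mut_seed (V : finType) (K : fieldType) (s : seed V K) (k : V) : seed V K :=
  let e := seps s in
  Seed (mut_eps e k)
    (fun i => if i == k then (sX s k)^-1
              else sX s i * (1 + sX s k ^ (- sgz (e i k))) ^ (- e i k))%R
    (fun i => if i == k then
                (sA s k)^-1 * (\prod_(j | 0 < e k j) sA s j ^ e k j +
                               \prod_(j | e k j < 0) sA s j ^ (- e k j))
              else sA s i)%R.

(* relabelling: the data of vertex u is moved to vertex (p u) *)
Definition perm_seed (V : finType) (K : fieldType) (s : seed V K) (p : {perm V}) :
  seed V K :=
  Seed (fun i j => seps s ((p^-1)%g i) ((p^-1)%g j)) (fun i => sX s ((p^-1)%g i))
       (fun i => sA s ((p^-1)%g i)).

Definition step_seed (V : finType) (K : fieldType) (s : seed V K) (st : mstep V) :=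
  match st with Mu k => mut_seed s k | Perm p => perm_seed s p end.

(* steps are listed in the order in which they are performed *)
Definition apply_seq (V : finType) (K : fieldType) (s : seed V K) (ss : seq (mstep V)) :=
  foldl (@step_seed V K) s ss.

Definition seed_equal (V : finType) (K : fieldType) (s1 s2 : seed V K) : Prop :=
  [/\ forall i j, seps s1 i j = seps s2 i j,
      forall i, sX s1 i = sX s2 i & forall i, sA s1 i = sA s2 i].

(* The initial seed of Q with generic (algebraically independent) cluster
   variables: X_v and A_v are distinct indeterminates of the field of
   rational functions Q(X_v, A_v : v in V). *)
Definition nvars (V : finType) := (#|V| + #|V|)%N.
Definition ratfun (V : finType) : fieldType := {fraction {mpoly rat[nvars V]}}.

Definition generic_seed (V : finType) (e : V -> V -> int) : seed V (ratfun V) :=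
  Seed e (fun v => @FracField.tofrac _ ('X_(lshift #|V| (enum_rank v)) : {mpoly rat[nvars V]}))
         (fun v => @FracField.tofrac _ ('X_(rshift #|V| (enum_rank v)) : {mpoly rat[nvars V]})).

(* a mutation sequence represents the identity of the cluster modular group:
   it preserves the seed (exchange matrix and all cluster variables). *)
Definition trivial_in_Gamma (V : finType) (e : V -> V -> int) (ss : seq (mstep V)) : Prop :=
  seed_equal (apply_seq (generic_seed e) ss) (generic_seed e).

Definition same_in_Gamma (V : finType) (e : V -> V -> int) (s1 s2 : seq (mstep V)) : Prop :=
  seed_equal (apply_seq (generic_seed e) s1) (apply_seq (generic_seed e) s2).

(* R(P) for an oriented cycle P = [v_1; ...; v_p], as a list of steps in the
   order performed: mu_{v_1},...,mu_{v_{p-2}}, mu_{v_{p-1}}, mu_{v_p},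
   (v_{p-1},v_p), mu_{v_{p-2}},...,mu_{v_1}. *)
Definition RP (V : finType) (P : seq V) : seq (mstep V) :=
  match rev P with
  | vp :: vp1 :: rM =>
      let M := rev rM in
      [seq Mu x | x <- M] ++ [:: Mu vp1; Mu vp; Perm (tperm vp1 vp)] ++
      [seq Mu x | x <- rev M]
  | _ => [::]
  end.

(* The oriented cycle P_{i,g+1} (0 <= g < d_i/d): v^i_{g d} -> v^i_{g d + d_i}
   -> ... of length p = r m / s_i. *)
Definition cycleP (t : ctype) (m : nat) (i : 'I_(rank t)) (g : nat) : seq (vert t m) :=
  let s := sc t i.+1 in
  [seq (i, k) | k <- pmap (fun n => insub ((g + n * s) %% (rr t * m)))
                          (iota 0 ((rr t * m) %/ s))].

(* R_i = R(P_{i,1}) o ... o R(P_{i,d_i/d}) (so R(P_{i,d_i/d}) is performed first) *)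
Definition Ri (t : ctype) (m : nat) (i : 'I_(rank t)) : seq (mstep (vert t m)) :=
  flatten [seq RP (cycleP m i g) | g <- rev (iota 0 (sc t i.+1))].

(* (R_i R_j)^{m_ij}: R_j performed first *)
Definition RiRj_pow (t : ctype) (m : nat) (i j : 'I_(rank t)) : seq (mstep (vert t m)) :=
  flatten (nseq (coxm t i.+1 j.+1) (Ri m j ++ Ri m i)).

(* A word ws = [:: i_p; ...; i_1] stands for s_{i_p} ... s_{i_1};
   R(ws) = R_{i_p} ... R_{i_1} (R_{i_1} performed first). *)
Definition Rword (t : ctype) (m : nat) (ws : seq 'I_(rank t)) : seq (mstep (vert t m)) :=
  flatten [seq Ri m i | i <- rev ws].

Definition coxrel (t : ctype) (i j : 'I_(rank t)) : seq 'I_(rank t) :=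
  flatten (nseq (coxm t i.+1 j.+1) [:: i; j]).

Inductive wequiv (t : ctype) : seq 'I_(rank t) -> seq 'I_(rank t) -> Prop :=
  | we_refl u : wequiv u u
  | we_sym u v : wequiv u v -> wequiv v u
  | we_trans u v w : wequiv u v -> wequiv v w -> wequiv u w
  | we_rel u v i j : wequiv (u ++ coxrel i j ++ v) (u ++ v).

Definition reduced (t : ctype) (ws : seq 'I_(rank t)) : Prop :=
  forall ws', wequiv ws' ws -> size ws <= size ws'.

(* the element represented by the reduced word ws has maximal length, i.e.
   it is the longest element of W(g) *)
Definition is_longest (t : ctype) (ws : seq 'I_(rank t)) : Prop :=
  forall u : seq 'I_(rank t), exists2 u', wequiv u' u & size u' <= size ws.

(* a tropical variable is a Laurent monomial in (u_v)_v, i.e. its exponent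
   vector; multiplication = +, (+) = componentwise min. *)
Definition trop (V : finType) := V -> int.

Definition trop_pos (V : finType) (x : trop V) : bool := [forall v, (0 <= x v)%R].
Definition trop_neg (V : finType) (x : trop V) : bool := [forall v, (x v <= 0)%R].

Record tseed (V : finType) := TSeed { teps : V -> V -> int; tx : V -> trop V }.

(* x'_k = x_k^{-1};  x'_i = x_i (1 (+) x_k^{-sgn e_ik})^{-e_ik} *)
Definition tmut (V : finType) (s : tseed V) (k : V) : tseed V :=
  let e := teps s in
  TSeed (mut_eps e k)
    (fun i => if i == k then (fun w => - tx s k w)%R
              else (fun w => tx s i w +
                      (- e i k) * Num.min 0 (- sgz (e i k) * tx s k w))%R).

Definition tperm_seed (V : finType) (s : tseed V) (p : {perm V}) : tseed V :=
  TSeed (fun i j => teps s ((p^-1)%g i) ((p^-1)%g j)) (fun i => tx s ((p^-1)%g i)).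

Fixpoint green_run (V : finType) (s : tseed V) (ss : seq (mstep V)) : option (tseed V) :=
  match ss with
  | [::] => Some s
  | Mu k :: ss' => if trop_pos (tx s k) then green_run (tmut s k) ss' else None
  | Perm p :: ss' => green_run (tperm_seed s p) ss'
  end.

Definition trop_init (V : finType) (e : V -> V -> int) : tseed V :=
  TSeed e (fun v w => Posz (v == w)).

Definition green (V : finType) (e : V -> V -> int) (ss : seq (mstep V)) : Prop :=
  green_run (trop_init e) ss <> None.

Definition maximal_green (V : finType) (e : V -> V -> int) (ss : seq (mstep V)) : Prop :=
  exists2 s, green_run (trop_init e) ss = Some s & forall v, trop_neg (tx s v).

(* Main.v *)
(* Each R_i is a product of moves R(P) along oriented cycles P, and all relations between these
   moves follow from involutivity of mutations, commutation at disconnected vertices and the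
   pentagon relation.  The pentagon shows that R(P) does not depend on where P is started, so
   R(P) = mu_v R(P - v) mu_v for every vertex v of P.  Hence the braid relation for two linked
   cycles can be conjugated, vertex by vertex, down to two cycles of length 2, where it is a
   direct computation.  The cycles of Q_m(g) satisfy the Coxeter relations of the simply-laced
   unfolding of g, which imply those of g.

   For part (2), valuations on Q(X) transport the relations to tropical seeds, so the tropical
   variables after R(w) only depend on w.  If they are nonnegative along P then R(P) is green and
   acts linearly on them.  That i is an ascent of w forces the variables of row i to be
   nonnegative is then proved by Deodhar's induction: strip the maximal left factor of w in a
   rank-two parabolic subgroup, and check the dihedral case. *)
Require Import Defs.
From HB Require Import structures.
From mathcomp Require Import all_boot all_order all_algebra.
From mathcomp Require Import fraction mpoly all_fingroup zify ring.
From Stdlib Require Import FunctionalExtensionality Classical.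
Import Defs.

Set Implicit Arguments.
Unset Strict Implicit.
Unset Printing Implicit Defensive.

Import Order.TTheory GRing.Theory Num.Theory.

(** All relations are proved for seeds whose variables lie in a [cone]: closed under sum, product
    and inverse, and without 0. Mutation is subtraction-free, so it stays in the cone and no
    denominator vanishes. The same relation then serves the generic seed and the seeds over Q(X)
    that carry tropical variables. Two conditions support every induction on a cycle P: the only
    arrows inside P are those of the cycle ([cyc]), and each vertex has as many arrows to P as from
    P ([bal]). The second is what makes R(P) preserve the quiver; both survive the removal of a
    vertex by mutation as long as two vertices remain. In the descent for two linked cycles A and B,
    mutation at a vertex of A does not discard it: it moves into B, and two vertices of B lose their
    links with A and become removable. Hence the measure 2|A| + |B|. In the dihedral check, time
    runs over the integers instead of Z/N, so one finite computation covers every m. *)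

(** * Subtraction-free positivity and Laurent monomials *)

Record cone (K : fieldType) := Cone {
  cpos :> K -> Prop;
  cpos1 : cpos 1%R;
  cposD : forall x y, cpos x -> cpos y -> cpos (x + y)%R;
  cposM : forall x y, cpos x -> cpos y -> cpos (x * y)%R;
  cposV : forall x, cpos x -> cpos (x^-1)%R;
  cpos_neq0 : forall x, cpos x -> (x != 0)%R }.

Definition pp (x : int) : int := Num.max x 0%R.

Section Cone.
Local Open Scope ring_scope.
Variables (K : fieldType) (C : cone K).

Lemma cposX x (n : int) : C x -> C (x ^ n).
Proof.
move=> Cx; have h k : C (x ^+ k).
  by elim: k => [|k IH]; [apply: cpos1 | rewrite exprS; apply: cposM].
by case: n => n; [apply: h | apply/cposV/h].
Qed.

Lemma cpos_prod (I : finType) (f : I -> K) : (forall i, C (f i)) -> C (\prod_i f i).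
Proof. by move=> Cf; apply: big_ind => //; [apply: cpos1 | apply: cposM]. Qed.

Definition mon (I : finType) (A : I -> K) (f : I -> int) := \prod_i A i ^ f i.

Lemma cpos_mon (I : finType) (A : I -> K) f : (forall i, C (A i)) -> C (mon A f).
Proof. by move=> CA; apply: cpos_prod => i; apply: cposX. Qed.

Lemma monD (I : finType) (A : I -> K) (f g h : I -> int) : (forall i, C (A i)) ->
  (forall i, h i = f i + g i) -> mon A h = mon A f * mon A g.
Proof.
move=> CA fg; rewrite /mon -big_split /=; apply: eq_bigr => i _.
by rewrite fg expfzDr // (cpos_neq0 (CA i)).
Qed.

Lemma eq_mon (I : finType) (A B : I -> K) (f g : I -> int) :
  (forall i, f i = g i) -> (forall i, f i != 0 -> A i = B i) -> mon A f = mon B g.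
Proof.
move=> fg AB; apply: eq_bigr => i _; rewrite -fg.
by have [->|/AB->] := eqVneq (f i) 0; rewrite ?expr0z.
Qed.

End Cone.

(** * Mutation of exchange matrices *)

Section Mutation.
Local Open Scope ring_scope.
Variables (V : finType).
Implicit Types (e : V -> V -> int).

Definition skewsym e := forall i j, e i j = - e j i.

Lemma skew0 e i : skewsym e -> e i i = 0.
Proof. by move=> sk; have := sk i i; lia. Qed.

(** The halved absolute values become products of positive parts, so there is no division left and
    [ring] or [lia] can work on matrix entries. *)
Lemma mut_epsE e k i j : mut_eps e k i j =
  if (i == k) || (j == k) then - e i j
  else e i j + (pp (e i k) * pp (e k j) - pp (- e i k) * pp (- e k j)).
Proof.
rewrite /mut_eps; case: ifP => // _; congr (_ + _).
move: (e i k) (e k j) => a b.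
have ppP x : 0 <= x -> (pp x = x) * (pp (- x) = 0) * (`|x| = x) by move=> ?; do !split; rewrite /pp; lia.
have ppN x : x < 0 -> (pp x = 0) * (pp (- x) = - x) * (`|x| = - x) by move=> ?; do !split; rewrite /pp; lia.
have [/ppP a0|/ppN a0] := lerP 0 a; have [/ppP b0|/ppN b0] := lerP 0 b; rewrite !a0 !b0.
- have -> : a * b + a * b = (a * b) * Posz 2 by lia.
  by rewrite mulzK //; ring.
- by rewrite (_ : _ + _ = 0) ?div0z //; ring.
- by rewrite (_ : _ + _ = 0) ?div0z //; ring.
- have -> : - a * b + a * - b = - (a * b) * Posz 2 by lia.
  by rewrite mulzK //; ring.
Qed.

Definition step_eps e (st : mstep V) : V -> V -> int :=
  match st with
  | Mu k => mut_eps e k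
  | Perm p => fun i j => e ((p^-1)%g i) ((p^-1)%g j)
  end.

Definition eps_seq e (ss : seq (mstep V)) := foldl step_eps e ss.

Lemma eps_seq_cat e s t : eps_seq e (s ++ t) = eps_seq (eps_seq e s) t.
Proof. exact: foldl_cat. Qed.

Lemma skew_mut e k : skewsym e -> skewsym (mut_eps e k).
Proof.
move=> sk i j; rewrite !mut_epsE orbC; case: ifP => _; first by rewrite sk.
rewrite (sk i j) (sk i k) (sk k j) !opprK; ring.
Qed.

Lemma skew_seq e ss : skewsym e -> skewsym (eps_seq e ss).
Proof.
elim: ss e => [|[k|p] ss IH] e sk //=; apply: IH; first exact: skew_mut.
by move=> i j; apply: sk.
Qed.

Lemma mut_eps2 e k : mut_eps (mut_eps e k) k = e.
Proof.
apply: functional_extensionality => i; apply: functional_extensionality => j.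
rewrite !mut_epsE !eqxx !orbT /=; case: ifP => ijk; rewrite ?ijk ?opprK //; ring.
Qed.

Lemma mut_eps_comm e i j : i != j -> skewsym e -> e i j = 0 ->
  mut_eps (mut_eps e i) j = mut_eps (mut_eps e j) i.
Proof.
move=> ij sk eij; have eji : e j i = 0 by rewrite sk eij.
apply: functional_extensionality => k; apply: functional_extensionality => l.
rewrite !mut_epsE ?eqxx ?(negPf ij) ?(eq_sym j i) ?(negPf ij) ?orbF ?orbT /= eij eji /pp !oppr0.
have [->|kj] := eqVneq k j; have [->|lj] := eqVneq l j;
have [?|ki] := eqVneq k i; have [?|li] := eqVneq l i; subst;
  rewrite ?eqxx ?orbT ?orbF ?(negPf ij) ?(eq_sym j i) ?(negPf ij) /= ?eij ?eji ?oppr0 ?maxxx ?mulr0 ?mul0r ?subr0 ?addr0 //; try ring.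
Qed.

Lemma mut_eps_row0 e k i l : i != k -> e i k = 0 -> mut_eps e k i l = e i l.
Proof.
move=> ik eik; rewrite mut_epsE (negPf ik) /= eik.
case: eqP => [->|_]; first by rewrite eik.
by rewrite oppr0 /pp maxxx; ring.
Qed.

End Mutation.

(** * Words acting on positive seeds *)

Section Seeds.
Local Open Scope ring_scope.
Variables (V : finType) (K : fieldType) (C : cone K).
Implicit Types (e : V -> V -> int) (s : seed V K) (u v w : seq (mstep V)).

Lemma seedP s s' : seps s = seps s' -> (forall i, sX s i = sX s' i) ->
  (forall i, sA s i = sA s' i) -> s = s'.
Proof.
case: s => e X A; case: s' => e' X' A' /= -> eX eA.
by congr Seed; apply: functional_extensionality.
Qed.

Definition pos_seed s := (forall x, C (sX s x)) /\ (forall x, C (sA s x)).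

(** Since [(1 + x^-1)^-n = x^n (1 + x)^-n], the sign of the entry can be absorbed into a positive
    part and one formula covers both signs. *)
Lemma mutXE s k i : pos_seed s -> i != k -> sX (mut_seed s k) i =
  sX s i * (sX s k ^ pp (seps s i k) * (1 + sX s k) ^ (- seps s i k)).
Proof.
move=> [CX _] ik /=; rewrite (negPf ik); congr (_ * _).
have Ck := CX k; move: (sX s k) (seps s i k) Ck => x n Cx.
have x0 := cpos_neq0 Cx.
have x10 : 1 + x != 0 by apply: (cpos_neq0 (cposD (cpos1 C) Cx)).
have [n0|n0|->] := ltrgtP n 0; last by rewrite /pp maxxx oppr0 !expr0z mulr1.
  rewrite ltr0_sgz //; have -> : pp n = 0 by rewrite /pp; lia.
  by rewrite opprK expr1z expr0z mul1r.
rewrite gtr0_sgz //; have -> : pp n = n by rewrite /pp; lia.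
have -> : 1 + x ^ (-1) = (1 + x) * x^-1 by rewrite -invr_expz expr1z mulrDl divff // mul1r addrC.
by rewrite expfzMl exprz_inv opprK mulrC.
Qed.

Lemma mutX_row0 s k i : pos_seed s -> i != k -> seps s i k = 0 -> sX (mut_seed s k) i = sX s i.
Proof. by move=> ps ik h; rewrite mutXE // h /pp maxxx oppr0 !expr0z !mulr1. Qed.

Lemma mutX_eq s k : sX (mut_seed s k) k = (sX s k)^-1.
Proof. by rewrite /= eqxx. Qed.

Lemma mutAE s k : sA (mut_seed s k) k =
  (sA s k)^-1 * (mon (sA s) (fun j => pp (seps s k j)) + mon (sA s) (fun j => pp (- seps s k j))).
Proof.
rewrite /= eqxx /mon; congr (_ * (_ + _)); rewrite big_mkcond /=; apply: eq_bigr => j _.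
  by rewrite /pp; case: ltrP.
by rewrite /pp -oppr_gt0; case: ltrP.
Qed.

Lemma mutA_neq s k i : i != k -> sA (mut_seed s k) i = sA s i.
Proof. by move=> /negPf /= ->. Qed.

Lemma pos_step s st : pos_seed s -> pos_seed (step_seed s st).
Proof.
case: st => [k|p] [CX CA]; last by split => v /=.
split=> v.
  have [->|vk] := eqVneq v k; first by rewrite /= eqxx; apply: cposV.
  rewrite [step_seed _ _]/= mutXE //; apply: cposM => //; apply: cposM; apply: cposX => //.
  by apply: cposD => //; apply: cpos1.
have [->|vk] := eqVneq v k; last by rewrite /= (negPf vk).
by rewrite [step_seed _ _]/= mutAE; apply: cposM; [apply: cposV | apply: cposD; apply: cpos_mon].
Qed.

Lemma pos_seq s ss : pos_seed s -> pos_seed (apply_seq s ss).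
Proof. by elim: ss s => //= st ss IH s ps; apply: IH; apply: pos_step. Qed.

Lemma seps_step s st : seps (step_seed s st) = step_eps (seps s) st.
Proof. by case: st. Qed.

Lemma seps_seq s ss : seps (apply_seq s ss) = eps_seq (seps s) ss.
Proof. by elim: ss s => //= st ss IH s; rewrite IH seps_step. Qed.

Lemma apply_seq_cat s u v : apply_seq s (u ++ v) = apply_seq (apply_seq s u) v.
Proof. exact: foldl_cat. Qed.

(** Only the matrix is fixed, the variables are arbitrary in the cone. This is why a relation can be
    applied in the middle of a word, where nothing but the current matrix is known. *)
Definition eqv e u v :=
  forall s, seps s = e -> pos_seed s -> apply_seq s u = apply_seq s v.

Lemma eqv_refl e u : eqv e u u. Proof. by []. Qed.

Lemma eqv_sym e u v : eqv e u v -> eqv e v u.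
Proof. by move=> h s se ps; rewrite h. Qed.

Lemma eqv_trans e v u w : eqv e u v -> eqv e v w -> eqv e u w.
Proof. by move=> h h' s se ps; rewrite h // h'. Qed.

Lemma eqv_cat e e' u v u' v' : eqv e u v -> e' = eps_seq e u -> eqv e' u' v' ->
  eqv e (u ++ u') (v ++ v').
Proof.
move=> h -> h' s se ps; rewrite !apply_seq_cat -h // h' //; last exact: pos_seq.
by rewrite seps_seq se.
Qed.

Lemma eqv_eps e u v : eqv e u v -> eps_seq e u = eps_seq e v.
Proof.
(* The constant 1 lies in every cone, so a positive seed with matrix [e] exists. *)
move=> h; pose s : seed V K := Seed e (fun=> 1) (fun=> 1).
have ps : pos_seed s by split => x; apply: cpos1.
by rewrite -[LHS](seps_seq s) -[RHS](seps_seq s) h.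
Qed.

Lemma eqv_mu2 e k : skewsym e -> eqv e [:: Mu k; Mu k] [::].
Proof.
move=> sk s se ps; have pk : pos_seed (mut_seed s k) := pos_step (Mu k) ps.
have e1 : seps (mut_seed s k) = mut_eps e k by rewrite /= se.
apply: seedP => [|i|i]; first by rewrite /= se mut_eps2.
  rewrite [apply_seq _ _]/=; have [->|ik] := eqVneq i k; first by rewrite /= eqxx invrK.
  rewrite mutXE // e1 mutXE //= eqxx mut_epsE eqxx orbT se.
  have Ck := ps.1 k; move: (sX s k) (e i k) Ck => x n Cx.
  have x0 := cpos_neq0 Cx; have x10 := cpos_neq0 (cposD (cpos1 C) Cx).
  have -> : 1 + x^-1 = (1 + x) * x^-1 by rewrite mulrDl divff // mul1r addrC.
  have h : x ^ pp n * x^-1 ^ pp (- n) * x^-1 ^ n = 1.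
    by rewrite !exprz_inv -!expfzDr // (_ : _ + _ - n = 0) ?expr0z // /pp; lia.
  have h' : (1 + x) ^ (- n) * (1 + x) ^ n = 1 by rewrite -expfzDr // addNr expr0z.
  rewrite opprK expfzMl; transitivity (sX s i *
    ((x ^ pp n * x^-1 ^ pp (- n) * x^-1 ^ n) * ((1 + x) ^ (- n) * (1 + x) ^ n))); first by ring.
  by rewrite h h' !mulr1.
rewrite [apply_seq _ _]/=; have [->|ik] := eqVneq i k; last by rewrite /= (negPf ik).
rewrite mutAE e1 (_ : sA (mut_seed s k) k = (sA s k)^-1 * (mon (sA s) (fun j => pp (- mut_eps e k k j)) +
   mon (sA s) (fun j => pp (mut_eps e k k j)))); last first.
  by rewrite mutAE se; congr (_ * (_ + _)); apply: eq_mon => // j; rewrite mut_epsE eqxx /= ?opprK.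
(* As [e k k] is 0, neither exchange monomial contains the variable at [k], so the first mutation
   leaves them unchanged. *)
have ekk := skew0 k sk.
have mE f : f k = 0 -> mon (sA (mut_seed s k)) f = mon (sA s) f.
  by move=> fk; apply: eq_mon => // j fj /=; case: eqP => // jk; rewrite jk fk in fj.
rewrite !mE ?mut_epsE ?eqxx /= ?ekk //.
set a := mon _ _; set b := mon _ _.
have ab : a + b != 0 by apply: (@cpos_neq0 _ C); apply: cposD; apply: cpos_mon ps.2.
have Ak := cpos_neq0 (ps.2 k).
by rewrite invfM invrK (addrC b) -mulrA mulVf // mulr1.
Qed.

Lemma eqv_mu_comm e i j : skewsym e -> i != j -> e i j = 0 ->
  eqv e [:: Mu i; Mu j] [:: Mu j; Mu i].
Proof.
move=> sk ij eij s se ps.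
have eji : e j i = 0 by rewrite sk eij.
have ji : j != i by rewrite eq_sym.
have pi : pos_seed (mut_seed s i) := pos_step (Mu i) ps.
have pj : pos_seed (mut_seed s j) := pos_step (Mu j) ps.
apply: seedP => [|k|k]; first by rewrite /= se mut_eps_comm.
  have Xj : sX (mut_seed s i) j = sX s j by rewrite mutX_row0 ?se.
  have Xi : sX (mut_seed s j) i = sX s i by rewrite mutX_row0 ?se.
  rewrite [apply_seq _ _]/= [apply_seq s [:: Mu j; _]]/=.
  have [->|ki] := eqVneq k i.
    by rewrite mutX_row0 // ?mutX_eq ?Xi //= se mut_epsE eqxx /= eij oppr0.
  have [->|kj] := eqVneq k j.
    by rewrite [RHS]mutX_row0 // ?mutX_eq ?Xj //= se mut_epsE eqxx /= eji oppr0.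
  rewrite mutXE // Xj [RHS]mutXE // Xi (mutXE ps ki) (mutXE ps kj).
  have -> : seps (mut_seed s i) k j = e k j.
    by rewrite /= se mut_epsE (negPf ki) (negPf ji) /= eij oppr0 /pp maxxx; ring.
  have -> : seps (mut_seed s j) k i = e k i.
    by rewrite /= se mut_epsE (negPf kj) (negPf ij) /= eji oppr0 /pp maxxx; ring.
  by rewrite se; ring.
rewrite [apply_seq _ _]/= [apply_seq s [:: Mu j; _]]/=.
(* The exchange binomial at [a] does not involve the variable at [b], because [e a b] is 0. *)
have main a b : a != b -> e a b = 0 -> sA (mut_seed (mut_seed s b) a) a = sA (mut_seed s a) a.
  move=> ab eab; have row l : mut_eps e b a l = e a l by apply: mut_eps_row0.
  rewrite !mutAE /= (negPf ab) se; congr (_ * (_ + _)); apply: eq_mon => l; rewrite row //.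
    by case: (l =P b) => // ->; rewrite eab ?oppr0 /pp maxxx eqxx.
  by case: (l =P b) => // ->; rewrite eab ?oppr0 /pp maxxx eqxx.
have [->|ki] := eqVneq k i; first by rewrite mutA_neq // main.
have [->|kj] := eqVneq k j; first by rewrite [RHS]mutA_neq // main.
by rewrite !mutA_neq.
Qed.

End Seeds.

(** * The pentagon relation *)

Section Pentagon.
Local Open Scope ring_scope.

Lemma ppB x : pp x - pp (- x) = x.
Proof. by rewrite /pp; lia. Qed.

(** In a column [k], [y] and [z] stand for the entries of rows [i] and [j]. Then [w] is the entry of
    row [j] after mutation at [i], [v] that of row [i] after mutation at [i] and [j], and [h] that
    of row [i] after mutation at [j] alone. The identities are piecewise linear; they give the
    matrix part and the A-variables. *)
Lemma pentagon_pp (y z : int) (w := z - pp (- y)) (v := - y - pp (- w)) (h := y + pp z) :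
  [/\ pp h = pp y + pp w, pp (- h) = pp (- y) - pp v, pp z = pp w + pp v,
      pp (- z) = pp (- w) - pp (- y) + pp v & pp (- v) = pp (- w) - pp (- y) + pp v + pp y].
Proof. by rewrite /h /v /w /pp; split; lia. Qed.

(** Comparison of the exponents of [X], [1 + X], [Y], [1 + Y (1 + X)] and [1 + Y] in the variable of
    a third vertex on the two sides of the pentagon. *)
Lemma pentagon_exp (y z : int) (w := z - pp (- y)) (v := - y - pp (- w)) (h := y + pp z) :
  [/\ pp (- y) - pp (- v) - v = pp (- h), y + pp (- w) + v = 0, pp (- w) = pp (- z) + pp (- h),
      w + pp (- v) = h & v = z - pp (- h) - h].
Proof. by rewrite /h /v /w /pp; split; lia. Qed.

Lemma mut_eps_row (V : finType) (e : V -> V -> int) k i l : i != k -> l != k ->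
  mut_eps e k i l = e i l + (pp (e i k) * pp (e k l) - pp (- e i k) * pp (- e k l)).
Proof. by move=> /negPf ik /negPf lk; rewrite mut_epsE ik lk. Qed.

Lemma mut_eps_rowk (V : finType) (e : V -> V -> int) k l : mut_eps e k k l = - e k l.
Proof. by rewrite mut_epsE eqxx. Qed.

Lemma mut_eps_colk (V : finType) (e : V -> V -> int) k l : mut_eps e k l k = - e l k.
Proof. by rewrite mut_epsE eqxx orbT. Qed.

Lemma pp1 : (pp 1 = 1) * (pp (-1) = 0) * (pp (- -1) = 1) * (pp 0 = 0).
Proof. by []. Qed.

Variables (V : finType) (i j : V).
Hypothesis ij : i != j.

Lemma pentagon_rows (e : V -> V -> int) : skewsym e -> e i j = 1 -> forall k, k != i -> k != j ->
  let y := e i k in let z := e j k in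
  let w := z - pp (- y) in let v := - y - pp (- w) in let h := y + pp z in
  let e1 := mut_eps e i in let e2 := mut_eps e1 j in
  let f1 := mut_eps e j in
  (e1 j k = w) * (e2 i k = v) * (f1 i k = h) * (e1 i k = - y) * (e2 j k = - w)* (f1 j k = - z).
Proof.
move=> sk eij k ki kj /=; have eji : e j i = -1 by rewrite sk eij.
have ji : j != i by rewrite eq_sym.
have H1 : mut_eps e i j k = e j k - pp (- e i k).
  by rewrite mut_eps_row // eji !pp1; ring.
have H2 : mut_eps (mut_eps e i) j i k = - e i k - pp (- (e j k - pp (- e i k))).
  by rewrite mut_eps_row // !mut_eps_rowk H1 eij !pp1; ring.
have H3 : mut_eps e j i k = e i k + pp (e j k) by rewrite mut_eps_row // eij !pp1; ring.
by rewrite H1 H2 H3 !mut_eps_rowk H1.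
Qed.

Lemma pentagon_ij (e : V -> V -> int) : skewsym e -> e i j = 1 ->
  let e1 := mut_eps e i in let e2 := mut_eps e1 j in let f1 := mut_eps e j in
  (e1 i j = -1) * (e1 j i = 1) * (e2 i j = 1) * (e2 j i = -1) * (f1 i j = -1) * (f1 j i = 1).
Proof.
move=> sk eij /=; have eji : e j i = -1 by rewrite sk eij.
by rewrite !(mut_eps_rowk, mut_eps_colk) eij eji.
Qed.

Lemma pentagon_eps (e : V -> V -> int) : skewsym e -> e i j = 1 ->
  eps_seq e [:: Mu i; Mu j; Mu i] = eps_seq e [:: Mu j; Mu i; Perm (tperm i j)].
Proof.
move=> sk eij; have ji : j != i by rewrite eq_sym.
apply: functional_extensionality => k; apply: functional_extensionality => l /=.
set e1 := mut_eps e i; set e2 := mut_eps e1 j; set f1 := mut_eps e j; rewrite tpermV.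
have [sk1 sk2 skf] : [/\ skewsym e1, skewsym e2 & skewsym f1] by do !split; do !apply: skew_mut.
have IJ := pentagon_ij sk eij; rewrite /= -/e1 -/e2 -/f1 in IJ.
have rI x : x != i -> x != j -> mut_eps e2 i i x = mut_eps f1 i j x.
  move=> xi xj; have := pentagon_rows sk eij xi xj; rewrite /= -/e1 -/e2 -/f1 => R.
  rewrite mut_eps_rowk mut_eps_row // !R !IJ !pp1.
  by case: (pentagon_pp (e i x) (e j x)); rewrite /pp; lia.
have rJ x : x != i -> x != j -> mut_eps e2 i j x = mut_eps f1 i i x.
  move=> xi xj; have := pentagon_rows sk eij xi xj; rewrite /= -/e1 -/e2 -/f1 => R.
  rewrite mut_eps_rowk mut_eps_row // !R !IJ !pp1.
  by case: (pentagon_pp (e i x) (e j x)); rewrite /pp; lia.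
have skL := skew_mut i sk2; have skR := skew_mut i skf.
case: (tpermP i j k) => [->|->|/eqP ki /eqP kj]; case: (tpermP i j l) => [->|->|/eqP li /eqP lj].
- by rewrite !skew0.
- by rewrite !(mut_eps_rowk, mut_eps_colk) !IJ.
- by rewrite rI.
- by rewrite !(mut_eps_rowk, mut_eps_colk) !IJ.
- by rewrite !skew0.
- by rewrite rJ.
- by rewrite skL rI // -skR.
- by rewrite skL rJ // -skR.
rewrite mut_eps_row // {1}/e2 mut_eps_row // {1}/e1 mut_eps_row // [RHS]mut_eps_row // {1}/f1 mut_eps_row //.
have Rk := pentagon_rows sk eij ki kj; have Rl := pentagon_rows sk eij li lj.
rewrite /= -/e1 -/e2 -/f1 in Rk Rl.
rewrite (sk k i) (sk k j) (sk1 k j) (sk2 k i) (skf k i) !opprK !Rk !Rl.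
case: (pentagon_pp (e i k) (e j k)) => -> -> -> -> ->.
case: (pentagon_pp (e i l) (e j l)) => -> -> -> -> ->.
ring.
Qed.

Variables (K : fieldType) (C : cone K).

Lemma big_exp_split (A : V -> K) (f g : V -> int) (x y : K) :
  (forall k, k != i -> k != j -> f k = g k) -> A i ^ f i = x -> A j ^ f j = y ->
  g i = 0 -> g j = 0 -> mon A f = x * y * mon A g.
Proof.
move=> fg fi fj gi gj; rewrite /mon (bigD1 i) //= (bigD1 j) /= 1?eq_sym //.
rewrite [in RHS](bigD1 i) //= [in RHS](bigD1 j) /= 1?eq_sym // gi gj !expr0z !mul1r fi fj mulrA.
by congr (_ * _); apply: eq_bigr => k /andP [ki kj]; rewrite fg.
Qed.

Lemma eqv_pentagon_pos (e : V -> V -> int) : skewsym e -> e i j = 1 ->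
  eqv C e [:: Mu i; Mu j; Mu i] [:: Mu j; Mu i; Perm (tperm i j)].
Proof.
move=> sk eij s se ps; have ji : j != i by rewrite eq_sym.
have eji : e j i = -1 by rewrite sk eij.
pose s1 := mut_seed s i; pose s2 := mut_seed s1 j; pose r1 := mut_seed s j.
have p1 : pos_seed C s1 := pos_step (Mu i) ps.
have p2 : pos_seed C s2 := pos_step (Mu j) p1.
have q1 : pos_seed C r1 := pos_step (Mu j) ps.
have e1E : mut_eps e i = seps s1 by rewrite /= se.
have e2E : mut_eps (seps s1) j = seps s2 by [].
have f1E : mut_eps e j = seps r1 by rewrite /= se.
have IJ := pentagon_ij sk eij; rewrite /= e1E e2E f1E in IJ.
have R k (ki : k != i) (kj : k != j) := pentagon_rows sk eij ki kj.
rewrite /= e1E e2E f1E in R.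
have [sk1 sk2 skf] : [/\ skewsym (seps s1), skewsym (seps s2) & skewsym (seps r1)].
  by rewrite -f1E -e2E -e1E; do !split; do !apply: skew_mut.
apply: seedP => [|k|k].
- by rewrite !seps_seq se; apply: pentagon_eps.
- rewrite -[LHS]/(sX (mut_seed s2 i) k) -[RHS]/(sX (mut_seed r1 i) ((tperm i j)^-1%g k)) tpermV.
  have Ci := ps.1 i; have Cj := ps.1 j.
  set X := sX s i in Ci; set Y := sX s j in Cj.
  have X0 := cpos_neq0 Ci; have Y0 := cpos_neq0 Cj.
  have X1 : 1 + X != 0 by apply: (cpos_neq0 (cposD (cpos1 C) Ci)).
  have Y1 : 1 + Y != 0 by apply: (cpos_neq0 (cposD (cpos1 C) Cj)).
  have D0 : 1 + Y * (1 + X) != 0.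
    by apply: (@cpos_neq0 _ C); do ?[apply: cposD | apply: cposM | apply: cpos1 | done].
  have s1i : sX s1 i = X^-1 by rewrite mutX_eq.
  have s1j : sX s1 j = Y * (1 + X) by rewrite (mutXE ps ji) se eji !pp1 opprK expr0z expr1z mul1r.
  have s2i : sX s2 i = X^-1 * (1 + Y * (1 + X)).
    by rewrite (mutXE p1 ij) !IJ s1i s1j !pp1 opprK expr0z expr1z mul1r.
  have r1i : sX r1 i = X * (Y / (1 + Y)) by rewrite (mutXE ps ij) se eij !pp1 expr1z -invr_expz expr1z.
  case: (tpermP i j k) => [->|->|/eqP ki /eqP kj].
  + rewrite mutX_eq s2i (mutXE q1 ji) !IJ !mutX_eq r1i !pp1 expr1z -invr_expz expr1z -/Y.
    field; do ?[apply/andP; split] => //; apply: contra_neq D0 => D0; rewrite -D0; ring.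
  + rewrite [RHS]mutX_eq (mutXE p2 ji) !IJ !mutX_eq s1j s2i r1i !pp1 opprK expr0z expr1z mul1r.
    have -> : 1 + X^-1 * (1 + Y * (1 + X)) = (1 + X) * (1 + Y) / X by field.
    field; do ?[apply/andP; split] => //.
  rewrite (mutXE p2 ki) s2i (mutXE p1 kj) s1j (mutXE ps ki) -/X.
  rewrite (mutXE q1 ki) r1i (mutXE ps kj) -/Y.
  rewrite (sk2 k i) (sk1 k j) (skf k i) se (sk k i) (sk k j) !opprK.
  have Rk := R k ki kj; rewrite !Rk.
  have -> : 1 + X^-1 * (1 + Y * (1 + X)) = (1 + X) * (1 + Y) * X^-1 by field.
  have -> : 1 + X * (Y / (1 + Y)) = (1 + Y * (1 + X)) * (1 + Y)^-1.
    by field.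
  rewrite !expfzMl !exprz_inv -!mulrA; congr (_ * _).
  move: (1 + Y * (1 + X)) D0 => D D0; move: (1 + X) (1 + Y) X1 Y1 => X' Y' X1 Y1.
  set y := e i k; set z := e j k.
  set w := z - pp (- y); set v := - y - pp (- w); set h := y + pp z.
  transitivity (X ^ (pp (- y) - pp (- v) - v) * X' ^ (y + pp (- w) + v) * Y ^ (pp (- w)) * D ^ (w + pp (- v)) * Y' ^ v).
    rewrite !expfzDr //; ring.
  transitivity (X ^ (pp (- h)) * X' ^ 0 * Y ^ (pp (- z) + pp (- h)) * D ^ h * Y' ^ (z - pp (- h) - h)); last first.
    rewrite !expfzDr // expr0z; ring.
  by case: (pentagon_exp y z) => ? ? ? ? ?; congr (_ ^ _ * _ ^ _ * _ ^ _ * _ ^ _ * _ ^ _).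
rewrite -[LHS]/(sA (mut_seed s2 i) k) -[RHS]/(sA (mut_seed r1 i) ((tperm i j)^-1%g k)) tpermV.
pose y k := e i k; pose z k := e j k; pose w k := z k - pp (- y k).
pose v k := - y k - pp (- w k); pose h k := y k + pp (z k).
(* Monomials in the variables other than those at [i] and [j], which no step touches. All exchange
   binomials are written with them; the factorisations [Hp] to [Vm] come from [pentagon_pp] and
   reduce the claim to a field identity. *)
pose M f := mon (sA s) (fun k => if (k == i) || (k == j) then 0 else f k : int).
have CA := ps.2.
have MD f g g' : (forall k, f k = g k + g' k) -> M f = M g * M g'.
  by move=> fg; apply: (monD CA) => l; case: ifP.
have CM f : C (M f) by apply: cpos_mon.
have MX A' f x x' : (forall k, k != i -> k != j -> A' k = sA s k) ->
    A' i ^ f i = x -> A' j ^ f j = x' -> mon A' f = x * x' * M f.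
  move=> AA fi fj; rewrite (@big_exp_split A' f (fun k => if (k == i) || (k == j) then 0 else f k) x x') ?eqxx ?orbT //.
    congr (_ * _); apply: eq_mon => // l; case: ifP; rewrite ?eqxx // => /negbT.
    by rewrite negb_or => /andP [li lj] _; apply: AA.
  by move=> l /negPf li /negPf lj; rewrite li lj.
have eqM f g : (forall k, k != i -> k != j -> f k = g k) -> M f = M g.
  move=> fg; apply: eq_mon => // l; case: ifP => // /negbT.
  by rewrite negb_or => /andP [li lj]; apply: fg.
have As1 l : l != i -> l != j -> sA s1 l = sA s l by move=> li lj; rewrite mutA_neq.
have As2 l : l != i -> l != j -> sA s2 l = sA s l by move=> li lj; rewrite mutA_neq // As1.
have Ar1 l : l != i -> l != j -> sA r1 l = sA s l by move=> li lj; rewrite mutA_neq.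
have eii := skew0 i sk; have ejj := skew0 j sk.
have mutE s' p rho : (forall l, l != i -> l != j -> sA s' l = sA s l) ->
    (forall l, l != i -> l != j -> seps s' p l = rho l) ->
  sA (mut_seed s' p) p = (sA s' p)^-1 *
    (sA s' i ^ pp (seps s' p i) * sA s' j ^ pp (seps s' p j) * M (pp \o rho) +
     sA s' i ^ pp (- seps s' p i) * sA s' j ^ pp (- seps s' p j) * M (pp \o (-%R \o rho))).
  move=> AA er; rewrite mutAE; congr (_ * (_ + _));
    rewrite (MX _ _ _ _ AA erefl erefl); congr (_ * _); apply: eqM => l li lj /=; by rewrite er.
have E1 : sA s1 i = (sA s i)^-1 * (sA s j * M (pp \o y) + M (pp \o (-%R \o y))).
  by rewrite (mutE s i y) ?se // eii eij oppr0 !pp1 !expr0z !expr1z !mul1r.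
have E2 : sA s2 j = (sA s j)^-1 * (sA s1 i * M (pp \o w) + M (pp \o (-%R \o w))).
  rewrite (mutE s1 j w) // => [|l li lj]; last by rewrite R.
  by rewrite (mutA_neq _ ji) !IJ (skew0 j sk1) oppr0 !pp1 !expr0z !expr1z !mul1r mulr1.
have E3 : sA (mut_seed s2 i) i = (sA s1 i)^-1 * (sA s2 j * M (pp \o v) + M (pp \o (-%R \o v))).
  rewrite (mutE s2 i v) // => [|l li lj]; last by rewrite R.
  by rewrite {1}(mutA_neq _ ij) !IJ (skew0 i sk2) oppr0 !pp1 !expr0z !expr1z !mul1r.
have G1 : sA r1 j = (sA s j)^-1 * (M (pp \o z) + sA s i * M (pp \o (-%R \o z))).
  by rewrite (mutE s j z) ?se // ejj eji oppr0 !pp1 !expr0z !expr1z !mul1r mulr1.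
have G2 : sA (mut_seed r1 i) i = (sA s i)^-1 * (M (pp \o h) + sA r1 j * M (pp \o (-%R \o h))).
  rewrite (mutE r1 i h) // => [|l li lj]; last by rewrite R.
  by rewrite (mutA_neq _ ij) !IJ (skew0 i skf) oppr0 !pp1 !expr0z !expr1z !mul1r.
have Hp : M (pp \o h) = M (pp \o y) * M (pp \o w).
  by apply: MD => l /=; case: (pentagon_pp (y l) (z l)).
have Ym : M (pp \o (-%R \o y)) = M (pp \o (-%R \o h)) * M (pp \o v).
  by apply: MD => l /=; case: (pentagon_pp (y l) (z l)) => _ -> _ _ _; rewrite subrK.
have Zp : M (pp \o z) = M (pp \o w) * M (pp \o v).
  by apply: MD => l /=; case: (pentagon_pp (y l) (z l)).
have Wm : M (pp \o (-%R \o w)) = M (pp \o (-%R \o z)) * M (pp \o (-%R \o h)).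
  by apply: MD => l /=; case: (pentagon_pp (y l) (z l)) => _ -> _ -> _; rewrite -/(w l) -/(v l); ring.
have Vm : M (pp \o (-%R \o v)) = M (pp \o (-%R \o z)) * M (pp \o y).
  by apply: MD => l /=; case: (pentagon_pp (y l) (z l)) => _ _ _ -> ->.
have a0 := cpos_neq0 (CA i); have b0 := cpos_neq0 (CA j).
have ab0 : sA s j * M (pp \o y) + M (pp \o (-%R \o h)) * M (pp \o v) != 0.
  by apply: (@cpos_neq0 _ C); apply: cposD; apply: cposM.
case: (tpermP i j k) => [->|->|/eqP ki /eqP kj]; last by rewrite !mutA_neq.
  rewrite E3 E2 E1 [RHS]mutA_neq // G1 Ym Wm Vm Zp; field.
  by rewrite a0 b0 ab0.
rewrite mutA_neq // E2 E1 G2 G1 Hp Ym Zp Wm; field.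
by rewrite a0 b0.
Qed.

End Pentagon.

(** * Relations inside words; words with disconnected supports *)

Section Words.
Local Open Scope ring_scope.
Variables (V : finType) (K : fieldType) (C : cone K).
Implicit Types (e : V -> V -> int) (u v w : seq (mstep V)).

Lemma eqv_ctx e u v v' w : eqv C (eps_seq e u) v v' -> eqv C e (u ++ v ++ w) (u ++ v' ++ w).
Proof.
by move=> h; apply: eqv_cat erefl _ => //; apply: eqv_cat h erefl _.
Qed.

Lemma eqv_ctxl e u v v' : eqv C (eps_seq e u) v v' -> eqv C e (u ++ v) (u ++ v').
Proof. by move=> h; apply: eqv_cat erefl _. Qed.

Lemma eqv_ctxr e v v' w : eqv C e v v' -> eqv C e (v ++ w) (v' ++ w).
Proof. by move=> h; apply: eqv_cat erefl _. Qed.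

Lemma mut_perm (s : seed V K) p k :
  mut_seed (perm_seed s p) k = perm_seed (mut_seed s ((p^-1)%g k)) p.
Proof.
have inj x y : ((p^-1)%g x == (p^-1)%g y) = (x == y) by apply: inj_eq; apply: perm_inj.
apply: seedP => [|i|i] /=; rewrite ?inj //.
  by do 2!apply: functional_extensionality => ?; rewrite /mut_eps !inj.
case: ifP => // _; congr (_ * (_ + _)); rewrite [RHS](reindex_inj (@perm_inj _ (p^-1)%g)) //=.
Qed.

Lemma eqv_perm_mu e p k : eqv C e [:: Perm p; Mu k] [:: Mu ((p^-1)%g k); Perm p].
Proof. by move=> s _ _; rewrite /= mut_perm. Qed.

Lemma eqv_permM e p q : eqv C e [:: Perm p; Perm q] [:: Perm (p * q)%g].
Proof.
move=> s _ _; apply: seedP => [|i|i] /=; rewrite ?invMg ?permM //.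
by do 2!apply: functional_extensionality => ?; rewrite !permM.
Qed.

Lemma eqv_perm1 e : eqv C e [:: Perm 1%g] [::].
Proof.
move=> s _ _; apply: seedP => [|i|i] /=; rewrite ?invg1 ?perm1 //.
by do 2!apply: functional_extensionality => ?; rewrite !perm1.
Qed.

(** For the entry -1 the positive case for [(j, i)] is inverted: insert [Mu j] twice, apply it, and
    push the transpositions together until they cancel. *)
Lemma eqv_pentagon e i j : i != j -> skewsym e -> (e i j == 1) || (e i j == -1) ->
  eqv C e [:: Mu i; Mu j; Mu i] [:: Mu j; Mu i; Perm (tperm i j)].
Proof.
move=> ij sk /orP [/eqP eij|/eqP eij]; first exact: eqv_pentagon_pos.
have ji : j != i by rewrite eq_sym.
have eji : e j i = 1 by rewrite sk eij opprK.
have H := eqv_pentagon_pos (C := C) ji sk eji; apply: eqv_sym.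
have sk' := skew_seq [:: Mu j; Mu i] sk; have sk'' := skew_seq [:: Mu i; Mu j] sk.
apply: (@eqv_trans _ _ _ _ [:: Mu j; Mu i; Mu j; Mu j; Perm (tperm i j)]).
  exact/eqv_sym/(@eqv_ctx _ [:: Mu j; Mu i] [:: Mu j; Mu j] [::] _)/eqv_mu2.
apply: (@eqv_trans _ _ _ _ ([:: Mu i; Mu j; Perm (tperm j i); Mu j; Perm (tperm i j)])).
  exact: (@eqv_ctxr _ _ _ [:: Mu j; Perm (tperm i j)] H).
apply: (@eqv_trans _ _ _ _ ([:: Mu i; Mu j; Mu i; Perm (tperm j i); Perm (tperm i j)])).
  have := @eqv_perm_mu (eps_seq e [:: Mu i; Mu j]) (tperm j i) j; rewrite tpermV tpermL.
  exact: (@eqv_ctx e [:: Mu i; Mu j] _ _ [:: Perm (tperm i j)]).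
apply: (@eqv_ctxl e [:: Mu i; Mu j; Mu i] _ [::]).
apply: eqv_trans (@eqv_permM _ _ _) _; rewrite tpermC tperm2; exact: eqv_perm1.
Qed.

Definition lsupp (S : pred V) (st : mstep V) : Prop :=
  match st with
  | Mu k => S k
  | Perm p => exists x y, [/\ S x, S y & p = tperm x y]
  end.

Fixpoint wsupp (S : pred V) w : Prop := if w is st :: w' then lsupp S st /\ wsupp S w' else True.

Lemma wsupp_cat S u v : wsupp S u -> wsupp S v -> wsupp S (u ++ v).
Proof. by elim: u => //= a u IH [sa su] sv; split => //; apply: IH. Qed.

Lemma wsupp_sub (S S' : pred V) u : (forall x, S x -> S' x) -> wsupp S u -> wsupp S' u.
Proof.
move=> SS; elim: u => //= [[k|p]] u IH [sa su]; split; try exact: IH; first exact: SS.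
by case: sa => x [y [sx sy ->]]; exists x, y; split => //; apply: SS.
Qed.

Definition disc e (S S' : pred V) := forall x y, S x -> S' y -> (x != y) /\ e x y = 0.

Lemma disc_sym e S S' : skewsym e -> disc e S S' -> disc e S' S.
Proof. by move=> sk d x y sx sy; case: (d y x sy sx) => ? h; rewrite eq_sym sk h oppr0. Qed.

(** Mutation at [k] in [S] corrects [e x y] by products containing [e k y], which is 0 for [y] in
    [S']. *)
Lemma disc_step e S S' st : skewsym e -> disc e S S' -> lsupp S st -> disc (step_eps e st) S S'.
Proof.
move=> sk d; case: st => [k|p] /=.
  move=> sk' x y sx sy; have [xy exy] := d x y sx sy; split=> //.
  have [ky eky] := d k y sk' sy; rewrite mut_epsE exy oppr0; case: ifP => // _.
  by rewrite eky oppr0 !pp1; ring.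
case=> a [b [sa sb ->]] x y sx sy; have [xy exy] := d x y sx sy; split=> //; rewrite tpermV.
have [ay eay] := d a y sa sy; have [b_y eby] := d b y sb sy.
by rewrite (tpermD ay b_y); case: tpermP => _ //.
Qed.

Lemma disc_seq e S S' w : skewsym e -> disc e S S' -> wsupp S w -> disc (eps_seq e w) S S'.
Proof.
elim: w e => //= st w IH e sk d [sst sw]; apply: IH => //; last exact: disc_step.
exact: (skew_seq [:: st]).
Qed.

Lemma eqv_letters e S S' a b : skewsym e -> disc e S S' -> lsupp S a -> lsupp S' b ->
  eqv C e [:: a; b] [:: b; a].
Proof.
move=> sk d; case: a => [k|p]; case: b => [l|q] /=.
- by move=> sk' sl; case: (d k l sk' sl) => kl ekl; apply: eqv_mu_comm.
- move=> sk' [x [y [sx sy ->]]]; apply: eqv_sym.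
  have := @eqv_perm_mu e (tperm x y) k; rewrite tpermV tpermD //; first by case: (d k x sk' sx); rewrite eq_sym.
  by case: (d k y sk' sy); rewrite eq_sym.
- move=> [x [y [sx sy ->]]] sl; have := @eqv_perm_mu e (tperm x y) l.
  by rewrite tpermV tpermD //; [case: (d x l sx sl) | case: (d y l sy sl)].
move=> [x [y [sx sy ->]]] [z [t [sz st ->]]].
apply: eqv_trans (@eqv_permM _ _ _) _; apply: eqv_sym; apply: eqv_trans (@eqv_permM _ _ _) _.
rewrite conjgC tpermJ !tpermD //; by [case: (d x z sx sz) | case: (d x t sx st) | case: (d y z sy sz) | case: (d y t sy st)].
Qed.

Lemma eqv_disc e S S' u w : skewsym e -> disc e S S' -> wsupp S u -> wsupp S' w ->
  eqv C e (u ++ w) (w ++ u).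
Proof.
have one a : forall e, skewsym e -> disc e S S' -> lsupp S a -> wsupp S' w -> eqv C e (a :: w) (w ++ [:: a]).
  elim: w => [|b w IH] e0 sk d sa //= [sb sw].
  apply: eqv_trans (@eqv_ctxr _ _ _ w (eqv_letters sk d sa sb)) _.
  apply: (@eqv_ctxl e0 [:: b] (a :: w) (w ++ [:: a])).
  have sk' := skew_seq [:: b] sk.
  by apply: IH => //; apply: disc_sym => //; apply: disc_step => //; apply: disc_sym.
elim: u e => [|a u IH] e sk d su sw; first by rewrite cats0.
case: su => sa su /=.
apply: (@eqv_trans _ _ _ _ ([:: a] ++ (w ++ u))).
  apply: (@eqv_ctxl e [:: a]); apply: IH => //; [exact: (skew_seq [:: a]) | exact: disc_step].
by rewrite -[a :: u]cat1s !catA; apply: eqv_ctxr; apply: one.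
Qed.

End Words.

(** * The words R(P) and the successor function of a list *)

Section CycleWords.
Variable V : finType.
Implicit Types (P T : seq V).

Lemma RP2 (x y : V) : RP [:: x; y] = [:: Mu x; Mu y; Perm (tperm x y)].
Proof. by []. Qed.

(** R(P) is a palindrome around its last two vertices, so removing the starting vertex is a
    conjugation by definition. It drives every induction on cycles, with length 2 as base. *)
Lemma RP_cons (z : V) T : 1 < size T -> RP (z :: T) = Mu z :: RP T ++ [:: Mu z].
Proof.
rewrite -[T]revK size_rev /RP rev_cons !revK; case: (rev T) => [|y [|x M]] //= _.
by rewrite rev_rcons rev_cons revK map_rcons -cats1 /= -?catA /= -?catA.
Qed.

Lemma wsupp_RP P : wsupp (mem P) (RP P).
Proof.
elim: P => [|z [|x [|y T]] IH] //.
  by rewrite RP2 /= !inE !eqxx !orbT; do !split => //; exists z, x; rewrite !inE !eqxx !orbT.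
rewrite RP_cons //; split; first by rewrite /= inE eqxx.
apply: wsupp_cat; last by rewrite /= inE eqxx.
by apply: wsupp_sub IH => t /= tT; rewrite inE tT orbT.
Qed.

(** The first argument after [x] is only the wrap-around value, returned at the last entry; changing
    it changes the successor nowhere else. *)
Lemma next_at_last (y0 y1 z x : V) T : uniq (z :: T) -> x \in z :: T ->
  next_at x y0 z T = if x == last z T then y0 else next_at x y1 z T.
Proof.
elim: T z => [|t T IH] z /=; first by rewrite inE => _ ->.
move=> /andP [zt uT]; rewrite inE; case: (eqVneq x z) => [-> _|_ /= xT]; last exact: IH.
by case: eqP => // zl; rewrite {1}zl mem_last in zt.
Qed.

Lemma next_cons (z h x : V) T : uniq (z :: h :: T) -> x \in h :: T ->
  next (z :: h :: T) x = if x == last h T then z else next (h :: T) x.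
Proof.
move=> /= /andP [zn uT] xT; have -> : x == z = false by apply: contraNF zn => /eqP <-.
by rewrite (next_at_last z h uT xT).
Qed.

Lemma next_last (h : V) T : uniq (h :: T) -> next (h :: T) (last h T) = h.
Proof. by move=> u; rewrite /= (next_at_last h h u) ?mem_last // eqxx. Qed.

Lemma next_head (z h : V) T : next (z :: h :: T) z = h.
Proof. by rewrite /= eqxx. Qed.

Lemma next_eq_head (z h x : V) T : uniq (z :: h :: T) -> x \in h :: T ->
  (next (z :: h :: T) x == z) = (x == last h T).
Proof.
move=> u xT; rewrite next_cons //; case: ifP => _; first by rewrite eqxx.
move: u => /= /andP [zn _]; apply: contraNF zn => /eqP <-.
by rewrite -[_ \in _]/(next (h :: T) x \in h :: T) mem_next.
Qed.

Lemma next_rcons (z x : V) T : uniq (z :: T) -> next (rcons T z) x = next (z :: T) x.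
Proof. by move=> u; rewrite -[RHS](next_rot 1) // rot1_cons. Qed.

End CycleWords.

(** * Oriented and balanced cycles; R(P) preserves the exchange matrix *)

Section Cycles.
Local Open Scope ring_scope.
Variables (V : finType).
Implicit Types (e : V -> V -> int) (P T : seq V).

(** In length 2 the two terms cancel and the vertices are not joined. This convention lets the
    removal of vertices end at pairs. *)
Definition cyc e P := [/\ uniq P, (1 < size P)%N & forall x y, x \in P -> y \in P ->
  e x y = (next P x == y)%:Z - (next P y == x)%:Z].

(** For a pair it says that the two columns are opposite, which is exactly what [pres2] needs. *)
Definition bal e P := forall k, \sum_(x <- P) e k x = 0.

Lemma cyc_rot e z T : cyc e (z :: T) -> cyc e (rcons T z).
Proof.
move=> [u s H]; split; first by rewrite rcons_uniq.
  by rewrite size_rcons.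
by move=> x y; rewrite !mem_rcons => xT yT; rewrite !next_rcons // H.
Qed.

Lemma cyc_rotr e z T : cyc e (rcons T z) -> cyc e (z :: T).
Proof.
move=> [u s H]; have u' : uniq (z :: T) by rewrite rcons_uniq in u.
split => //; first by rewrite size_rcons in s.
by move=> x y xT yT; rewrite -!next_rcons // H // mem_rcons.
Qed.

Lemma bal_rot e z T : bal e (z :: T) -> bal e (rcons T z).
Proof. by move=> H k; have := H k; rewrite big_cons -cats1 big_cat /= big_seq1 addrC. Qed.

Lemma bal_perm e P Q : perm_eq P Q -> bal e P -> bal e Q.
Proof. by move=> pPQ H k; rewrite -(perm_big _ pPQ) /=. Qed.

Lemma cyc_head e z h T x : skewsym e -> cyc e [:: z, h & T] -> T != [::] -> x \in h :: T ->
  let l := last h T in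
  [/\ h != l, x != z, e z x = (x == h)%:Z - (x == l)%:Z,
      pp (e z x) = (x == h)%:Z & pp (- e z x) = (x == l)%:Z].
Proof.
move=> sk [u s H] T0 xT l.
have hl : h != l.
  move: u T0 => /= /and3P [_ hT _]; rewrite /l; case: (T) hT => //= t T' hT _.
  by apply: contraNneq hT => ->; apply: mem_last.
have xz : x != z by move: u => /= /andP [zn _]; apply: contraNneq zn => <-.
have ezx : e z x = (x == h)%:Z - (x == l)%:Z.
  rewrite H ?mem_head //; last by rewrite inE xT orbT.
  by rewrite next_head next_eq_head // (eq_sym h).
split => //; rewrite ezx; case: (eqVneq x h) => [->|]; rewrite ?(negPf hl) //; by case: (x == l).
Qed.

(** Mutation at [z] replaces the path from the last vertex through [z] to the next one by a single
    arrow, which closes the shorter cycle. From length 3 to 2 this arrow cancels the existing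
    one. *)
Lemma cyc_del e z T : skewsym e -> cyc e (z :: T) -> (1 < size T)%N -> cyc (mut_eps e z) T.
Proof.
case: T => [|h T] //= sk cy; have [u _ H] := cy; rewrite ltnS => T0.
have {}T0 : T != [::] by case: (T) T0.
have u' : uniq (h :: T) by case/andP: u.
split=> //; first by case: (T) T0.
move=> x y xT yT.
have [hl xz ezx px mx] := cyc_head sk cy T0 xT; have [_ yz ezy py my] := cyc_head sk cy T0 yT.
rewrite mut_eps_row // (sk x z) opprK px mx py my H; [|by rewrite inE ?xT ?yT orbT ..].
rewrite !next_cons //.
have zx : (z == x) = false by rewrite eq_sym (negPf xz).
have zy : (z == y) = false by rewrite eq_sym (negPf yz).
have nl := next_last u'.
rewrite (eq_sym x h) (eq_sym y h).
case: (x =P last h T) => [xl|_]; case: (y =P last h T) => [yl|_]; rewrite ?zx ?zy.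
- by rewrite xl yl nl (negPf hl).
- by rewrite xl nl (negPf hl); case: (h == y); case: (_ == last h T).
- by rewrite yl nl (negPf hl); case: (h == x); case: (_ == last h T).
by case: (h == x); case: (h == y); case: (_ == y); case: (_ == x).
Qed.

Lemma sum_delta (T : seq V) h : uniq T -> h \in T -> \sum_(x <- T) (x == h)%:Z = 1.
Proof.
move=> u hT; rewrite (bigD1_seq h) //= eqxx big1 ?addr0 // => x /negPf ->; done.
Qed.

(** The removed term [e k z] comes back through the two neighbours of [z]: its positive part at one
    and its negative part at the other. *)
Lemma bal_del e z T : skewsym e -> cyc e (z :: T) -> (1 < size T)%N -> bal e (z :: T) -> bal (mut_eps e z) T.
Proof.
case: T => [|h T] //= sk cy; have [u _ _] := cy; rewrite ltnS => T0.
have {}T0 : T != [::] by case: (T) T0.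
have u' : uniq (h :: T) by case/andP: u.
move=> B k; have := B k; rewrite big_cons => Bk.
have [->|kz] := eqVneq k z.
  rewrite (eq_bigr (fun x => - e z x)) => [|x _]; last by rewrite mut_eps_rowk.
  by rewrite sumrN; have := B z; rewrite big_cons skew0 // add0r => ->; rewrite oppr0.
rewrite (eq_big_seq (fun x => e k x + (pp (e k z) * (x == h)%:Z - pp (- e k z) * (x == last h T)%:Z))); last first.
  by move=> x xT; have [_ xz _ px mx] := cyc_head sk cy T0 xT; rewrite mut_eps_row // px mx.
rewrite big_split /= sumrB -!mulr_sumr !sum_delta ?mem_head ?mem_last // !mulr1 ppB.
by rewrite addrC.
Qed.

(** The corrections from the two mutations add up to the negative of those needed to restore the
    entry: opposite columns make them cancel, and the transposition undoes the sign change in the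
    rows of [x] and [y]. *)
Lemma pres2 e x y : x != y -> skewsym e -> e x y = 0 -> (forall k, e k y = - e k x) ->
  eps_seq e [:: Mu x; Mu y; Perm (tperm x y)] = e.
Proof.
move=> xy sk exy B; have yx : y != x by rewrite eq_sym.
have eyx : e y x = 0 by rewrite sk exy.
have B' l : e y l = - e x l by rewrite sk B opprK; apply: sk.
apply: functional_extensionality => k; apply: functional_extensionality => l /=; rewrite tpermV.
set f := mut_eps _ y.
have skf : skewsym f by do 2!apply: skew_mut.
have fy j : f y j = - e y j by rewrite /f mut_eps_rowk mut_eps_row0.
have fx j : f x j = - e x j.
  by rewrite /f mut_eps_row0 // ?mut_eps_colk ?mut_eps_rowk ?exy ?oppr0.
case: (tpermP x y k) => [->|->|/eqP kx /eqP ky]; first by rewrite fy; case: (tpermP x y l) => [->|->|_ _]; rewrite B' ?opprK // ?exy ?skew0 // ?oppr0 //.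
  by rewrite fx; case: (tpermP x y l) => [->|->|_ _]; rewrite B' // ?exy ?skew0 // ?oppr0 //.
case: (tpermP x y l) => [->|->|/eqP lx /eqP ly].
- by rewrite skf fy -sk B opprK.
- by rewrite skf fx -sk B.
rewrite /f mut_eps_row // [mut_eps e x y l]mut_eps_row0 // mut_eps_row //.
have -> : mut_eps e x k y = e k y.
  by rewrite (skew_mut x sk) mut_eps_row0 // -sk.
by rewrite B B' !opprK; ring.
Qed.

Lemma pres e P : skewsym e -> cyc e P -> bal e P -> eps_seq e (RP P) = e.
Proof.
elim: P e => [|z T IH] e sk cy B; first by case: cy.
have [u s _] := cy; rewrite /= ltnS in s.
have [s2|] := ltnP 1 (size T).
  rewrite RP_cons // -cat1s !eps_seq_cat IH; first exact: mut_eps2.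
  - exact: skew_mut.
  - exact: cyc_del.
  - exact: bal_del.
case: T s cy B u {IH} => [|y [|? ?]] //= _ [/= u _ H] B _ _.
have zy : z != y by case/andP: u; rewrite inE.
apply: pres2 => //.
  by rewrite H ?inE ?eqxx ?orbT //= (eq_sym y z) (negPf zy) ?eqxx.
by move=> k; have := B k; rewrite !big_cons big_nil; lia.
Qed.

End Cycles.

(** * Involutivity of R(P) and independence of the starting vertex *)

Section CycleMoves.
Local Open Scope ring_scope.
Variables (V : finType) (K : fieldType) (C : cone K).
Implicit Types (e : V -> V -> int) (P T : seq V) (u v w : seq (mstep V)).

Lemma eqv_cancel e u k w : skewsym e -> eqv C e (u ++ Mu k :: Mu k :: w) (u ++ w).
Proof.
by move=> sk; apply: (@eqv_ctx _ _ _ _ _ [:: _; _] [::]); apply: eqv_mu2; apply: skew_seq.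
Qed.

Lemma eqv_perm_word e a b (S : pred V) w : wsupp S w -> ~~ S a -> ~~ S b ->
  eqv C e (Perm (tperm a b) :: w) (w ++ [:: Perm (tperm a b)]).
Proof.
move=> sw Sa Sb; elim: w e sw => //= st w IH e [sst sw].
have neq x : S x -> (a != x) /\ (b != x).
  by move=> Sx; split; [apply: contraNneq Sa => -> | apply: contraNneq Sb => ->].
have H : eqv C e [:: Perm (tperm a b); st] [:: st; Perm (tperm a b)].
  case: st sst => [k|p] /= sst.
    by have := @eqv_perm_mu _ _ C e (tperm a b) k; have [? ?] := neq k sst; rewrite tpermV tpermD.
  case: sst => x [y [Sx Sy ->]]; have [? ?] := neq x Sx; have [? ?] := neq y Sy.
  apply: eqv_trans (@eqv_permM _ _ _ _ _ _) _; apply: eqv_sym.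
  by apply: eqv_trans (@eqv_permM _ _ _ _ _ _) _; rewrite conjgC tpermJ !tpermD.
apply: eqv_trans (@eqv_ctxr _ _ _ _ _ _ w H) _.
by apply: (@eqv_ctxl _ _ _ _ [:: st] (_ :: w) (w ++ _)); apply: IH.
Qed.

Lemma eqv_tperm2 e u a b w : eqv C e (u ++ Perm (tperm a b) :: Perm (tperm a b) :: w) (u ++ w).
Proof.
apply: (@eqv_ctx _ _ _ _ _ [:: _; _] [::]); apply: eqv_trans (@eqv_permM _ _ _ _ _ _) _.
by rewrite tperm2; apply: eqv_perm1.
Qed.

Lemma rp_invol e P : skewsym e -> cyc e P -> bal e P -> eqv C e (RP P ++ RP P) [::].
Proof.
elim: P e => [|z T IH] e sk cy B; first by case: cy.
have [u s _] := cy; rewrite /= ltnS in s.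
have [s2|] := ltnP 1 (size T).
  rewrite RP_cons // -(cat1s _ (RP T ++ _)) -!catA.
  have skz := skew_mut z sk; have cz := cyc_del sk cy s2; have bz := bal_del sk cy s2 B.
  apply: (@eqv_trans _ _ _ _ ([:: Mu z] ++ RP T ++ RP T ++ [:: Mu z])).
    apply: eqv_ctxl; apply: eqv_ctxl; apply: (@eqv_cancel _ [::] z (RP T ++ [:: Mu z])); do !apply: skew_seq => //.
  apply: (@eqv_trans _ _ _ _ ([:: Mu z; Mu z])); last exact: eqv_mu2.
  by rewrite (catA (RP T)); apply: (@eqv_ctx _ _ _ e [:: Mu z] _ [::] [:: Mu z]); apply: IH.
case: T s cy B u {IH} => [|y [|? ?]] //= _ cy _ _ _; rewrite RP2.
apply: (@eqv_trans _ _ _ _ [:: Mu z; Mu y; Mu y; Mu z; Perm (tperm z y); Perm (tperm z y)]).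
  apply: (@eqv_trans _ _ _ _ [:: Mu z; Mu y; Mu y; Perm (tperm z y); Mu y; Perm (tperm z y)]).
    apply: (@eqv_ctx _ _ _ _ [:: Mu z; Mu y] [:: _; _] [:: _; _]).
    by have := @eqv_perm_mu _ _ C (eps_seq e [:: Mu z; Mu y]) (tperm z y) z; rewrite tpermV tpermL.
  apply: (@eqv_ctx _ _ _ _ [:: Mu z; Mu y; Mu y] [:: _; _] [:: _; _]).
  by have := @eqv_perm_mu _ _ C (eps_seq e [:: Mu z; Mu y; Mu y]) (tperm z y) y; rewrite tpermV tpermR.
apply: eqv_trans (@eqv_tperm2 _ [:: _; _; _; _] _ _ [::]) _.
apply: eqv_trans (@eqv_cancel _ [:: _] _ [:: _] sk) _; exact: eqv_mu2.
Qed.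

Lemma rp_disc e P Q : skewsym e -> disc e (mem P) (mem Q) -> eqv C e (RP P ++ RP Q) (RP Q ++ RP P).
Proof. by move=> sk d; apply: (eqv_disc sk d); apply: wsupp_RP. Qed.

Lemma mem_cyc_pair e x y z T : cyc e [:: x, y, z & T] ->
  [/\ x != y, x != z, y != z & [/\ x \notin T, y \notin T & z \notin T]].
Proof.
case=> u _ _; move: u => /= /and4P []; rewrite !inE !negb_or => /and3P [-> -> ->] /andP [-> ->] ->.
by [].
Qed.

(** The smallest case in which the starting vertex matters, and the only one not reached by
    [rp_swap], which needs two vertices to remain. *)
Lemma rp_rot3 e x y z : skewsym e -> cyc e [:: x; y; z] -> eqv C e (RP [:: x; y; z]) (RP [:: y; z; x]).
Proof.
move=> sk cy; have [xy xz yz _] := mem_cyc_pair cy.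
have [yx zx zy] : [/\ y != x, z != x & z != y] by rewrite !(eq_sym _ x) (eq_sym z).
have [u _ H] := cy.
have nx : next [:: x; y; z] x = y by rewrite /= eqxx.
have ny : next [:: x; y; z] y = z by rewrite /= eqxx (negPf yx).
have nz : next [:: x; y; z] z = x by rewrite /= eqxx (negPf zx) (negPf zy).
have exy : e x y = 1 by rewrite H ?inE ?eqxx ?orbT // nx ny eqxx (negPf zx).
have eyz : e y z = 1 by rewrite H ?inE ?eqxx ?orbT // ny nz eqxx (negPf xy).
have ezx : e z x = 1 by rewrite H ?inE ?eqxx ?orbT // nx nz eqxx (negPf yz).
have eyx : e y x = -1 by rewrite sk exy.
have exz : e x z = -1 by rewrite sk ezx.
have ezy : e z y = -1 by rewrite sk eyz.
rewrite [RP [:: y; z; x]]RP_cons // RP2 [RP [:: x; y; z]]RP_cons // RP2 /=.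
set t1 := tperm x y; set t2 := tperm x z; set t3 := tperm y z.
apply: (@eqv_trans _ _ _ _ [:: Mu x; Mu y; Mu z; Mu x; Perm t3]).
  apply: (@eqv_ctxl _ _ _ _ [:: Mu x; Mu y; Mu z] [:: _; _] [:: _; _]).
  by have := @eqv_perm_mu _ _ C (eps_seq e [:: Mu x; Mu y; Mu z]) t3 x; rewrite tpermV tpermD.
(* The pentagon is used to lengthen the word: [Mu z; Mu x] becomes [Mu x; Mu z; Mu x] and a
   transposition, so that [Mu x; Mu y; Mu x] appears. *)
apply: (@eqv_trans _ _ _ _ [:: Mu x; Mu y; Mu x; Mu z; Mu x; Perm t2; Perm t3]).
  apply: (@eqv_ctx _ _ _ _ [:: Mu x; Mu y] [:: _; _] [:: _; _; _; _] [:: Perm t3]).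
  have sk2 := skew_seq [:: Mu x; Mu y] sk; set e2 := eps_seq e _ in sk2 *.
  have e2zx : e2 z x = -1.
    by rewrite /e2 /= mut_eps_row // !mut_eps_colk mut_eps_row // !(eyx, exz, ezx, eyz, ezy, exy).
  have pz : eqv C e2 [:: Mu z; Mu x; Mu z] [:: Mu x; Mu z; Perm (tperm z x)].
    by apply: eqv_pentagon => //; rewrite e2zx.
  apply: (@eqv_trans _ _ _ _ [:: Mu z; Mu x; Mu z; Mu z]).
    by apply: eqv_sym; apply: (@eqv_cancel _ [:: _; _] z [::]).
  apply: (@eqv_trans _ _ _ _ [:: Mu x; Mu z; Perm (tperm z x); Mu z]).
    exact: (@eqv_ctxr _ _ _ _ _ _ [:: Mu z] pz).
  apply: (@eqv_ctxl _ _ _ _ [:: Mu x; Mu z] [:: _; _] [:: _; _]).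
  by have := @eqv_perm_mu _ _ C (eps_seq e2 [:: Mu x; Mu z]) t2 z; rewrite tpermV tpermR tpermC.
apply: (@eqv_trans _ _ _ _ [:: Mu y; Mu x; Perm t1; Mu z; Mu x; Perm t2; Perm t3]).
  apply: (@eqv_ctxr _ _ _ _ [:: _; _; _] [:: _; _; _]).
  by apply: eqv_pentagon => //; rewrite exy.
apply: (@eqv_trans _ _ _ _ [:: Mu y; Mu x; Mu z; Perm t1; Mu x; Perm t2; Perm t3]).
  apply: (@eqv_ctx _ _ _ _ [:: Mu y; Mu x] [:: _; _] [:: _; _]).
  by have := @eqv_perm_mu _ _ C (eps_seq e [:: Mu y; Mu x]) t1 z; rewrite tpermV tpermD.
apply: (@eqv_trans _ _ _ _ [:: Mu y; Mu x; Mu z; Mu y; Perm t1; Perm t2; Perm t3]).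
  apply: (@eqv_ctx _ _ _ _ [:: Mu y; Mu x; Mu z] [:: _; _] [:: _; _]).
  by have := @eqv_perm_mu _ _ C (eps_seq e [:: Mu y; Mu x; Mu z]) t1 x; rewrite tpermV tpermL.
(* Mutation at [y] has cancelled the arrow from [z] to [x] against the path from [x] through [y] to
   [z], so [x] and [z] commute. *)
apply: (@eqv_trans _ _ _ _ [:: Mu y; Mu z; Mu x; Mu y; Perm t1; Perm t2; Perm t3]).
  apply: (@eqv_ctx _ _ _ _ [:: Mu y] [:: _; _] [:: _; _]); apply: eqv_mu_comm => //; first exact: skew_mut.
  by rewrite /= mut_eps_row // exz eyz exy /pp; lia.
apply: (@eqv_trans _ _ _ _ [:: Mu y; Mu z; Mu x; Mu y; Perm (tperm z x)]).
  apply: (@eqv_ctxl _ _ _ _ [:: _; _; _; _] [:: _; _; _] [:: _]).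
  apply: eqv_trans (@eqv_ctxr _ _ _ _ [:: _; _] _ [:: _] (@eqv_permM _ _ _ _ _ _)) _.
  apply: eqv_trans (@eqv_permM _ _ _ _ _ _) _; rewrite (_ : (t1 * t2 * t3)%g = tperm z x) //.
  apply/permP => a; rewrite !permM /t1 /t2 /t3; have [->|ax] := eqVneq a x.
    by rewrite tpermL (tpermD xy zy) tpermL tpermR.
  have [->|ay] := eqVneq a y; first by rewrite tpermR tpermL tpermR (tpermD zy xy).
  have [->|az] := eqVneq a z; first by rewrite (tpermD xz yz) tpermR (tpermD yx zx) tpermL.
  by rewrite !tpermD // eq_sym.
apply: (@eqv_ctxl _ _ _ _ [:: Mu y; Mu z; Mu x] [:: _; _] [:: _; _]); apply: eqv_sym.
by have := @eqv_perm_mu _ _ C (eps_seq e [:: Mu y; Mu z; Mu x]) (tperm z x) y; rewrite tpermV tpermD.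
Qed.

(** After mutation at [x] and [y], vertex [x] is disconnected from [T]. A pair of mutations at [x]
    can thus be inserted and one of them carried across R(T), which leaves R(T) between two triples
    [x, y, x]. The pentagon turns both into [y, x] and a transposition, and the transpositions meet
    and cancel. *)
Lemma rp_swap e x y T : skewsym e -> cyc e [:: x, y & T] -> bal e [:: x, y & T] -> (1 < size T)%N ->
  eqv C e (Mu x :: Mu y :: RP T ++ [:: Mu y; Mu x]) (Mu y :: Mu x :: RP T ++ [:: Mu x; Mu y]).
Proof.
move=> sk cy B sT.
have skx := skew_mut x sk; have cyx : cyc (mut_eps e x) (y :: T) by apply: cyc_del => //; rewrite /= ltnW.
have Bx : bal (mut_eps e x) (y :: T) by apply: bal_del => //; rewrite /= ltnW.
have cyy := cyc_del skx cyx sT; have By := bal_del skx cyx sT Bx.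
have sky := skew_mut y skx.
set e2 := mut_eps (mut_eps e x) y in cyy By sky.
have [u s H] := cy.
have [xn yn] : x \notin T /\ y \notin T.
  by move: u => /= /and3P []; rewrite inE negb_or => /andP [_ ->] ->.
have xy : x != y by move: u => /= /andP []; rewrite inE negb_or => /andP [].
have yx : y != x by rewrite eq_sym.
have T0 : T != [::] by case: (T) sT.
case: T T0 sT {s} cy cyx B Bx cyy By u H xn yn => [|h T] // _ sT cy cyx B Bx cyy By u H xn yn.
have T0 : T != [::] by case: (T) sT.
have d2 z : z \in h :: T -> e2 x z = 0.
  move=> zT; have zx : z != x by apply: contraNneq xn => <-.
  have zy : z != y by apply: contraNneq yn => <-.
  have zyT : z \in y :: h :: T by rewrite inE zT orbT.
  have [yl _ exz pxz mxz] := cyc_head sk cy (erefl true) zyT.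
  have [_ _ exy _ _] := cyc_head sk cy (erefl true) (mem_head y _).
  have [_ _ eyz pyz myz] := cyc_head skx cyx T0 zT.
  rewrite /e2 mut_eps_row // mut_eps_rowk mut_eps_rowk pyz myz exz exy eqxx (negPf yl) (negPf zy) subr0 opprK !pp1 /=.
  by rewrite -/(last h T) mul0r; case: (z == last h T).
have exy2 : e2 x y = 1.
  have [yl _ exy _ _] := cyc_head sk cy (erefl true) (mem_head y _).
  by rewrite /e2 mut_eps_colk mut_eps_rowk opprK exy eqxx (negPf yl).
have sk3 := skew_mut x sky; set e3 := mut_eps e2 x in sk3.
have colz k z : z \in h :: T -> e3 k z = e2 k z.
  move=> zT; have zx : z != x by apply: contraNneq xn => <-.
  by rewrite sk3 /e3 mut_eps_row0 -?sky // sky d2 ?oppr0.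
have cy3 : cyc e3 (h :: T).
  by case: cyy => u3 s3 H3; split => // a b aT bT; rewrite colz // H3.
have B3 : bal e3 (h :: T).
  by move=> k; rewrite -[RHS](By k); apply: eq_big_seq => z zT; rewrite colz.
have pr3 := pres sk3 cy3 B3.
have P12 : eqv C e [:: Mu x; Mu y; Mu x] [:: Mu y; Mu x; Perm (tperm x y)].
  apply: eqv_pentagon => //; have [yl _ exy _ _] := cyc_head sk cy (erefl true) (mem_head y _).
  by rewrite exy eqxx (negPf yl).
(* R(T) preserves the matrix [e3] reached after the first triple, so the second triple starts from
   the same matrix. *)
have P3 : eqv C e3 [:: Mu x; Mu y; Mu x] [:: Mu y; Mu x; Perm (tperm x y)].
  by apply: eqv_pentagon => //; rewrite /e3 mut_eps_rowk exy2.
set R := RP (h :: T).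
have sR : wsupp (mem (h :: T)) R by apply: wsupp_RP.
apply: (@eqv_trans _ _ _ _ ([:: Mu x; Mu y; Mu x] ++ R ++ [:: Mu x; Mu y; Mu x])).
  apply: (@eqv_trans _ _ _ _ ([:: Mu x; Mu y; Mu x; Mu x] ++ R ++ [:: Mu y; Mu x])).
    by apply: eqv_sym; apply: (@eqv_cancel e [:: Mu x; Mu y] x).
  apply: (@eqv_ctxl _ _ _ e [:: Mu x; Mu y; Mu x] ((Mu x :: R) ++ _) (R ++ [:: Mu x] ++ _)).
  rewrite (catA R); apply: eqv_ctxr; apply: (@eqv_disc _ _ _ _ (pred1 x) (mem (h :: T)) [:: Mu x] R) => //=.
  move=> a b /= /eqP -> bT; split; first by apply: contraNneq xn => ->.
  by rewrite -[LHS]/(mut_eps e2 x x b) mut_eps_rowk d2 ?oppr0.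
have E3 : eps_seq e ([:: Mu x; Mu y; Mu x] ++ R) = e3 by rewrite eps_seq_cat -[eps_seq e _]/e3 pr3.
apply: (@eqv_trans _ _ _ _ ([:: Mu x; Mu y; Mu x] ++ R ++ [:: Perm (tperm x y); Mu x; Mu y])).
  rewrite !catA; apply: eqv_ctxl; rewrite E3; apply: eqv_trans P3 _.
  apply: eqv_sym; apply: (@eqv_trans _ _ _ _ [:: Mu y; Perm (tperm x y); Mu y]).
    apply: (@eqv_ctxr _ _ _ _ [:: _; _] [:: _; _]).
    by have := @eqv_perm_mu _ _ C e3 (tperm x y) x; rewrite tpermV tpermL.
  apply: (@eqv_ctxl _ _ _ _ [:: _] [:: _; _] [:: _; _]).
  by have := @eqv_perm_mu _ _ C (eps_seq e3 [:: Mu y]) (tperm x y) y; rewrite tpermV tpermR.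
apply: eqv_trans (@eqv_ctxr _ _ _ _ _ _ _ P12) _.
apply: (@eqv_trans _ _ _ _ ([:: Mu y; Mu x] ++ R ++ [:: Perm (tperm x y); Perm (tperm x y); Mu x; Mu y])).
  apply: (@eqv_ctxl _ _ _ _ [:: Mu y; Mu x] (Perm _ :: R ++ _)).
  rewrite -cat_cons -[[:: Perm _, Perm _ & _]]cat1s catA; apply: eqv_ctxr.
  exact: eqv_perm_word sR xn yn.
by rewrite !catA; apply: eqv_tperm2.
Qed.

(** For length at least 4, strip [z] and [y], exchange them by [rp_swap], put [z] back, rotate the
    shorter cycle by induction and put [y] back. *)
Lemma rp_rot e z T : skewsym e -> cyc e (z :: T) -> bal e (z :: T) -> eqv C e (RP (z :: T)) (RP (rcons T z)).
Proof.
elim: {T}(size T) {-2}T (leqnn (size T)) e z => [|n IH] [|y T] sT e z sk cy B; try by case: cy.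
case: T sT cy B => [|t [|t' T]] sT cy B.
- have [u _ H] := cy; have zy : z != y by case/andP: u; rewrite inE.
  rewrite !RP2 tpermC; apply: (@eqv_ctxr _ _ _ _ [:: _; _] [:: _; _]); apply: eqv_mu_comm => //.
  by rewrite H ?inE ?eqxx ?orbT //= (eq_sym y z) (negPf zy) ?eqxx.
- exact: rp_rot3.
have skz := skew_mut z sk; have cz := cyc_del sk cy (erefl true).
rewrite RP_cons // [RP (y :: _)]RP_cons //.
rewrite rcons_cons [RP (y :: _)]RP_cons ?size_rcons //.
set U := [:: t, t' & T]; rewrite -/U in cy B sT *.
have := @rp_swap e z y U sk cy B (erefl true).
rewrite /= -catA /= => h; apply: eqv_trans h _.
rewrite -[Mu z :: RP U ++ _]/((Mu z :: RP U) ++ _) -[[:: Mu z; Mu y]]/([:: Mu z] ++ [:: Mu y]) catA cat_cons -RP_cons //.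
apply: (@eqv_ctx _ _ _ e [:: Mu y]); apply: IH => //; first exact: skew_mut.
  by apply: cyc_rotr; apply: cyc_del => //; apply: cyc_rot cy.
apply: (@bal_perm _ _ (rcons U z)); first by rewrite perm_rcons.
by apply: bal_del => //; [apply: cyc_rot cy | apply: bal_rot B].
Qed.

End CycleMoves.

Definition gp (K : fieldType) (X Y : K) : K := (X * (1 + Y) / (1 + X))%R.

(** * The action of R(P) for a cycle of length 2 *)

Section PairMove.
Local Open Scope ring_scope.
Variables (V : finType) (K : fieldType) (C : cone K).
Implicit Types (e : V -> V -> int) (s : seed V K).

Definition R2 (x y : V) := [:: Mu x; Mu y; Perm (tperm x y)].

(** Factor gained by the variable of a vertex [k] outside the pair, with [n] the entry from [k] to
    the first vertex; the entry to the second is [- n]. For each sign of [n] it is a power of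
    [gp]. *)
Definition gfac (X Y : K) (n : int) : K := X ^ pp n * (1 + X) ^ (- n) * (Y ^ pp (- n) * (1 + Y) ^ n).

Definition exchg e (A : V -> K) (x : V) := mon A (fun j => pp (e x j)) + mon A (fun j => pp (- e x j)).

Lemma gfac_pos X Y n : C X -> C Y -> 0 <= n -> gfac X Y n = gp X Y ^ n.
Proof.
move=> CX CY n0; have X1 := cpos_neq0 (cposD (cpos1 C) CX).
have [p1 p2] : pp n = n /\ pp (- n) = 0 by split; rewrite /pp; lia.
rewrite /gfac p1 p2 /gp.
by rewrite expr0z mul1r !expfzMl exprz_inv; ring.
Qed.

Lemma gfac_neg X Y n : C X -> C Y -> n <= 0 -> gfac X Y n = gp Y X ^ (- n).
Proof.
move=> CX CY n0.
have [p1 p2] : pp n = 0 /\ pp (- n) = - n by split; rewrite /pp; lia.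
rewrite /gfac p1 p2 /gp.
by rewrite expr0z mul1r !expfzMl exprz_inv opprK; ring.
Qed.

Lemma R2X e x y s : x != y -> skewsym e -> e x y = 0 -> (forall k, e k y = - e k x) ->
  seps s = e -> pos_seed C s -> let s' := apply_seq s (R2 x y) in
  [/\ sX s' x = (sX s y)^-1, sX s' y = (sX s x)^-1 &
      forall k, k != x -> k != y -> sX s' k = sX s k * gfac (sX s x) (sX s y) (e k x)].
Proof.
move=> xy sk exy B se ps s'; have yx : y != x by rewrite eq_sym.
have eyx : e y x = 0 by rewrite sk exy.
have p1 : pos_seed C (mut_seed s x) := pos_step (Mu x) ps.
have Xy : sX (mut_seed s x) y = sX s y by apply: (mutX_row0 ps) => //; rewrite se.
have sE k : sX s' k = sX (mut_seed (mut_seed s x) y) (tperm x y k) by rewrite -[in RHS]tpermV.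
split; first by rewrite sE tpermL mutX_eq Xy.
  rewrite sE tpermR (mutX_row0 p1) // ?mutX_eq //= se mut_eps_rowk exy oppr0 //.
move=> k kx ky; rewrite sE tpermD 1?eq_sym // (mutXE p1 ky) Xy (mutXE ps kx) se.
have -> : seps (mut_seed s x) k y = - e k x.
  by rewrite /= se (skew_mut x sk) mut_eps_row0 // -sk B.
by rewrite /gfac opprK; ring.
Qed.

(** Opposite rows give [x] and [y] the same exchange binomial. Each new variable is this binomial
    over an old one, and after the swap both variables of the pair have been multiplied by the same
    factor. *)
Lemma R2A e x y s : x != y -> skewsym e -> e x y = 0 -> (forall k, e k y = - e k x) ->
  seps s = e -> pos_seed C s -> let s' := apply_seq s (R2 x y) in
  let r := exchg e (sA s) x / (sA s x * sA s y) in
  forall k, sA s' k = sA s k * (if (k == x) || (k == y) then r else 1).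
Proof.
move=> xy sk exy B se ps s' r k; have yx : y != x by rewrite eq_sym.
have eyx : e y x = 0 by rewrite sk exy.
have sE : sA s' k = sA (mut_seed (mut_seed s x) y) (tperm x y k) by rewrite -[in RHS]tpermV.
have x0 := cpos_neq0 (ps.2 x); have y0 := cpos_neq0 (ps.2 y).
have Ey l : mut_eps e x y l = - e x l by rewrite mut_eps_row0 // sk B opprK -sk.
rewrite sE; case: tpermP => [->|->|/eqP kx /eqP ky].
- rewrite eqxx mutAE (mutA_neq _ yx) /r /exchg /= se.
  transitivity ((sA s y)^-1 * (mon (sA s) (fun j => pp (- e x j)) + mon (sA s) (fun j => pp (e x j)))).
    congr (_ * (_ + _)); apply: eq_mon => l; rewrite Ey ?opprK //; case: (l =P x) => // ->;
    by rewrite skew0 // ?oppr0 /pp maxxx eqxx.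
  by field; rewrite x0 y0.
- by rewrite eqxx orbT (mutA_neq _ xy) mutAE se /r /exchg; field; rewrite x0 y0.
by rewrite !mutA_neq // (negPf kx) (negPf ky) mulr1.
Qed.

Lemma mon_scale (A A' : V -> K) (r : K) x y (f : V -> int) : x != y -> r != 0 ->
  (forall k, A' k = A k * (if (k == x) || (k == y) then r else 1)) ->
  mon A' f = mon A f * r ^ (f x + f y).
Proof.
move=> xy r0 AA; rewrite /mon (eq_bigr (fun k => A k ^ f k * (if (k == x) || (k == y) then r else 1) ^ f k)).
  rewrite big_split /=; congr (_ * _).
  rewrite (bigD1 x) //= (bigD1 y) /= 1?eq_sym // !eqxx orbT /= big1 ?mulr1 ?expfzDr // => k.
  by case/andP => /negPf -> /negPf ->; rewrite exp1rz.
by move=> k _; rewrite AA expfzMl.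
Qed.

End PairMove.

Ltac cpos_tac := do ?[ done | apply: cposD | apply: cposM | apply: cposV | apply: cpos1 ].

(** * The braid relation for two linked pairs *)

Section Braid2Identities.
Local Open Scope ring_scope.
Variables (K : fieldType) (C : cone K) (X1 X2 Y1 Y2 : K).
Hypotheses (C1 : C X1) (C2 : C X2) (D1 : C Y1) (D2 : C Y2).

(** Numerators of [1 + Y1a], [1 + Y2a], [1 + X1b] and [1 + X2b], the only new polynomials that arise
    in the braid relation. *)
Let P : K := 1 + X2 + X2 * Y1 + X1 * X2 * Y1.
Let Q : K := 1 + X1 + X1 * Y2 + X1 * X2 * Y2.
Let S : K := 1 + Y1 + X1 * Y1 + X1 * Y1 * Y2.
Let T : K := 1 + Y2 + X2 * Y2 + X2 * Y1 * Y2.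

(** [X] belongs to the pair of [a], [Y] to that of [b]. The suffix lists the moves already made,
    from left to right. *)
Let Y1a := Y1 * gp X2 X1.
Let Y2a := Y2 * gp X1 X2.
Let X1ab := X2^-1 * gp Y1a Y2a.
Let X2ab := X1^-1 * gp Y2a Y1a.
Let X1b := X1 * gp Y1 Y2.
Let X2b := X2 * gp Y2 Y1.
Let Y1ba := Y2^-1 * gp X2b X1b.
Let Y2ba := Y1^-1 * gp X1b X2b.

Lemma braid2X :
  [/\ X2ab^-1 = X2b^-1 * gp Y1ba Y2ba, X1ab^-1 = X1b^-1 * gp Y2ba Y1ba,
      Y2a^-1 * gp X2ab X1ab = Y2ba^-1 & Y1a^-1 * gp X1ab X2ab = Y1ba^-1] /\
  [/\ gp X1 X2 * gp X1ab X2ab = gp X1b X2b, gp X2 X1 * gp X2ab X1ab = gp X2b X1b,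
      gp Y1a Y2a = gp Y1 Y2 * gp Y1ba Y2ba & gp Y2a Y1a = gp Y2 Y1 * gp Y2ba Y1ba].
Proof.
have fin := (@cpos_neq0 _ C).
have [x1 x2 y1 y2] : [/\ X1 != 0, X2 != 0, Y1 != 0 & Y2 != 0] by split; apply: fin.
have [x1' x2' y1' y2'] : [/\ 1 + X1 != 0, 1 + X2 != 0, 1 + Y1 != 0 & 1 + Y2 != 0].
  by split; apply: fin; cpos_tac.
have [P0 Q0 S0 T0] : [/\ P != 0, Q != 0, S != 0 & T != 0].
  by split; apply: fin; rewrite /P /Q /S /T; cpos_tac.
have gpE (X Y X' Y' : K) : 1 + X = X' -> 1 + Y = Y' -> gp X Y = X * Y' / X' by move=> <- <-.
have gX : gp X1 X2 = X1 * (1 + X2) / (1 + X1) by [].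
have gX' : gp X2 X1 = X2 * (1 + X1) / (1 + X2) by [].
have gY : gp Y1 Y2 = Y1 * (1 + Y2) / (1 + Y1) by [].
have gY' : gp Y2 Y1 = Y2 * (1 + Y1) / (1 + Y2) by [].
have p1 : 1 + Y1a = P / (1 + X2) by rewrite /Y1a gX' /P; field.
have p2 : 1 + Y2a = Q / (1 + X1) by rewrite /Y2a gX /Q; field.
have p3 : 1 + X1b = S / (1 + Y1) by rewrite /X1b gY /S; field.
have p4 : 1 + X2b = T / (1 + Y2) by rewrite /X2b gY' /T; field.
(* These four relations hold all the cancellation that is needed. Afterwards the polynomials are
   made opaque by [clearbody], which keeps the [field] goals small. *)
have e1 : P + Y1 * Q = (1 + X2) * S by rewrite /P /Q /S; ring.
have e2 : Q + Y2 * P = (1 + X1) * T by rewrite /P /Q /T; ring.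
have e3 : S + X1 * T = (1 + Y1) * Q by rewrite /S /T /Q; ring.
have e4 : T + X2 * S = (1 + Y2) * P by rewrite /S /T /P; ring.
have gYa : gp Y1a Y2a = Y1 * X2 * Q / P.
  by rewrite (gpE _ _ _ _ p1 p2) /Y1a gX'; clearbody P Q S T; field; rewrite P0 x1' x2'.
have gYa' : gp Y2a Y1a = Y2 * X1 * P / Q.
  by rewrite (gpE _ _ _ _ p2 p1) /Y2a gX; clearbody P Q S T; field; rewrite Q0 x1' x2'.
have gXb : gp X1b X2b = X1 * Y1 * T / S.
  by rewrite (gpE _ _ _ _ p3 p4) /X1b gY; clearbody P Q S T; field; rewrite S0 y1' y2'.
have gXb' : gp X2b X1b = X2 * Y2 * S / T.
  by rewrite (gpE _ _ _ _ p4 p3) /X2b gY'; clearbody P Q S T; field; rewrite T0 y1' y2'.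
have q1 : X1ab = Y1 * Q / P by rewrite /X1ab gYa; clearbody P Q S T; field; rewrite P0 x2.
have q2 : X2ab = Y2 * P / Q by rewrite /X2ab gYa'; clearbody P Q S T; field; rewrite Q0 x1.
have q3 : Y1ba = X2 * S / T by rewrite /Y1ba gXb'; clearbody P Q S T; field; rewrite T0 y2.
have q4 : Y2ba = X1 * T / S by rewrite /Y2ba gXb; clearbody P Q S T; field; rewrite S0 y1.
have r1 : 1 + X1ab = (1 + X2) * S / P by rewrite q1 -e1; clearbody P Q S T; field.
have r2 : 1 + X2ab = (1 + X1) * T / Q by rewrite q2 -e2; clearbody P Q S T; field.
have r3 : 1 + Y1ba = (1 + Y2) * P / T by rewrite q3 -e4; clearbody P Q S T; field.
have r4 : 1 + Y2ba = (1 + Y1) * Q / S by rewrite q4 -e3; clearbody P Q S T; field.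
have gXab : gp X1ab X2ab = Y1 * (1 + X1) * T / ((1 + X2) * S).
  by rewrite (gpE _ _ _ _ r1 r2) q1; clearbody P Q S T; field; rewrite P0 Q0 S0 x2'.
have gXab' : gp X2ab X1ab = Y2 * (1 + X2) * S / ((1 + X1) * T).
  by rewrite (gpE _ _ _ _ r2 r1) q2; clearbody P Q S T; field; rewrite P0 Q0 T0 x1'.
have gYba : gp Y1ba Y2ba = X2 * (1 + Y1) * Q / ((1 + Y2) * P).
  by rewrite (gpE _ _ _ _ r3 r4) q3; clearbody P Q S T; field; rewrite P0 S0 T0 y2'.
have gYba' : gp Y2ba Y1ba = X1 * (1 + Y2) * P / ((1 + Y1) * Q).
  by rewrite (gpE _ _ _ _ r4 r3) q4; clearbody P Q S T; field; rewrite Q0 S0 T0 y1'.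
do !split.
- rewrite gYba q2 /X2b gY'; clearbody P Q S T; field; do ?[apply/andP; split] => //.
- rewrite gYba' q1 /X1b gY; clearbody P Q S T; field; do ?[apply/andP; split] => //.
- rewrite gXab' q4 /Y2a gX; clearbody P Q S T; field; do ?[apply/andP; split] => //.
- rewrite gXab q3 /Y1a gX'; clearbody P Q S T; field; do ?[apply/andP; split] => //.
- rewrite gX gXab gXb; clearbody P Q S T; field; do ?[apply/andP; split] => //.
- rewrite gX' gXab' gXb'; clearbody P Q S T; field; do ?[apply/andP; split] => //.
- rewrite gYa gY gYba; clearbody P Q S T; field; do ?[apply/andP; split] => //.
- rewrite gYa' gY' gYba'; clearbody P Q S T; field; do ?[apply/andP; split] => //.
Qed.
End Braid2Identities.

Section Braid2.
Local Open Scope ring_scope.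
Variables (V : finType) (K : fieldType) (C : cone K).
Variables (e : V -> V -> int) (a1 a2 b1 b2 : V).
Hypotheses (sk : skewsym e) (a12 : a1 != a2) (b12 : b1 != b2).
Hypotheses (ab11 : a1 != b1) (ab12 : a1 != b2) (ab21 : a2 != b1) (ab22 : a2 != b2).
Hypotheses (ea : e a1 a2 = 0) (eb : e b1 b2 = 0) (Ba : forall k, e k a2 = - e k a1)
  (Bb : forall k, e k b2 = - e k b1) (eab : e a1 b1 = 1).

Let prA : eps_seq e (R2 a1 a2) = e. Proof. exact: pres2. Qed.
Let prB : eps_seq e (R2 b1 b2) = e. Proof. exact: pres2. Qed.

(** The hypotheses make [a1 -> b1 -> a2 -> b2 -> a1] an oriented square, and every other vertex sees
    each pair through one integer. *)
Lemma braid2 : eqv C e (R2 a1 a2 ++ R2 b1 b2 ++ R2 a1 a2) (R2 b1 b2 ++ R2 a1 a2 ++ R2 b1 b2).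
Proof.
move=> s se ps; rewrite !apply_seq_cat.
have name (s' : seed V K) w : exists s'', s'' = apply_seq s' w by eexists.
have [sa saE] := name s (R2 a1 a2); have [sb sbE] := name s (R2 b1 b2).
have [sab sabE] := name sa (R2 b1 b2); have [sba sbaE] := name sb (R2 a1 a2).
have [saba sabaE] := name sab (R2 a1 a2); have [sbab sbabE] := name sba (R2 b1 b2).
rewrite -saE -sbE -sabE -sbaE -sabaE -sbabE {name}.
have [pa pb] : pos_seed C sa /\ pos_seed C sb by rewrite saE sbE; split; apply: pos_seq.
have [pab pba] : pos_seed C sab /\ pos_seed C sba by rewrite sabE sbaE; split; apply: pos_seq.
have [ga gb] : seps sa = e /\ seps sb = e by rewrite saE sbE !seps_seq se prA prB.
have [gab gba] : seps sab = e /\ seps sba = e by rewrite sabE sbaE !seps_seq ga gb prA prB.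
have [e11 e12 e21 e22] : [/\ e b1 a1 = -1, e b2 a1 = 1, e a1 b1 = 1 & e a2 b1 = -1].
  split => //; first by rewrite sk eab.
    by rewrite sk Bb opprK eab.
  by rewrite sk Ba opprK sk eab.
have [ba11 ba12 ba21 ba22] : [/\ b1 != a1, b2 != a1, b1 != a2 & b2 != a2] by rewrite !(eq_sym b1) !(eq_sym b2).
apply: seedP.
- by rewrite sabaE sbabE !seps_seq gab gba prA prB.
- have [F1 F2 F3] := R2X a12 sk ea Ba se ps; rewrite -saE in F1 F2 F3.
  have [F4 F5 F6] := R2X b12 sk eb Bb ga pa; rewrite -sabE in F4 F5 F6.
  have [F7 F8 F9] := R2X a12 sk ea Ba gab pab; rewrite -sabaE in F7 F8 F9.
  have [G1 G2 G3] := R2X b12 sk eb Bb se ps; rewrite -sbE in G1 G2 G3.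
  have [G4 G5 G6] := R2X a12 sk ea Ba gb pb; rewrite -sbaE in G4 G5 G6.
  have [G7 G8 G9] := R2X b12 sk eb Bb gba pba; rewrite -sbabE in G7 G8 G9.
  have C1 := ps.1 a1; have C2 := ps.1 a2; have D1 := ps.1 b1; have D2 := ps.1 b2.
  move: F1 F2 F4 F5 G1 G2 G4 G5 (F3 _ ba11 ba21) (F3 _ ba12 ba22) (F6 _ ab11 ab12) (F6 _ ab21 ab22)
   (G3 _ ab11 ab12) (G3 _ ab21 ab22) (G6 _ ba11 ba21) (G6 _ ba12 ba22) (F9 _ ba11 ba21) (F9 _ ba12 ba22) (G9 _ ab11 ab12) (G9 _ ab21 ab22).
  rewrite e11 e12 e21 e22.
  have gf1 (X Y : K) : gfac X Y 1 = gp X Y.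
    by rewrite /gfac /gp !pp1 expr0z !expr1z -invr_expz expr1z; ring.
  have gfN (X Y : K) : gfac X Y (-1) = gp Y X.
    by rewrite /gfac /gp !pp1 opprK expr0z !expr1z -invr_expz expr1z; ring.
  move=> F1 F2 F4 F5 G1 G2 G4 G5 H1 H2 H3 H4 I1 I2 I3 I4 J1 J2 L1 L2.
  rewrite gfN in H1; rewrite gf1 in H2; rewrite gf1 in H3; rewrite gfN in H4.
  rewrite gf1 in I1; rewrite gfN in I2; rewrite gfN in I3; rewrite gf1 in I4.
  rewrite gfN in J1; rewrite gf1 in J2; rewrite gf1 in L1; rewrite gfN in L2.
  rewrite F1 F2 H1 H2 in H3 H4; rewrite G1 G2 I1 I2 in I3 I4.
  rewrite H1 H2 in F4 F5; rewrite I1 I2 in G4 G5.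
  rewrite H3 H4 in F7 F8; rewrite I3 I4 in G7 G8; rewrite F4 F5 H3 H4 in J1 J2; rewrite G4 G5 I3 I4 in L1 L2.
  have [[E1 E2 E3 E4] [E5 E6 E7 E8]] := braid2X C1 C2 D1 D2.
  move=> k; have [->|ka1] := eqVneq k a1; first by rewrite F7 L1.
  have [->|ka2] := eqVneq k a2; first by rewrite F8 L2.
  have [->|kb1] := eqVneq k b1; first by rewrite G7 J1.
  have [->|kb2] := eqVneq k b2; first by rewrite G8 J2.
  rewrite F9 // F6 // F3 // G9 // G6 // G3 //.
  (* The two moves along the first pair in one word have the combined effect of the single such move
     in the other word. For each sign of the exponent this is a power of an identity of
     [braid2X]. *)
  have Ca : gfac (sX s a1) (sX s a2) (e k a1) * gfac (sX sab a1) (sX sab a2) (e k a1) = gfac (sX sb a1) (sX sb a2) (e k a1).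
    have [n0|/ltW n0] := leP 0 (e k a1).
      rewrite (gfac_pos C1 C2 n0) (gfac_pos (pab.1 _) (pab.1 _) n0) (gfac_pos (pb.1 _) (pb.1 _) n0).
      by rewrite H3 H4 I1 I2 -E5 expfzMl.
    rewrite (gfac_neg C1 C2 n0) (gfac_neg (pab.1 _) (pab.1 _) n0) (gfac_neg (pb.1 _) (pb.1 _) n0).
    by rewrite H3 H4 I1 I2 -E6 expfzMl.
  have Cb : gfac (sX sa b1) (sX sa b2) (e k b1) = gfac (sX s b1) (sX s b2) (e k b1) * gfac (sX sba b1) (sX sba b2) (e k b1).
    have [n0|/ltW n0] := leP 0 (e k b1).
      rewrite (gfac_pos D1 D2 n0) (gfac_pos (pa.1 _) (pa.1 _) n0) (gfac_pos (pba.1 _) (pba.1 _) n0).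
      by rewrite H1 H2 I3 I4 E7 expfzMl.
    rewrite (gfac_neg D1 D2 n0) (gfac_neg (pa.1 _) (pa.1 _) n0) (gfac_neg (pba.1 _) (pba.1 _) n0).
    by rewrite H1 H2 I3 I4 E8 expfzMl.
  by rewrite -Ca Cb; ring.
have exch_pos s' x : pos_seed C s' -> C (exchg e (sA s') x).
  by move=> [_ CA]; apply: cposD; apply: cpos_mon.
(* In both monomials of the binomial at [z] the scaling factor has the same exponent, namely the
   absolute value of [e z x], so the binomial as a whole is multiplied by a power of [r]. *)
have step x y z s' (r := exchg e (sA s') x / (sA s' x * sA s' y)) : x != y -> e x y = 0 ->
    (forall k, e k y = - e k x) -> seps s' = e -> pos_seed C s' ->
    [/\ r != 0, forall k, sA (apply_seq s' (R2 x y)) k = sA s' k * (if (k == x) || (k == y) then r else 1) &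
      exchg e (sA (apply_seq s' (R2 x y))) z =
      mon (sA s') (fun j => pp (e z j)) * r ^ (pp (e z x) + pp (- e z x)) +
      mon (sA s') (fun j => pp (- e z j)) * r ^ (pp (e z x) + pp (- e z x))].
  move=> xy exy Bxy se' ps'; have r0 : r != 0.
    by apply: (@cpos_neq0 _ C); apply: cposM; [apply: exch_pos | apply/cposV/cposM; apply: ps'.2].
  have SA := R2A xy sk exy Bxy se' ps'; split => //.
  by rewrite /exchg !(mon_scale _ xy r0 SA) !Bxy !opprK (addrC (pp (- e z x))).
have [ra0 SA NA] := step a1 a2 b1 s a12 ea Ba se ps.
have [_ _ NA'] := step a1 a2 a1 s a12 ea Ba se ps.
have [rb0 SB NB] := step b1 b2 a1 s b12 eb Bb se ps.
have [_ _ NB'] := step b1 b2 b1 s b12 eb Bb se ps.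
have [rab0 SAB NAB] := step b1 b2 a1 sa b12 eb Bb ga pa.
have [rba0 SBA NBA] := step a1 a2 b1 sb a12 ea Ba gb pb.
have [_ SABA _] := step a1 a2 a1 sab a12 ea Ba gab pab.
have [_ SBAB _] := step b1 b2 b1 sba b12 eb Bb gba pba.
move: NA NA' NB NB' NAB NBA; rewrite e11 e21 !skew0 // !oppr0 !pp1 !expr0z !expr1z !mulr1 -!mulrDl.
rewrite -!/(exchg e _ _) -saE -sbE -sabE -sbaE => NA NA' NB NB' NAB NBA k.
rewrite -saE in SA; rewrite -sbE in SB; rewrite -sabE in SAB; rewrite -sbaE in SBA.
rewrite -sabaE in SABA; rewrite -sbabE in SBAB.
rewrite SABA SBAB NAB NBA ?NA ?NB ?NA' ?NB' !SAB !SBA ?NA ?NB ?NA' ?NB' !SA !SB.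
rewrite !eqxx !(negPf ab11, negPf ab12, negPf ab21, negPf ab22, negPf ba11, negPf ba12, negPf ba21, negPf ba22) ?orbT /= !mulr1.
have Na := cpos_neq0 (exch_pos s a1 ps); have Nb := cpos_neq0 (exch_pos s b1 ps).
have [A1 A2 B1 B2] : [/\ sA s a1 != 0, sA s a2 != 0, sA s b1 != 0 & sA s b2 != 0].
  by split; apply: (@cpos_neq0 _ C); apply: ps.2.
have [->|ka1] := eqVneq k a1.
  rewrite !(negPf ab11, negPf ab12) /=; field; do ?[apply/andP; split] => //.
have [->|ka2] := eqVneq k a2.
  rewrite !(negPf ab21, negPf ab22) /=; field; do ?[apply/andP; split] => //.
case: ifP => _ /=; last by rewrite !mulr1.
field; do ?[apply/andP; split] => //.
Qed.
End Braid2.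

(** * The braid relation for linked cycles of any length *)

Section LinkedCycles.
Local Open Scope ring_scope.
Variables (V : finType) (K : fieldType) (C : cone K).
Implicit Types (e : V -> V -> int) (P T A B S : seq V).

Lemma rp_rotn e P1 P2 : skewsym e -> cyc e (P1 ++ P2) -> bal e (P1 ++ P2) ->
  [/\ cyc e (P2 ++ P1), bal e (P2 ++ P1) & eqv C e (RP (P1 ++ P2)) (RP (P2 ++ P1))].
Proof.
move=> sk; elim: P1 P2 => [|z P1 IH] P2 cy B; first by rewrite cats0.
rewrite cat_cons in cy B.
have := IH (rcons P2 z); rewrite -rcons_cat => /(_ (cyc_rot cy) (bal_rot B)).
rewrite cat_rcons => -[? ? h]; split => //; apply: eqv_trans h; exact: rp_rot.
Qed.

(** Rotate [z] to the front, strip it there, and rotate the rest back in the mutated quiver. *)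
Lemma rp_del e P1 z P2 : skewsym e -> cyc e (P1 ++ z :: P2) -> bal e (P1 ++ z :: P2) ->
  (1 < size (P1 ++ P2))%N ->
  [/\ cyc (mut_eps e z) (P1 ++ P2), bal (mut_eps e z) (P1 ++ P2) &
      eqv C e (RP (P1 ++ z :: P2)) (Mu z :: RP (P1 ++ P2) ++ [:: Mu z])].
Proof.
move=> sk cy B s; have [cy' B' h] := rp_rotn sk cy B.
have s' : (1 < size (P2 ++ P1))%N by rewrite size_cat addnC -size_cat.
rewrite cat_cons in cy' B' h.
have skz := skew_mut z sk.
have [cz Bz hz] := rp_rotn skz (cyc_del sk cy' s') (bal_del sk cy' s' B').
split => //; apply: eqv_trans h _; rewrite RP_cons //.
exact: (@eqv_ctx _ _ _ e [:: Mu z] _ _ [:: Mu z]).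
Qed.

Lemma conj3 e k a b c a' b' c' : skewsym e ->
  eqv C e a (Mu k :: a' ++ [:: Mu k]) -> eqv C e b (Mu k :: b' ++ [:: Mu k]) ->
  eqv C e c (Mu k :: c' ++ [:: Mu k]) ->
  eps_seq e a = e -> eps_seq e b = e ->
  eqv C e (a ++ b ++ c) (Mu k :: (a' ++ b' ++ c') ++ [:: Mu k]).
Proof.
move=> sk ha hb hc pa pb.
apply: (@eqv_trans _ _ _ _ ((Mu k :: a' ++ [:: Mu k]) ++ (Mu k :: b' ++ [:: Mu k]) ++ (Mu k :: c' ++ [:: Mu k]))).
  apply: eqv_cat ha (esym pa) _; exact: eqv_cat hb (esym pb) hc.
have := @eqv_cancel _ _ C e (Mu k :: a') k (b' ++ [:: Mu k] ++ Mu k :: c' ++ [:: Mu k]) sk.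
rewrite /= -!catA /= => h; apply: eqv_trans h _.
have := @eqv_cancel _ _ C e (Mu k :: a' ++ b') k (c' ++ [:: Mu k]) sk.
by rewrite /= -!catA.
Qed.

Lemma conj_braid e k a b a' b' : skewsym e ->
  eqv C e a (Mu k :: a' ++ [:: Mu k]) -> eqv C e b (Mu k :: b' ++ [:: Mu k]) ->
  eps_seq e a = e -> eps_seq e b = e ->
  eqv C (mut_eps e k) (a' ++ b' ++ a') (b' ++ a' ++ b') ->
  eqv C e (a ++ b ++ a) (b ++ a ++ b).
Proof.
move=> sk ha hb pa pb h; apply: eqv_trans (conj3 sk ha hb ha pa pb) _.
apply: eqv_sym; apply: eqv_trans (conj3 sk hb ha hb pb pa) _.
by apply: eqv_sym; apply: (@eqv_ctx _ _ _ e [:: Mu k] _ _ [:: Mu k]).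
Qed.

Definition att A S (x : V) := nth x S (index x A).

(** Each [x] in [A] has an arrow to the entry of [S] at its position and one from the next entry of
    [S]. The sublist [S] is kept apart from [B] because [B] may be longer: for unequal root lengths,
    and after a vertex of [A] has moved into [B]. *)
Record linked e A S B : Prop := Linked {
  lcycA : cyc e A; lbalA : bal e A; lcycB : cyc e B; lbalB : bal e B;
  lsize : size A = size S; lsub : subseq S B;
  ldisj : forall x, x \in A -> x \notin B;
  latt : forall x y, x \in A -> y \in B ->
    e x y = (y == att A S x)%:Z - (y == next S (att A S x))%:Z }.

Lemma mem_att A S x : size A = size S -> x \in A -> att A S x \in S.
Proof. by move=> s xA; rewrite mem_nth // -s index_mem. Qed.

(** A vertex of [B] outside [S] has no arrows to or from [A]. Mutation there commutes with R(A) and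
    strips the vertex from [B], so the braid relation is conjugate to that of the shorter pair. *)
Lemma braid_del e A S B1 z B2 : skewsym e -> linked e A S (B1 ++ z :: B2) -> z \notin S ->
  (forall e', skewsym e' -> linked e' A S (B1 ++ B2) -> eqv C e' (RP A ++ RP (B1 ++ B2) ++ RP A) (RP (B1 ++ B2) ++ RP A ++ RP (B1 ++ B2))) ->
  eqv C e (RP A ++ RP (B1 ++ z :: B2) ++ RP A) (RP (B1 ++ z :: B2) ++ RP A ++ RP (B1 ++ z :: B2)).
Proof.
move=> sk L zS IH; have [cA bA cB bB sAS sub dj at_] := L.
have uB : uniq (B1 ++ z :: B2) by case: cB.
have zB : z \in B1 ++ z :: B2 by rewrite mem_cat mem_head orbT.
have sub' : subseq S (B1 ++ B2).
  have SE := elimT (subseq_uniqP uB) sub.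
  by rewrite SE filter_cat /= (negPf zS) -filter_cat filter_subseq.
have s2 : (1 < size (B1 ++ B2))%N.
  by apply: leq_trans (size_subseq sub'); rewrite -sAS; case: cA.
have [cB' bB' hB] := rp_del sk cB bB s2.
have ez x : x \in A -> x != z /\ e x z = 0.
  move=> xA; split; first by apply: contraNneq (dj x xA) => ->.
  have atS := mem_att sAS xA; rewrite at_ //.
  have z1 : z != att A S x by apply: contraNneq zS => ->.
  have z2 : z != next S (att A S x) by apply: contraNneq zS => ->; rewrite mem_next.
  by rewrite (negPf z1) (negPf z2).
have skz := skew_mut z sk.
have eA x k : x \in A -> mut_eps e z x k = e x k.
  by move=> xA; have [xz exz] := ez x xA; apply: mut_eps_row0.
have eA' x k : x \in A -> mut_eps e z k x = e k x by move=> xA; rewrite skz eA // -sk.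
apply: (@conj_braid _ z _ _ (RP A) (RP (B1 ++ B2))) => //.
- apply: eqv_sym; apply: (@eqv_trans _ _ _ _ ([::] ++ Mu z :: Mu z :: RP A)).
    apply: (@eqv_ctxl _ _ _ e [:: Mu z] (RP A ++ [:: Mu z]) (Mu z :: RP A)).
    apply: eqv_sym; apply: (@eqv_disc _ _ _ _ (pred1 z) (mem A) [:: Mu z]) => //=; last exact: wsupp_RP.
    move=> x y /eqP -> yA; have [yz eyz] := ez y yA; split; first by rewrite eq_sym.
    by rewrite skz eA // eyz oppr0.
  exact: eqv_cancel.
- exact: pres.
- exact: pres.
apply: IH => //; split => //.
- by case: cA => u s H; split => // x y xA yA; rewrite eA // H.
- by move=> k; rewrite -[RHS](bA k); apply: eq_big_seq => x xA; rewrite eA'.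
- by move=> x xA; apply: contra (dj x xA); rewrite !mem_cat inE => /orP [->|->]; rewrite ?orbT.
move=> x y xA yB; rewrite eA // at_ //; move: yB; rewrite !mem_cat inE => /orP [->|->]; by rewrite ?orbT.
Qed.

(** Mutation at [a1] closes up [A] and inserts [a1] into [B] between [b1] and [b2], whose direct
    arrow it cancels. It also cancels the remaining arrows of [b1] and [b2] with [A]; in [S] both
    are replaced by [a1]. *)
Lemma linked_shift e a1 a2 A b1 b2 b3 B0 (B := b3 :: B0) : skewsym e ->
  linked e [:: a1, a2 & A] [:: b1, b2 & B] [:: b1, b2 & B] -> A != [::] ->
  linked (mut_eps e a1) (a2 :: A) (a1 :: B) [:: b1, a1, b2 & B].
Proof.
move=> sk [cA bA cB bB sAS _ dj at_] A0.
set BB := [:: b1, b2 & B] in cB bB dj at_ *; set AA := [:: a1, a2 & A] in cA bA dj at_ *.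
have sA1 : (1 < size (a2 :: A))%N by case: (A) A0.
have [uA _ _] := cA; have [uB _ HB] := cB.
have skz := skew_mut a1 sk.
have a1A : a1 \in AA by rewrite mem_head.
have a1B : a1 \notin BB by apply: dj.
have neB y : y \in BB -> y != a1 by apply: contraTneq => ->.
have b12 : b1 != b2 by move: uB => /= /andP []; rewrite inE negb_or => /andP [].
have b1B : b1 \notin B by move: uB => /= /andP []; rewrite inE negb_or => /andP [].
have b2B : b2 \notin B by move: uB => /= /and3P [].
have attI : att AA BB a1 = b1 by rewrite /att /= eqxx.
have n1 : next BB b1 = b2 by rewrite /BB next_head.
have e1 y : y \in BB -> e a1 y = (y == b1)%:Z - (y == b2)%:Z by move=> yB; rewrite at_ // attI n1.
have p1 y : y \in BB -> pp (e a1 y) = (y == b1)%:Z.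
  by move=> yB; rewrite e1 //; case: (eqVneq y b1) => [->|_]; [rewrite (negPf b12) | case: (_ == _)].
have m1 y : y \in BB -> pp (- e a1 y) = (y == b2)%:Z.
  by move=> yB; rewrite e1 //; case: (eqVneq y b1) => [->|_]; [rewrite (negPf b12) | case: (_ == _)].
pose NN := [:: b1, a1, b2 & B]; rewrite -/NN.
have nN1 : next NN b1 = a1 by rewrite next_head.
have nNa : next NN a1 = b2 by rewrite /= eqxx eq_sym (negPf (neB b1 (mem_head _ _))) in a1B *.
have nNx x : x \in BB -> x != b1 -> next NN x = next BB x.
  by move=> xB xb1; rewrite /= (negPf xb1) (negPf (neB x xB)).
have uN : uniq NN.
  move: uB a1B; rewrite /NN /BB /= !inE !negb_or => /and3P [/andP [-> ->] -> ->] /and3P [a1b1 -> ->].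
  by rewrite eq_sym a1b1.
have mN x : (x \in NN) = (x == a1) || (x \in BB) by rewrite !inE; do 2!case: (x == _).
have nNeq x y : x \in BB -> y \in BB -> (next NN x == y)%:Z = (next BB x == y)%:Z - ((x == b1) && (y == b2))%:Z.
  move=> xB yB; have [->|xb] := eqVneq x b1; last by rewrite nNx // subr0.
  by rewrite nN1 n1 (eq_sym a1) (negPf (neB y yB)) (eq_sym b2); case: (y == b2).
have nNa1 x : x \in BB -> (next NN x == a1) = (x == b1).
  move=> xB; have [->|xb] := eqVneq x b1; first by rewrite nN1 eqxx.
  by rewrite nNx // (negPf (neB _ _)) // mem_next.
have cN : cyc (mut_eps e a1) NN.
  split => // x y; rewrite !mN.
  have main y' : y' \in BB -> mut_eps e a1 a1 y' = (next NN a1 == y')%:Z - (next NN y' == a1)%:Z.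
    by move=> yB; rewrite mut_eps_rowk e1 // nNa nNa1 // (eq_sym b2) opprB.
  case/orP => [/eqP->|xB] /orP [/eqP->|yB].
  - by rewrite skew0 // subrr.
  - exact: main.
  - by rewrite skz main // opprB.
  rewrite mut_eps_row ?neB // (sk x a1) opprK !p1 // !m1 // HB // !nNeq //.
  by case: (x == b1); case: (x == b2); case: (y == b1); case: (y == b2);
     case: (_ == y); case: (_ == x).
have [u s2 _] := cB.
have bN : bal (mut_eps e a1) NN.
  move=> k; have pN : perm_eq NN (a1 :: BB) by rewrite /NN (perm_catCA [:: b1] [:: a1]).
  rewrite (perm_big _ pN) /= big_cons; have := bB k.
  have [->|ka] := eqVneq k a1 => Bk.
    rewrite skew0 // add0r (eq_bigr (fun x => - e a1 x)) => [|x _]; last by rewrite mut_eps_rowk.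
    by rewrite sumrN Bk oppr0.
  rewrite (eq_big_seq (fun x => e k x + (pp (e k a1) * (x == b1)%:Z - pp (- e k a1) * (x == b2)%:Z))); last first.
    by move=> x xB; have xa := neB x xB; rewrite mut_eps_row // p1 // m1.
  rewrite big_split /= sumrB -!mulr_sumr !sum_delta ?inE ?eqxx ?orbT // !mulr1 ppB mut_eps_colk Bk add0r.
  by rewrite addNr.
split => //.
- exact: cyc_del.
- exact: bal_del.
- by move: sAS => /= [->].
- apply: (@subseq_trans _ [:: a1, b2 & B]); last exact: subseq_cons.
  exact: (@cat_subseq _ [:: a1] B [:: a1] (b2 :: B) (subseq_refl _) (subseq_cons _ _)).
- move=> x xA; rewrite mN negb_or; apply/andP; split.
    by move: uA => /= /andP [a1n _]; apply: contraNneq a1n => <-.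
  by apply: dj; rewrite inE xA orbT.
have sAB : size A = size B by move: sAS => /= [].
have uA' : uniq A by move: uA => /= /and3P [].
have uB' : uniq B by move: uB => /= /and3P [].
pose f x := nth x B (index x A).
have fB x : x \in A -> f x \in B by move=> xA; rewrite mem_nth // -sAB index_mem.
have neA x : x \in A -> (x != a2) /\ (x != a1).
  move=> xA; move: uA => /= /and3P []; rewrite inE negb_or => /andP [_ h1] h2 _.
  by split; [apply: contraNneq h2 => <- | apply: contraNneq h1 => <-].
have attx x : x \in A -> att AA BB x = f x.
  by move=> xA; have [n2 n1'] := neA x xA; rewrite /att /= eq_sym (negPf n1') eq_sym (negPf n2).
have a21 : a2 != a1 by move: uA => /= /andP []; rewrite inE negb_or eq_sym => /andP [].
have att2 : att AA BB a2 = b2 by rewrite /att /= eq_sym (negPf a21) eqxx.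
have attS2 : att (a2 :: A) (a1 :: B) a2 = a1 by rewrite /att /= eqxx.
have attS x : x \in A -> att (a2 :: A) (a1 :: B) x = f x.
  by move=> xA; have [n2 _] := neA x xA; rewrite /att /= eq_sym (negPf n2).
have n2 : next BB b2 = b3 by rewrite /= eqxx eq_sym (negPf b12).
have uS1 : uniq (a1 :: B) by rewrite cons_uniq uB' andbT; apply: contra a1B => h; rewrite /BB 2!in_cons h !orbT.
have nS1 : next (a1 :: B) a1 = b3 by rewrite /= eqxx.
have BBB z : z \in B -> z \in BB by move=> h; rewrite /BB 2!in_cons h !orbT.
have nS z : z \in B -> next (a1 :: B) z = if z == last b3 B0 then a1 else next B z.
  by move=> zB; apply: next_cons.
have nB z : z \in B -> next BB z = if z == last b3 B0 then b1 else next B z.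
  move=> zB; rewrite /BB next_cons //; last by rewrite inE zB orbT.
  have u2 : uniq (b2 :: B) by case/andP: uB.
  rewrite [next (b2 :: B) z]next_cons // -[last b2 B]/(last b3 B0); by case: ifP => // ->.
have fl x : x \in A -> (f x == last b3 B0) = (x == last a2 A).
  move=> xA; have -> : last b3 B0 = nth x B (size A).-1 by rewrite sAB /= (last_nth x).
  have A1 : (0 < size A)%N by case: (A) A0.
  rewrite nth_uniq // -?sAB ?index_mem ?prednK //.
  have -> : last a2 A = nth x A (size A).-1 by rewrite -nth_last; apply: set_nth_default; rewrite prednK.
  apply/eqP/eqP => [<-|xl]; first by rewrite nth_index.
  by rewrite {1}xl index_uniq // prednK.
have b3B : b3 \in B by rewrite mem_head.
have A0' : A != [::] by [].
move=> x y xA; rewrite mN.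
have [hl xa1 eax pax max] := cyc_head sk cA A0 xA.
have xAA : x \in AA by rewrite inE xA orbT.
have skx : mut_eps e a1 x a1 = (x == a2)%:Z - (x == last a2 A)%:Z by rewrite mut_eps_colk -sk.
case/orP => [/eqP->|yB].
  rewrite skx; move: xA; rewrite inE => /orP [/eqP->|xA].
    by rewrite attS2 nS1 !eqxx (negPf hl) (eq_sym a1) (negPf (neB _ (BBB _ b3B))).
  have [xn _] := neA x xA; rewrite (negPf xn) attS // nS ?fB // fl //.
  rewrite (eq_sym a1 (f x)) (negPf (neB _ (BBB _ (fB _ xA)))); case: ifP; rewrite ?eqxx // => _.
  by rewrite (eq_sym a1) (negPf (neB _ _)) // BBB // mem_next fB.
have ya := neB y yB; rewrite mut_eps_row // (sk x a1) opprK pax max p1 // m1 // at_ //.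
move: xA; rewrite inE => /orP [/eqP->|xA].
  by rewrite att2 n2 attS2 nS1 (negPf (neB y yB)) eqxx (negPf hl); case: (y == b2); case: (y == b3).
have [xn _] := neA x xA; rewrite (negPf xn) attS // attx // nS ?nB ?fB // fl //.
by case: ifP => _; rewrite ?(negPf (neB y yB)); case: (y == _); case: (y == _).
Qed.

Lemma braid_linked e A S B : skewsym e -> linked e A S B ->
  eqv C e (RP A ++ RP B ++ RP A) (RP B ++ RP A ++ RP B).
Proof.
(* The shift of a vertex shortens [A] by one and lengthens [B] by one; weight 2 on [A] makes this a
   decrease. *)
elim: {A B}(2 * size A + size B)%N {-2}A {-2}B S (leqnn (2 * size A + size B)) e => [|n IH] A B S sz e sk L.
  by have [_ sA1 _] := lcycA L; move: sz sA1; lia.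
have [cA bA cB bB sAS sub dj at_] := L.
have [/allP BS|/allPn [z zB zS]] := boolP (all (mem S) B); last first.
  case/splitPr: zB L sz => B1 B2 L sz; apply: (braid_del sk L zS) => e' sk' L'.
  by apply: (IH _ _ S) => //; move: sz; rewrite !size_cat /=; lia.
have uB : uniq B by case: cB.
have SB : S = B.
  by rewrite (elimT (subseq_uniqP uB) sub); apply/all_filterP/allP.
subst S; have sA1 : (1 < size A)%N by case: cA.
case: A sA1 sz L cA bA sAS dj at_ => [|a1 [|a2 A]] // _ sz L cA bA sAS dj at_.
case: B sAS sz L cB bB sub dj at_ {BS} uB => [|b1 [|b2 B]] //= [sAB] sz L cB bB sub dj at_ uB.
case: A sAB sz L cA bA dj at_ => [|a3 A] sAB sz L cA bA dj at_.
  case: B sAB sz L cB bB sub dj at_ uB => // _ sz L cB bB sub dj at_ uB.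
  have [uA _ HA] := cA; have [_ _ HB] := cB.
  have a12 : a1 != a2 by move: uA; rewrite /= inE => /andP [].
  have b12 : b1 != b2 by move: uB; rewrite /= inE => /andP [].
  have := dj a1; have := dj a2; rewrite !inE !eqxx orbT !negb_or => /(_ isT) /andP [d21 d22] /(_ isT) /andP [d11 d12].
  rewrite !RP2; apply: braid2 => //.
  - by rewrite HA ?inE ?eqxx ?orbT //= (eq_sym a2) (negPf a12) ?eqxx.
  - by rewrite HB ?inE ?eqxx ?orbT //= (eq_sym b2) (negPf b12) ?eqxx.
  - by move=> k; have := bA k; rewrite !big_cons big_nil addr0 addrC => /eqP; rewrite addr_eq0 => /eqP.
  - by move=> k; have := bB k; rewrite !big_cons big_nil addr0 addrC => /eqP; rewrite addr_eq0 => /eqP.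
  by rewrite at_ ?inE ?eqxx //= /att /= !eqxx /= (negPf b12).
case: B sAB sz L cB bB sub dj at_ uB => // b3 B sAB sz L cB bB sub dj at_ uB.
have L' := linked_shift sk L (erefl true).
have skz := skew_mut a1 sk.
have [cN bN] := (lcycB L', lbalB L').
have [_ _ h] := @rp_del _ [:: b1] a1 [:: b2, b3 & B] skz cN bN (erefl true).
apply: (@conj_braid _ a1 _ _ (RP [:: a2, a3 & A]) (RP [:: b1, a1, b2, b3 & B])) => //.
- by rewrite RP_cons.
(* Here [rp_del] is read in the mutated quiver: stripping [a1] from the longer cycle gives back the
   original [B]. *)
- apply: eqv_sym; apply: (@eqv_trans _ _ _ _ ([:: Mu a1; Mu a1] ++ RP [:: b1, b2, b3 & B] ++ [:: Mu a1; Mu a1])).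
    apply: (@eqv_trans _ _ _ _ ([:: Mu a1] ++ (Mu a1 :: RP [:: b1, b2, b3 & B] ++ [:: Mu a1]) ++ [:: Mu a1])).
      exact: (@eqv_ctx _ _ _ e [:: Mu a1] _ _ [:: Mu a1] h).
    by rewrite /= -catA.
  apply: eqv_trans (@eqv_cancel _ _ C e [::] a1 _ sk) _.
  by have := @eqv_cancel _ _ C e (RP [:: b1, b2, b3 & B]) a1 [::] sk; rewrite cats0.
- exact: pres.
- exact: pres.
by apply: (IH _ _ (a1 :: [:: b3 & B])) => //; move: sz => /=; lia.
Qed.

End LinkedCycles.

(** * Cones in fraction fields *)

Section FractionCone.
Local Open Scope ring_scope.
Variables (R : idomainType) (pos : R -> Prop).
Hypotheses (pos1 : pos 1) (posD : forall x y, pos x -> pos y -> pos (x + y))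
  (posM : forall x y, pos x -> pos y -> pos (x * y)) (pos_neq0 : forall x, pos x -> x != 0).

Local Notation "x %:F" := (@FracField.tofrac R x).

Definition frac_pos (x : {fraction R}) := exists p q, [/\ pos p, pos q & x = p%:F / q%:F].

Lemma frac_pos1 : frac_pos 1.
Proof. by exists 1, 1; rewrite divr1 tofrac1. Qed.

Lemma tofrac_neq0 p : pos p -> p%:F != 0.
Proof. by move=> /pos_neq0; rewrite tofrac_eq0. Qed.

Lemma frac_addE p q p' q' : pos q -> pos q' ->
  p%:F / q%:F + p'%:F / q'%:F = (p * q' + p' * q)%:F / (q * q')%:F.
Proof.
by move=> /tofrac_neq0 q0 /tofrac_neq0 q0'; rewrite tofracD !tofracM addf_div.
Qed.

Lemma frac_mulE p q p' q' : (p%:F / q%:F) * (p'%:F / q'%:F) = (p * p')%:F / (q * q')%:F.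
Proof. by rewrite !tofracM mulf_div. Qed.

Lemma frac_posD x y : frac_pos x -> frac_pos y -> frac_pos (x + y).
Proof.
move=> [p [q [pp_ pq ->]]] [p' [q' [pp' pq' ->]]]; rewrite frac_addE //.
by do 2!eexists; split; last reflexivity; do ?[apply: posD | apply: posM].
Qed.

Lemma frac_posM x y : frac_pos x -> frac_pos y -> frac_pos (x * y).
Proof.
move=> [p [q [pp_ pq ->]]] [p' [q' [pp' pq' ->]]]; rewrite frac_mulE.
by do 2!eexists; split; last reflexivity; apply: posM.
Qed.

Lemma frac_posV x : frac_pos x -> frac_pos x^-1.
Proof. by move=> [p [q [pp_ pq ->]]]; exists q, p; split => //; rewrite invf_div. Qed.

Lemma frac_pos_neq0 x : frac_pos x -> x != 0.
Proof.
by move=> [p [q [pp_ pq ->]]]; rewrite mulf_neq0 ?invr_eq0 ?tofrac_neq0.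
Qed.

Definition frac_cone := Cone frac_pos1 frac_posD frac_posM frac_posV frac_pos_neq0.

End FractionCone.

Section MPolyCone.
Local Open Scope ring_scope.
Variable n : nat.

(** A positive value at the point with all coordinates 1 is enough: it is kept by sums and products,
    excludes 0 and holds for the indeterminates. *)
Definition mpos (p : {mpoly rat[n]}) : Prop := 0 < p.@[fun=> 1].

Lemma mpos1 : mpos 1. Proof. by rewrite /mpos rmorph1. Qed.
Lemma mposD p q : mpos p -> mpos q -> mpos (p + q).
Proof. by rewrite /mpos rmorphD => hp hq; apply: addr_gt0. Qed.
Lemma mposM p q : mpos p -> mpos q -> mpos (p * q).
Proof. by rewrite /mpos rmorphM => hp hq; apply: mulr_gt0. Qed.
Lemma mpos_neq0 p : mpos p -> p != 0.
Proof. by rewrite /mpos; apply: contraTneq => ->; rewrite rmorph0 ltxx. Qed.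

Definition mpoly_cone : cone {fraction {mpoly rat[n]}} := frac_cone mpos1 mposD mposM mpos_neq0.

Lemma mpoly_cone_X i : mpoly_cone (@FracField.tofrac _ ('X_i : {mpoly rat[n]})).
Proof.
by exists 'X_i, 1; split; rewrite ?tofrac1 ?divr1 //; [rewrite /mpos mevalXU | apply: mpos1].
Qed.

End MPolyCone.

Lemma generic_pos (V : finType) e : pos_seed (mpoly_cone (nvars V)) (@generic_seed V e).
Proof. by split => v; apply: mpoly_cone_X. Qed.

(** * From seeds over Q(X) to tropical seeds *)

Section Valuation.
Local Open Scope ring_scope.

Definition lpos (p : {poly rat}) : Prop := 0 < lead_coef p.

Lemma lpos1 : lpos 1. Proof. by rewrite /lpos lead_coef1. Qed.
Lemma lposM p q : lpos p -> lpos q -> lpos (p * q).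
Proof. by rewrite /lpos lead_coefM; apply: mulr_gt0. Qed.
Lemma lpos_neq0 p : lpos p -> p != 0.
Proof. by rewrite /lpos; apply: contraTneq => ->; rewrite lead_coef0 ltxx. Qed.

(** Positive leading coefficients cannot cancel, so the degree of a sum is exactly the larger
    degree. This makes the valuation of a sum equal to the minimum and not just bounded by it. *)
Lemma lposD_size p q : lpos p -> lpos q -> lpos (p + q) /\ size (p + q) = maxn (size p) (size q).
Proof.
move=> lp lq; case: (ltngtP (size p) (size q)) => h.
- by rewrite addrC /lpos lead_coefDl // size_polyDl // /maxn h.
- by rewrite /lpos lead_coefDl // size_polyDl // /maxn ltnNge (ltnW h).
have c : (p + q)`_(size p).-1 = lead_coef p + lead_coef q by rewrite coefD !lead_coefE h.
have s : size (p + q) = size p.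
  apply/eqP; rewrite eqn_leq (leq_trans (size_polyD p q)) ?h ?maxnn //=.
  rewrite -h leqNgt; apply/negP => lt.
  have := addr_gt0 lp lq; rewrite -c nth_default ?ltxx //.
  by rewrite -ltnS prednK // lt0n size_poly_eq0 lpos_neq0.
by rewrite s ?h ?maxnn; split; rewrite ?h // /lpos lead_coefE s c; apply: addr_gt0.
Qed.

Lemma lposD p q : lpos p -> lpos q -> lpos (p + q).
Proof. by move=> lp lq; case: (lposD_size lp lq). Qed.

Definition poly_cone : cone {fraction {poly rat}} := frac_cone lpos1 lposD lposM lpos_neq0.

Local Notation "x %:F" := (@FracField.tofrac {poly rat} x).

(** The valuation at infinity, the degree of the denominator minus that of the numerator, as a
    relation on positive fractions. *)
Definition isval (x : {fraction {poly rat}}) (n : int) := exists p q,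
  [/\ lpos p, lpos q, x = p%:F / q%:F & n = (size q)%:Z - (size p)%:Z].

Lemma isval_pos x n : isval x n -> poly_cone x.
Proof. by move=> [p [q [? ? ? _]]]; exists p, q. Qed.

Lemma lsizeM p q : lpos p -> lpos q -> (size (p * q))%:Z = (size p)%:Z + (size q)%:Z - 1.
Proof.
move=> lp lq; have := size_poly_eq0 p; have := size_poly_eq0 q.
by rewrite size_mul ?lpos_neq0 // !(negPf (lpos_neq0 _)) //; move: (size p) (size q); lia.
Qed.

Lemma isval_uniq x n n' : isval x n -> isval x n' -> n = n'.
Proof.
move=> [p [q [lp lq -> ->]]] [p' [q' [lp' lq' /eqP E ->]]]; move: E.
rewrite eqr_div ?(tofrac_neq0 lpos_neq0) // -!tofracM tofrac_eq => /eqP E.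
by have := lsizeM lp lq'; rewrite E lsizeM //; lia.
Qed.

Lemma isval1 : isval 1 0.
Proof. by exists 1, 1; split; rewrite ?tofrac1 ?divr1 ?subrr //; apply: lpos1. Qed.

Lemma isvalM x y n n' : isval x n -> isval y n' -> isval (x * y) (n + n').
Proof.
move=> [p [q [lp lq -> ->]]] [p' [q' [lp' lq' -> ->]]]; exists (p * p'), (q * q').
by split; try exact: lposM; [rewrite frac_mulE | rewrite !lsizeM //; ring].
Qed.

Lemma isvalV x n : isval x n -> isval x^-1 (- n).
Proof. by move=> [p [q [lp lq -> ->]]]; exists q, p; split => //; rewrite ?invf_div ?opprB. Qed.

Lemma isvalD x y n n' : isval x n -> isval y n' -> isval (x + y) (Num.min n n').
Proof.
move=> [p [q [lp lq -> ->]]] [p' [q' [lp' lq' -> ->]]]; exists (p * q' + p' * q), (q * q').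
have [l1 l2] := (lposM lp lq', lposM lp' lq); have [l s] := lposD_size l1 l2.
split => //; first exact: lposM.
  by rewrite (frac_addE lpos_neq0).
have h1 := lsizeM lp lq'; have h2 := lsizeM lp' lq; rewrite (lsizeM lq lq') s.
by move: (size (p * q')) (size (p' * q)) h1 h2; lia.
Qed.

Lemma isvalX x n (k : int) : isval x n -> isval (x ^ k) (k * n).
Proof.
move=> vx; have nat_case m : isval (x ^+ m) (m%:Z * n).
  elim: m => [|m IH]; first by rewrite mul0r; apply: isval1.
  by rewrite exprS (_ : m.+1%:Z * n = n + m%:Z * n); [apply: isvalM | lia].
case: k => m; first exact: nat_case.
by rewrite NegzE mulNr; apply/isvalV/nat_case.
Qed.

Lemma isval_ex (k : int) : exists x, isval x k.
Proof.
have v1 : isval ('X%:F)^-1 1.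
  by exists 1, 'X; split; rewrite ?tofrac1 ?div1r //; rewrite /lpos ?lead_coef1 ?lead_coefX // size_polyX size_poly1.
by exists (('X%:F)^-1 ^ k); have := isvalX k v1; rewrite mulr1.
Qed.

Variable V : finType.
Implicit Types (ts : tseed V).

Definition tstep ts (st : mstep V) := match st with Mu k => tmut ts k | Perm p => tperm_seed ts p end.

Definition trun ts (u : seq (mstep V)) := foldl tstep ts u.

(** One coordinate [w] of the exponent vectors at a time, since the valuation takes values in the
    integers. *)
Definition sim (w : V) (s : seed V {fraction {poly rat}}) ts :=
  seps s = teps ts /\ forall v, isval (sX s v) (tx ts v w).

Lemma sim_step w s ts st : sim w s ts -> sim w (step_seed s st) (tstep ts st).
Proof.
case: st => [k|p] [se sv]; split => //=; rewrite ?se //.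
move=> v; case: ifP => _; first exact/isvalV.
apply: isvalM => //; apply: isvalX; apply: isvalD; first exact: isval1.
by apply: isvalX.
Qed.

Lemma sim_seq w s ts u : sim w s ts -> sim w (apply_seq s u) (trun ts u).
Proof. by elim: u s ts => //= st u IH s ts h; apply: IH; apply: sim_step. Qed.

(** Every integer is a valuation, so for each coordinate the tropical seed lifts to a positive seed
    over Q(X). There the two words agree, and valuations bring the equality back; A-variables are
    irrelevant to this and are set to 1. *)
Lemma trop_eqv e u v x : eqv poly_cone e u v -> trun (TSeed e x) u = trun (TSeed e x) v.
Proof.
move=> h.
have [f Hf] : exists f : V -> V -> {fraction {poly rat}}, forall a w, isval (f a w) (x a w).
  have H a : exists f : V -> {fraction {poly rat}}, forall w, isval (f w) (x a w).
    exact: (fin_all_exists (fun w => isval_ex (x a w))).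
  exact: (fin_all_exists H).
pose s w := Seed e (fun a => f a w) (fun=> 1).
have S w : sim w (s w) (TSeed e x) by split => //= a.
have ps w : pos_seed poly_cone (s w).
  by split => a /=; [apply: isval_pos (Hf a w) | exact: (cpos1 poly_cone)].
case E1 : (trun _ u) => [e1 x1]; case E2 : (trun _ v) => [e2 x2].
have S1 w := sim_seq u (S w); have S2 w := sim_seq v (S w); rewrite E1 in S1; rewrite E2 in S2.
have hs w : apply_seq (s w) u = apply_seq (s w) v by apply: h.
have ee : eps_seq e u = eps_seq e v := eqv_eps h.
have [X1 X2] : e1 = eps_seq e u /\ e2 = eps_seq e v.
  have P ts t : teps (trun ts t) = eps_seq (teps ts) t by elim: t ts => //= -[k|p] t IH ts; rewrite IH.
  by have := P (TSeed e x) u; have := P (TSeed e x) v; rewrite E1 E2.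
congr TSeed; first by rewrite X1 X2.
apply: functional_extensionality => a; apply: functional_extensionality => w.
have [_ /(_ a) v1] := S1 w; have [_ /(_ a) v2] := S2 w; rewrite hs in v1.
exact: isval_uniq v1 v2.
Qed.

End Valuation.

(** * Green runs of R(P) on nonnegative tropical variables *)

Section Green.
Local Open Scope ring_scope.
Variable V : finType.
Implicit Types (e : V -> V -> int) (P T : seq V) (x : V -> trop V).

(** Source of the linearity: at a nonnegative variable the minimum in the tropical rule is decided
    by the sign of the entry alone. *)
Lemma trop_term (n a : int) : 0 <= a -> (- n) * Num.min 0 (- sgz n * a) = pp n * a.
Proof.
move=> a0; have [n0|n0|->] := ltrgtP n 0; last by rewrite oppr0 !mul0r.
  have -> : pp n = 0 by rewrite /pp; lia.
  by rewrite ltr0_sgz // mul0r opprK mul1r min_l // mulr0.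
have -> : pp n = n by rewrite /pp; lia.
by rewrite gtr0_sgz // mulN1r min_r ?oppr_le0 // mulrNN.
Qed.

Lemma pp_min a b : (pp (a - b) = a - Num.min a b) * (pp (- (a - b)) = b - Num.min a b).
Proof. by split; rewrite /pp; lia. Qed.

Lemma tmut_pos e x k i w : 0 <= x k w -> i != k ->
  tx (tmut (TSeed e x) k) i w = x i w + pp (e i k) * x k w.
Proof. by move=> x0 /negPf ik /=; rewrite ik trop_term. Qed.

Lemma tmut_k e x k w : tx (tmut (TSeed e x) k) k w = - x k w.
Proof. by rewrite /= eqxx. Qed.

Lemma green_cat (s : tseed V) u v : green_run s (u ++ v) = obind (fun s' => green_run s' v) (green_run s u).
Proof. by elim: u s => [|[k|p] u IH] s //=; case: ifP. Qed.

(** A primitive along the cycle of the entries of [k], normalised to have minimum 0. Its values turn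
    out to be the coefficients with which R(P) adds the variables of P to that of [k]. *)
Definition potential e P k (h : V -> int) :=
  [/\ forall v, v \in P -> h (next P v) - h v = e k (next P v),
      forall v, v \in P -> 0 <= h v & exists2 v, v \in P & h v = 0].

Lemma green_mu e x k u : (forall w, 0 <= x k w) ->
  green_run (TSeed e x) (Mu k :: u) = green_run (tmut (TSeed e x) k) u.
Proof. by move=> x0 /=; rewrite (_ : trop_pos _) //; apply/forallP. Qed.

(** Induction by stripping the head [z]. Mutation at [z] adds its variable to that of the last
    vertex, so the shorter cycle is still nonnegative, and [z] itself is then an outside vertex for
    it. *)
Lemma green_RP e P x : skewsym e -> cyc e P -> bal e P -> (forall v, v \in P -> forall w, 0 <= x v w) ->
  exists x', [/\ green_run (TSeed e x) (RP P) = Some (TSeed e x'),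
    forall v, v \in P -> forall w, x' (next P v) w = - x v w &
    forall k h, k \notin P -> potential e P k h ->
      forall w, x' k w = x k w + \sum_(v <- P) h v * x v w].
Proof.
elim: P e x => [|z T IH] e x sk cy B x0; first by case: cy.
have [u s H] := cy; rewrite /= ltnS in s.
have [s2|] := ltnP 1 (size T); last first.
  case: T s cy B u H x0 {IH} => [|y [|? ?]] // _ cy B u H x0 _.
  have zy : z != y by case/andP: u; rewrite inE.
  have yz : y != z by rewrite eq_sym.
  have nz : next [:: z; y] z = y by rewrite /= eqxx.
  have ny : next [:: z; y] y = z by rewrite /= (negPf yz) eqxx.
  have ezy : e z y = 0 by rewrite H ?inE ?eqxx ?orbT // nz ny !eqxx.
  have eyz : e y z = 0 by rewrite sk ezy.
  have By k : e k y = - e k z.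
    by have := B k; rewrite !big_cons big_nil addr0 addrC => /eqP; rewrite addr_eq0 => /eqP.
  have pe := pres2 zy sk ezy By; rewrite /= tpermV in pe.
  pose s1 := tmut (TSeed e x) z.
  have x1 i w : i != z -> tx s1 i w = x i w + pp (e i z) * x z w.
    by move=> iz; rewrite tmut_pos // x0 ?mem_head.
  have x1y w : tx s1 y w = x y w by rewrite x1 // eyz mul0r addr0.
  have e1 : teps s1 = mut_eps e z by [].
  have s1E : s1 = TSeed (mut_eps e z) (tx s1) by [].
  pose s2 := tmut s1 y.
  have y0 w : 0 <= x y w by apply: x0; rewrite !inE eqxx orbT.
  have x2 i w : i != y -> tx s2 i w = tx s1 i w + pp (mut_eps e z i y) * x y w.
    by move=> iy; rewrite /s2 s1E tmut_pos // x1y.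
  exists (fun i => tx s2 (tperm z y i)); split.
  - rewrite RP2 green_mu; last by apply: x0; rewrite mem_head.
    rewrite -/s1 s1E green_mu; last by move=> w; rewrite x1y.
    rewrite -s1E -/s2 /=; congr Some; rewrite /tperm_seed tpermV; congr TSeed.
    exact: pe.
  - move=> v; rewrite !inE => /orP [/eqP->|/eqP->] w.
      rewrite nz tpermR x2 // mut_eps_rowk ezy oppr0 /pp maxxx mul0r addr0.
      by rewrite /s1 tmut_k.
    by rewrite ny tpermL /s2 s1E tmut_k x1y.
  move=> k h; rewrite !inE negb_or => /andP [kz ky] [ph h0 [v0 v0P hv0]] w.
  rewrite tpermD 1?eq_sym // x2 // x1 //.
  have -> : mut_eps e z k y = - e k z.
    by rewrite (skew_mut z sk) mut_eps_row0 // -sk By.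
  rewrite !big_cons big_nil addr0 -addrA; congr (_ + (_ * _ + _ * _)).
    have := ph y; rewrite ny !inE eqxx orbT => /(_ isT) <-; rewrite pp_min.
    move: v0P hv0 (h0 z) (h0 y); rewrite !inE !eqxx orbT => /orP [/eqP->|/eqP->] hv /(_ isT) a /(_ isT) b; rewrite hv.
      by rewrite min_l ?subr0.
    by rewrite min_r ?subr0.
  have := ph y; rewrite ny !inE eqxx orbT => /(_ isT) <-; rewrite pp_min.
  move: v0P hv0 (h0 z) (h0 y); rewrite !inE !eqxx orbT => /orP [/eqP->|/eqP->] hv /(_ isT) a /(_ isT) b; rewrite hv.
    by rewrite min_l ?subr0.
  by rewrite min_r ?subr0.
case: T IH cy B u H x0 s s2 => [|h0 T] // IH cy B u H x0 s s2.
have T0 : T != [::] by case: (T) s2.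
set TT := h0 :: T in IH cy B u H x0 s s2 *; set l := last h0 T.
have lT : l \in TT by apply: mem_last.
have h0T : h0 \in TT by rewrite mem_head.
have zT : z \notin TT by case/andP: u.
have uT : uniq TT by case/andP: u.
have hd v : v \in TT -> [/\ h0 != l, v != z, e z v = (v == h0)%:Z - (v == l)%:Z,
      pp (e z v) = (v == h0)%:Z & pp (- e z v) = (v == l)%:Z] by move=> vT; apply: cyc_head.
have hl : h0 != l by case: (hd h0 h0T).
have skz := skew_mut z sk; have cz := cyc_del sk cy s2; have Bz := bal_del sk cy s2 B.
have z0 w : 0 <= x z w by apply: x0; rewrite mem_head.
pose s1 := tmut (TSeed e x) z; set e1 := mut_eps e z in skz cz Bz *.
have s1E : s1 = TSeed e1 (tx s1) by [].
have x1 i w : i != z -> tx s1 i w = x i w + pp (e i z) * x z w by move=> iz; rewrite tmut_pos.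
have x1z w : tx s1 z w = - x z w by rewrite tmut_k.
have x1T v w : v \in TT -> tx s1 v w = x v w + (v == l)%:Z * x z w.
  by move=> vT; have [_ vz _ _ pv] := hd v vT; rewrite x1 // (sk v z) pv.
have x1pos v : v \in TT -> forall w, 0 <= tx s1 v w.
  move=> vT w; rewrite x1T //; apply: addr_ge0; last by case: (v == l); rewrite ?mul1r ?mul0r.
  by apply: x0; rewrite inE vT orbT.
have [x2 [G2 N2 K2]] := IH e1 (tx s1) skz cz Bz x1pos.
have nP v : v \in TT -> next (z :: TT) v = if v == l then z else next TT v by move=> vT; apply: next_cons.
have nTl : next TT l = h0 by apply: next_last.
have nT v : v \in TT -> (next TT v == h0) = (v == l).
  move=> vT; rewrite -nTl; apply/eqP/eqP => [/(can_inj (prev_next uT))|->] //.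
have x2z w : x2 z w = x l w.
  (* For the shorter cycle, the potential of [z] is the indicator of its last vertex. Hence [z]
     returns with the old variable of that vertex, which is nonnegative, and the final mutation is
     green. *)
  rewrite (K2 z (fun v => (v == l)%:Z)) //; last first.
    split=> [v vT|v vT|]; last by exists h0 => //; rewrite (negPf hl).
      have nvT : next TT v \in TT by rewrite mem_next.
      have [_ _ ev _ _] := hd _ nvT; rewrite /e1 mut_eps_rowk ev nT // opprB.
      by [].
    by case: (v == l).
  rewrite x1z (bigD1_seq l) // eqxx mul1r x1T // eqxx mul1r big1 ?addr0; last by move=> v /negPf->; rewrite mul0r.
  by rewrite /=; ring.
have l0 w : 0 <= x l w by apply: x0; rewrite inE lT orbT.
pose s3 := tmut (TSeed e1 x2) z.
have x3 i w : i != z -> tx s3 i w = x2 i w + pp (- e i z) * x l w.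
  by move=> iz; rewrite tmut_pos ?x2z // /e1 mut_eps_colk.
exists (tx s3); split.
- rewrite RP_cons // green_mu // -/s1 s1E green_cat G2 /= (_ : trop_pos _); last first.
    by apply/forallP => w; rewrite x2z.
  by rewrite -[tmut _ z]/s3 /s3 /tmut /= mut_eps2.
- move=> v; rewrite inE => /orP [/eqP->|vT] w.
    have h0z : h0 != z by case: (hd h0 h0T).
    rewrite next_head x3 // -nTl N2 // x1T // eqxx nTl -sk.
    by have [_ _ _ -> _] := hd h0 h0T; rewrite eqxx !mul1r; ring.
  rewrite nP //; case: (eqVneq v l) => [->|vl]; first by rewrite /s3 tmut_k x2z.
  have nvT : next TT v \in TT by rewrite mem_next.
  have [_ nz _ pn _] := hd _ nvT; rewrite x3 // -sk pn nT // (negPf vl) mul0r addr0 N2 // x1T // (negPf vl).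
  by rewrite mul0r addr0.
move=> k h; rewrite inE negb_or => /andP [kz kT] [ph h_ge [v0 v0P hv0]] w.
(* Removing [z] merges it with its predecessor [l], and the potential there becomes the minimum of
   the two values. The differences from that minimum are added by the first and the last mutation at
   [z]. *)
pose h' v := if v == l then Num.min (h z) (h l) else h v.
have hz0 := h_ge z (mem_head _ _).
have hv v : v \in TT -> 0 <= h v by move=> vT; apply: h_ge; rewrite inE vT orbT.
have ekz : e k z = h z - h l.
  by have := ph l; rewrite nP // eqxx inE lT orbT => /(_ isT) <-.
have ekh0 : e k h0 = h h0 - h z.
  by have := ph z (mem_head _ _); rewrite next_head.
have ek v : v \in TT -> v != l -> e k (next TT v) = h (next TT v) - h v.
  by move=> vT vl; have := ph v; rewrite nP // (negPf vl) inE vT orbT => /(_ isT).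
rewrite x3 // (K2 k h') //; last first.
  split=> [v vT|v vT|].
  - have nvT : next TT v \in TT by rewrite mem_next.
    have [_ nz _ pn mn] := hd _ nvT; rewrite /e1 mut_eps_row // pn mn nT //.
    case: (eqVneq v l) => [->|vl].
      by rewrite nTl ekh0 ekz /h' eqxx (negPf hl) !pp_min mulr1 mulr0; ring.
    rewrite ek // ekz /h' (negPf vl) !pp_min; case: eqP => [->|_]; rewrite ?mulr1 ?mulr0; ring.
  - by rewrite /h'; case: eqP => _; [rewrite le_min hz0 hv | apply: hv].
  move: v0P; rewrite inE => /orP [/eqP vz|vT].
    by exists l => //; rewrite /h' eqxx -vz hv0 min_l ?hv.
  exists v0 => //; rewrite /h'; case: eqP => [vl|//]; by rewrite -vl hv0 min_r.
rewrite x1 // [in RHS]big_cons ekz.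
rewrite (eq_big_seq (fun v => h v * x v w + (v == l)%:Z * ((h' l - h l) * x l w + h' l * x z w))); last first.
  move=> v vT; rewrite x1T //; case: (eqVneq v l) => [->|vl]; first by rewrite !mul1r; ring.
  by rewrite /h' (negPf vl) !mul0r; ring.
rewrite big_split /= -mulr_suml sum_delta // mul1r.
rewrite !pp_min /h' eqxx; ring.
Qed.

End Green.

(** * The exchange matrix of the quiver in uniform terms *)

Section Quiver.
Local Open Scope ring_scope.

(** Time shift, in units of d, of the arrow from row [a] to a neighbour of smaller label. The value
    -1 is the half step at the short end of B and in the middle of F4. *)
Definition off0 (t : ctype) (a : nat) : int :=
  match t with
  | TB l => if a == l then -1 else 0
  | TF4 => if a == 3%N then -1 else 0
  | _ => 0
  end.

Definition scmax (t : ctype) (a b : nat) : nat := maxn (sc t a) (sc t b).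

(** All types follow one pattern: the arrow back along an edge is later by the larger of the two
    step lengths. *)
Definition ugens (t : ctype) : seq (nat * int * nat * int) :=
  [seq (i, 0%Z, i, Posz (sc t i)) | i <- iota 1 (rank t)] ++
  flatten [seq [:: (g.1, 0%Z, g.2, off0 t g.1); (g.2, off0 t g.1 + Posz (scmax t g.1 g.2), g.1, 0%Z)]
            | g <- dynkin_edges t].

(** Types B and C list the arrows of the last node together at the end; this moves its row arrow up
    to the other row arrows. *)
Lemma chain_perm (T : eqType) (A A' : nat -> T) (E : nat -> seq T) (E' : nat * nat -> seq T) n a b c :
  (forall i, 0 < i <= n.+1 -> A i = A' i)%N -> a = A' n.+2 ->
  (forall i, 0 < i <= n -> E i.+1 = E' (i.+1, i))%N -> E' (n.+2, n.+1) = [:: b; c] ->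
  perm_eq (map A (iota 1 n.+1) ++ flatten (map E (iota 2 n)) ++ [:: a; b; c])
    (map A' (iota 1 n.+2) ++ flatten (map E' [seq (i.+1, i) | i <- iota 1 n.+1])).
Proof.
move=> hA -> hE hE'.
have iS k : iota 1 k.+1 = iota 1 k ++ [:: k.+1] by rewrite -[in LHS](addn1 k) iotaD.
rewrite (iS n.+1) map_cat (_ : map A (iota 1 n.+1) = map A' (iota 1 n.+1)); last first.
  by apply/eq_in_map => i; rewrite mem_iota => h; apply: hA; lia.
rewrite -catA perm_cat2l (iS n) !map_cat flatten_cat /= hE' cats0 -[2%N]/(1 + 1)%N iotaDl -!map_comp.
rewrite (_ : map (E \o _) (iota 1 n) = map (E' \o (fun i => (i.+1, i))) (iota 1 n)); last first.
  by apply/eq_in_map => i; rewrite mem_iota => h /=; rewrite add1n hE //; lia.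
set Y := flatten _; exact/permPl/(perm_catCA Y [:: _] [:: _; _]).
Qed.

Lemma gens_perm t : valid_ctype t -> perm_eq (gens t) (ugens t).
Proof.
case: t => [l|l|l|l|||||] //.
- case: l => [//|[//|n]] _; rewrite /gens /ugens !subSS !subn0; apply: chain_perm => //=.
  + by move=> i h; have -> : (i < n.+2)%N by lia.
  + by rewrite ltnn.
  + move=> i h; rewrite /scmax /= subn1 /=.
    have [e1 e2 e3] : [/\ (i.+1 == n.+2) = false, (i.+1 < n.+2)%N & (i < n.+2)%N] by split; lia.
    by rewrite e1 e2 e3.
  by rewrite /scmax /= ?eqxx ?ltnn ?ltnSn ?subn1.
- case: l => [//|[//|n]] _; rewrite /gens /ugens !subSS !subn0; apply: chain_perm => //=.
  + by move=> i h; have -> : (i < n.+2)%N by lia.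
  + by rewrite ltnn.
  + move=> i h; rewrite /scmax /= subn1 /=.
    have [e2 e3] : (i.+1 < n.+2)%N /\ (i < n.+2)%N by split; lia.
    by rewrite e2 e3.
  by rewrite /scmax /= ?ltnn ?ltnSn ?subn1.
Qed.

Lemma edge_lt t a b : valid_ctype t -> (a, b) \in dynkin_edges t -> (b < a)%N.
Proof.
case: t => [l|l|l|l|||||] v; rewrite /dynkin_edges ?mem_cat.
1-3: by case/mapP => i _ [-> ->].
- case/orP => [/mapP [i _ [-> ->]] //|]; rewrite inE => /eqP [-> ->]; move: v => /=; lia.
all: by rewrite /= ?inE; do ?[case/orP]; move/eqP => [-> ->].
Qed.

Lemma edge_uniq t : valid_ctype t -> uniq (dynkin_edges t).
Proof.
have u k n : uniq [seq (i.+1, i) | i <- iota k n] by rewrite map_inj_uniq ?iota_uniq // => i j [].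
case: t => [l|l|l|l|||||] v //=.
rewrite cats1 rcons_uniq u andbT; apply/mapP => -[i]; rewrite mem_iota => h [h1 h2].
by move: v h1 h2 => /=; lia.
Qed.

Lemma sc_cases t a : (sc t a = 1)%N \/ sc t a = rr t.
Proof. by case: t => [l|l|l|l|||||] /=; try (by left); case: ifP; auto. Qed.

Lemma rr_cases t : [\/ (rr t = 1)%N, (rr t = 2)%N | (rr t = 3)%N].
Proof. by case: t => [l|l|l|l|||||] /=; auto using Or31, Or32, Or33. Qed.

Lemma sc_gt0 t a : (0 < sc t a)%N.
Proof. by case: (sc_cases t a) => -> //; case: (rr_cases t) => ->. Qed.

Lemma off0_edge t a b : valid_ctype t -> (a, b) \in dynkin_edges t -> sc t a = sc t b -> (Posz (sc t a) %| off0 t a)%Z.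
Proof.
case: t => [l|l|l|l|||||] v; rewrite ?dvdz0 //=; last first.
  by rewrite !inE => /or3P [] /eqP [-> ->].
case/mapP => i; rewrite mem_iota => h [-> ->].
case: (eqVneq i.+1 l) => [<-|h']; last by rewrite dvdz0.
by rewrite ltnn ltnSn.
Qed.

(** Shift of the arrow from row [a] to row [b] for either order of the labels, so that later
    arguments need not know which end of the edge is larger. *)
Definition off (t : ctype) (a b : nat) : int :=
  if (a, b) \in dynkin_edges t then off0 t a else - off0 t b - Posz (scmax t a b).

Lemma adjacentC t a b : adjacent t a b = adjacent t b a.
Proof. by rewrite /adjacent orbC. Qed.

Lemma adjacent_neq t a b : valid_ctype t -> adjacent t a b -> a != b.
Proof. by move=> v /orP [] /(edge_lt v); lia. Qed.

Lemma edge_asym t a b : valid_ctype t -> (a, b) \in dynkin_edges t -> (b, a) \in dynkin_edges t = false.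
Proof. by move=> v h; apply/negP => h'; have := edge_lt v h; have := edge_lt v h'; lia. Qed.

Lemma offC t a b : valid_ctype t -> adjacent t a b -> off t b a = - off t a b - Posz (scmax t a b).
Proof.
move=> v /orP [h|h]; rewrite /off h (edge_asym v h).
  by rewrite /scmax maxnC.
by rewrite opprD !opprK addrK.
Qed.

Lemma off_dvd t a b : valid_ctype t -> adjacent t a b -> sc t a = sc t b -> (Posz (sc t a) %| off t a b)%Z.
Proof.
move=> v /orP [h|h] s; rewrite /off; first by rewrite h; apply: off0_edge h s.
rewrite (edge_asym v h) rpredB // ?rpredN ?s; first exact: (off0_edge v h (esym s)).
by rewrite /scmax s maxnn dvdzz.
Qed.

Variables (t : ctype) (m : nat).
Hypotheses (vt : valid_ctype t) (m1 : (1 < m)%N).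
Local Notation N := (rr t * m)%N.

Definition D (z : int) : bool := (Posz N %| z)%Z.

Lemma DN z : D (- z) = D z.
Proof. by rewrite /D !dvdzE abszN. Qed.

Lemma N_gt0 : (0 < N)%N.
Proof. by rewrite muln_gt0 (ltnW m1) andbT; case: (rr_cases t) => ->. Qed.

(** When the rows match, exactly one [n] modulo N puts the source at [u]; the sum collapses to a
    congruence for the time difference. *)
Lemma is_vert_sum a x b y (u v : vert t m) :
  (\sum_(n < N) (is_vert a (Posz n + x) u && is_vert b (Posz n + y) v : nat) =
   [&& a == u.1.+1, b == v.1.+1 & D (Posz v.2 - Posz u.2 - (y - x))])%N.
Proof.
have N0 := N_gt0; have N0' : Posz N != 0 by rewrite eqz_nat -lt0n.
have modE (z : int) (k : 'I_N) : ((z %% Posz N)%Z == Posz k) = D (z - Posz k).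
  by rewrite /D -eqz_mod_dvd [(Posz k %% _)%Z]modz_small //= ltz_nat ltn_ord.
rewrite /is_vert; case: (a == _) => /=; last by rewrite big1.
case: (b == _) => /=; last by rewrite big1 // => n _; rewrite andbF.
have [n0 Hn0] : exists n0 : 'I_N, D (Posz n0 + x - Posz u.2).
  have lt : (`|((Posz u.2 - x) %% Posz N)%Z| < N)%N.
    by rewrite -ltz_nat gez0_abs ?modz_ge0 // ltz_pmod // ltz_nat.
  exists (Ordinal lt); rewrite -modE /= gez0_abs ?modz_ge0 // -modzDml ?modz_mod modzDml.
  by rewrite subrK modz_small //= ltz_nat ltn_ord.
rewrite (bigD1 n0) //= !modE Hn0 /= big1 ?addn0 => [|n nn0].
  congr nat_of_bool; rewrite /D.
  rewrite (_ : Posz n0 + y - Posz v.2 = (Posz n0 + x - Posz u.2) - (Posz v.2 - Posz u.2 - (y - x))); last by ring.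
  by rewrite rpredBl.
rewrite !modE (_ : D _ = false) //; apply: contraNF nn0 => Hn.
have : (Posz N %| Posz n - Posz n0)%Z.
  by rewrite (_ : _ - _ = (Posz n + x - Posz u.2) - (Posz n0 + x - Posz u.2)); [apply: rpredB | ring].
by rewrite -eqz_mod_dvd !modz_small // ?ltz_nat ?ltn_ord // => /eqP [] /val_inj ->.
Qed.

Lemma narrowsE (u v : vert t m) (d := Posz v.2 - Posz u.2) :
  narrows u v = ((u.1 == v.1) && D (d - Posz (sc t u.1.+1)) +
    (adjacent t u.1.+1 v.1.+1 && D (d - off t u.1.+1 v.1.+1)))%N.
Proof.
have -> : narrows u v = (\sum_(g <- ugens t)
    [&& g.1.1.1 == u.1.+1, g.1.2 == v.1.+1 & D (d - (g.2 - g.1.1.2))])%N.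
  rewrite /narrows -(eq_bigr _ (fun g _ => is_vert_sum _ _ _ _ u v)) exchange_big /=.
  apply: eq_bigr => n _; rewrite (seq.permP (gens_perm vt)) -sum1_count big_mkcond /=.
  by apply: eq_bigr => g _; case: (_ && _).
rewrite /ugens big_cat /= big_map; congr addn.
  rewrite (eq_bigr (fun i => (i == u.1.+1) && ((u.1 == v.1) && D (d - Posz (sc t u.1.+1))) : nat)) => [|i _ /=].
    have mu : u.1.+1 \in iota 1 (rank t) by rewrite mem_iota add1n; apply: (ltn_ord u.1).
    by rewrite (bigD1_seq _ mu (iota_uniq _ _)) /= eqxx big1 ?addn0 // => i /negPf ->.
  case: eqP => //= ->; rewrite eqSS -(inj_eq val_inj) subr0; done.
rewrite big_flatten /= big_map.
rewrite (eq_bigr (fun g => ((g == (u.1.+1, v.1.+1)) && D (d - off0 t u.1.+1) +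
    ((g == (v.1.+1, u.1.+1)) && D (d + off0 t v.1.+1 + Posz (scmax t u.1.+1 v.1.+1))))%N)) => [|[a b] _ /=]; last first.
  rewrite !big_cons big_nil /= addn0 !xpair_eqE -!andbA; congr addn.
    by case: eqP => //= ->; case: eqP => //=; rewrite subr0.
  rewrite andbCA; case: eqP => //= ->; case: eqP => //= ->.
  by rewrite sub0r opprK addrA /scmax maxnC.
have cnt (x : nat * nat) (c : bool) : (\sum_(g <- dynkin_edges t) ((g == x) && c : nat))%N = ((x \in dynkin_edges t) && c)%N.
  have [xE|xE] := boolP (x \in dynkin_edges t).
    by rewrite (bigD1_seq _ xE (edge_uniq vt)) /= eqxx big1 ?addn0 // => i /negPf ->.
  by rewrite big1_seq // => g /= gE; case: eqP => // gx; rewrite -gx gE in xE.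
rewrite big_split /= !cnt /adjacent /off.
have [h|h] := boolP ((u.1.+1, v.1.+1) \in _); first by rewrite (edge_asym vt h) /= addn0.
by case: (_ \in _) => //=; rewrite add0n; congr (nat_of_bool (D _)); ring.
Qed.

Lemma epsQ_row (u v : vert t m) (d := Posz v.2 - Posz u.2) (s := Posz (sc t u.1.+1)) : u.1 = v.1 ->
  epsQ u v = (D (d - s))%:Z - (D (d + s))%:Z.
Proof.
move=> uv; have nadj : adjacent t u.1.+1 v.1.+1 = false.
  by apply/negP => /(adjacent_neq vt); rewrite uv eqxx.
rewrite /epsQ !narrowsE nadj [adjacent t v.1.+1 _]adjacentC nadj /s uv eqxx /= !addn0 -/d; congr (_ - (Posz (nat_of_bool _))).
by rewrite -DN; congr (D _); rewrite /d; ring.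
Qed.

Lemma epsQ_adj (u v : vert t m) (d := Posz v.2 - Posz u.2) : adjacent t u.1.+1 v.1.+1 ->
  epsQ u v = (D (d - off t u.1.+1 v.1.+1))%:Z -
             (D (d - off t u.1.+1 v.1.+1 - Posz (scmax t u.1.+1 v.1.+1)))%:Z.
Proof.
move=> h; have := adjacent_neq vt h; rewrite eqSS (inj_eq val_inj) => /negPf uv.
rewrite /epsQ !narrowsE [adjacent t v.1.+1 _]adjacentC h uv eq_sym uv /= !add0n -/d; congr (_ - (Posz (nat_of_bool _))).
by rewrite -DN (offC vt h); congr (D _); rewrite /d; ring.
Qed.

Lemma epsQ_nadj (u v : vert t m) : u.1 != v.1 -> ~~ adjacent t u.1.+1 v.1.+1 -> epsQ u v = 0.
Proof.
move=> /negPf uv /negPf h; rewrite /epsQ !narrowsE uv h [v.1 == _]eq_sym uv.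
by rewrite [adjacent t v.1.+1 _]adjacentC h subrr.
Qed.

Lemma epsQ_skew : @skewsym (vert t m) (@epsQ t m).
Proof. by move=> u v; rewrite /epsQ opprB. Qed.

End Quiver.

(** * The cycles of the quiver and relations among their moves *)

Section QuiverCycles.
Local Open Scope ring_scope.
Variables (t : ctype) (m : nat).
Hypotheses (vt : valid_ctype t) (m1 : (1 < m)%N).
Local Notation N := (rr t * m)%N.
Local Notation D := (D t m).
Local Notation eQ := (@epsQ t m).
Local Notation s_ i := (sc t (nat_of_ord i).+1).
Local Notation adj i j := (adjacent t (nat_of_ord i).+1 (nat_of_ord j).+1).
Local Notation off_ i j := (off t (nat_of_ord i).+1 (nat_of_ord j).+1).
Implicit Types (i j : 'I_(rank t)).

Lemma vx_lt (z : int) : (`|(z %% Posz N)%Z| < N)%N.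
Proof.
have N0 := N_gt0 t m1; have N0' : Posz N != 0 by rewrite eqz_nat -lt0n.
by rewrite -ltz_nat gez0_abs ?modz_ge0 // ltz_pmod // ltz_nat.
Qed.

Definition vx i (z : int) : vert t m := (i, Ordinal (vx_lt z)).

Lemma vx_val i z : Posz (vx i z).2 = (z %% Posz N)%Z.
Proof. by rewrite /= gez0_abs // modz_ge0 // eqz_nat -lt0n N_gt0. Qed.

Lemma Dsub x y z : D (x - y) -> D (y - z) -> D (x - z).
Proof. by move=> h1 h2; rewrite /D -(subrKA y) rpredD. Qed.

Lemma Deq x y : D (x - y) = ((x %% Posz N)%Z == (y %% Posz N)%Z).
Proof. by rewrite /D -eqz_mod_dvd. Qed.

Lemma modN_ord (k : 'I_N) : (Posz k %% Posz N)%Z = Posz k.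
Proof. by rewrite modz_small //= ltz_nat ltn_ord. Qed.

Lemma vx_D i z : D (Posz (vx i z).2 - z).
Proof. by rewrite Deq vx_val modz_mod. Qed.

Lemma vx_eq i z (y : vert t m) : (vx i z == y) = (i == y.1) && D (Posz y.2 - z).
Proof.
rewrite -pair_eqE /pair_eq /=; congr (_ && _); rewrite Deq modN_ord eq_sym -(inj_eq val_inj) /=.
by rewrite -eqz_nat gez0_abs // modz_ge0 // eqz_nat -lt0n N_gt0.
Qed.

Lemma vxK (v : vert t m) : vx v.1 (Posz v.2) = v.
Proof. by apply/eqP; rewrite vx_eq eqxx subrr /D dvdz0. Qed.

Lemma vx_mod i z z' : D (z - z') -> vx i z = vx i z'.
Proof.
move=> h; have h' : D (z' - z) by rewrite -DN opprB.
by apply/eqP; rewrite vx_eq eqxx /=; apply: Dsub (vx_D i z') h'.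
Qed.

Definition sh (c : nat) (v : vert t m) : vert t m := vx v.1 (Posz v.2 + Posz c).

Lemma sh_vx c i z : sh c (vx i z) = vx i (z + Posz c).
Proof. by apply: vx_mod; have := vx_D i z; congr D; ring. Qed.

Definition tr i (z : int) (c n : nat) := [seq vx i (z + Posz (k * c)) | k <- iota 0 n].

Lemma trE i z c n : tr i z c n = traject (sh c) (vx i z) n.
Proof.
have it k : iter k (sh c) (vx i z) = vx i (z + Posz (k * c)).
  elim: k => [|k IH]; first by rewrite mul0n addr0.
  by rewrite iterS IH sh_vx; congr vx; rewrite mulSn PoszD; ring.
rewrite /tr; elim: n => // n IH; rewrite trajectSr -IH it.
by rewrite -(addn1 n) iotaD map_cat /= cats1 add0n.
Qed.

Section FullOrbit.
Variables (i : 'I_(rank t)) (z : int) (c n : nat).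
Hypotheses (nc : (n * c = N)%N).
Let n0 : (0 < n)%N. Proof. by have := N_gt0 t m1; rewrite -nc; case: n. Qed.
Let c0 : (0 < c)%N. Proof. by have := N_gt0 t m1; rewrite -nc; case: c; rewrite ?muln0. Qed.
Let cN : (Posz c %| Posz N)%Z. Proof. by rewrite -nc PoszM dvdz_mull. Qed.

Lemma tr_cycle : fcycle (sh c) (tr i z c n).
Proof.
rewrite trE; case: n n0 nc => // k _ kc /=.
have it : iter k.+1 (sh c) (vx i z) = vx i z.
  have itE l : iter l (sh c) (vx i z) = vx i (z + Posz (l * c)).
    elim: l => [|l IH]; first by rewrite mul0n addr0.
    by rewrite iterS IH sh_vx; congr vx; rewrite mulSn PoszD; ring.
  by rewrite itE kc; apply: vx_mod; rewrite addrAC subrr add0r /D dvdzz.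
have -> : rcons (traject (sh c) (sh c (vx i z)) k) (vx i z) = traject (sh c) (sh c (vx i z)) k.+1.
  by rewrite trajectSr -iterSr it.
exact: fpath_traject.
Qed.

Lemma tr_uniq : uniq (tr i z c n).
Proof.
rewrite map_inj_in_uniq ?iota_uniq // => a b; rewrite !mem_iota !add0n => /= ha hb /eqP.
rewrite vx_eq eqxx /= => h0; have h1 := Dsub (y := Posz (vx i (z + Posz (b * c))).2) _ h0.
have : D (Posz (b * c) - Posz (a * c)).
  have : D ((z + Posz (b * c)) - (z + Posz (a * c))) by apply: h1; rewrite -DN opprB vx_D.
  by congr D; ring.
rewrite Deq !modz_small //= ?ltz_nat -?nc ?ltn_pmul2r // eqz_nat eqn_pmul2r // => /eqP ->.
by [].
Qed.

Lemma tr_next x : x \in tr i z c n -> next (tr i z c n) x = sh c x.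
Proof. by move=> xT; have := next_cycle tr_cycle xT => /eqP. Qed.

Lemma dvd_vx (x : int) (y : int) : D (x - y) -> (Posz c %| x - y)%Z.
Proof. exact: dvdz_trans. Qed.

Lemma mem_tr (y : vert t m) : (y \in tr i z c n) = (y.1 == i) && (Posz c %| Posz y.2 - z)%Z.
Proof.
apply/mapP/andP => [[k _ ->]|[/eqP yi /dvdzP [q hq]]].
  rewrite /= eqxx; split => //.
  have := dvd_vx (vx_D i (z + Posz (k * c))) => h.
  rewrite (_ : _ - z = (Posz (vx i (z + Posz (k * c))).2 - (z + Posz (k * c))) + Posz (k * c)); last by ring.
  by rewrite rpredD // PoszM dvdz_mull.
have n0' : Posz n != 0 by rewrite eqz_nat -lt0n n0.
exists `|(q %% Posz n)%Z|%N; first by rewrite mem_iota /= -ltz_nat gez0_abs ?modz_ge0 // ltz_pmod // ltz_nat n0.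
apply/eqP; rewrite eq_sym vx_eq yi eqxx /= PoszM gez0_abs ?modz_ge0 //.
have key r : Posz y.2 - (z + r * Posz c) = (q - r) * Posz c by rewrite mulrBl -hq opprD addrA.
rewrite key.
have -> : q - (q %% Posz n)%Z = (q %/ Posz n)%Z * Posz n by rewrite {1}(divz_eq q (Posz n)) addrK.
by rewrite /D -mulrA -PoszM nc dvdz_mull.
Qed.

Lemma size_tr : size (tr i z c n) = n.
Proof. by rewrite size_map size_iota. Qed.

Lemma tr_count (w : int) : \sum_(x <- tr i z c n) (D (Posz x.2 - w))%:Z = (Posz c %| w - z)%Z%:Z.
Proof.
have [h|h] := boolP (Posz c %| w - z)%Z.
  have xT : vx i w \in tr i z c n.
    rewrite mem_tr eqxx /=; rewrite (_ : _ - z = (Posz (vx i w).2 - w) + (w - z)); last by ring.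
    by rewrite rpredD // dvd_vx // vx_D.
  rewrite (eq_big_seq (fun x => (x == vx i w)%:Z)) ?(sum_delta tr_uniq xT) // => x.
  by rewrite mem_tr => /andP [/eqP xi _]; rewrite eq_sym vx_eq xi eqxx.
rewrite big1_seq // => x /= xT; rewrite (_ : D _ = false) //; apply: contraNF h => /dvd_vx h.
move: xT; rewrite mem_tr => /andP [_ h'].
by rewrite (_ : w - z = (Posz x.2 - z) - (Posz x.2 - w)); [apply: rpredB | ring].
Qed.

End FullOrbit.

(** Two orbits of the same step whose starting times are congruent modulo the step are the same
    cycle, entered at different points. *)
Lemma tr_rot i z z' c n : (n * c = N)%N -> (Posz c %| z - z')%Z ->
  exists P1 P2, tr i z' c n = P1 ++ P2 /\ tr i z c n = P2 ++ P1.
Proof.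
move=> nc zz; have xT : vx i z \in tr i z' c n.
  rewrite mem_tr // eqxx /= (_ : _ - z' = (Posz (vx i z).2 - z) + (z - z')); last by ring.
  by rewrite rpredD // (dvd_vx nc) // vx_D.
have [k q E] := rot_to xT; exists (take k (tr i z' c n)), (drop k (tr i z' c n)).
rewrite cat_take_drop -[drop _ _ ++ _]/(rot k _) E; split => //.
have := tr_cycle i z' nc; rewrite -(rot_cycle k) E /= rcons_path => /andP [/fpathP [l ql] _].
rewrite {}ql in E *.
have := congr1 size E; rewrite size_rot size_tr /= size_traject => nl.
by rewrite trE nl.
Qed.

Definition plen i := (N %/ s_ i)%N.

Lemma plenE i : (plen i * s_ i = N)%N.
Proof.
rewrite /plen; case: (sc_cases t i.+1) => ->; first by rewrite divn1 muln1.
by rewrite mulKn ?(mulnC m) //; case: (rr_cases t) => ->.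
Qed.

Lemma plen_gt1 i : (1 < plen i)%N.
Proof.
rewrite /plen; case: (sc_cases t i.+1) => ->; last by rewrite mulKn //; case: (rr_cases t) => ->.
by rewrite divn1; case: (rr_cases t) => ->; lia.
Qed.

Lemma cycleP_tr i g : cycleP m i g = tr i (Posz g) (s_ i) (plen i).
Proof.
rewrite /cycleP /tr -/(plen i); elim: (iota 0 _) => //= k l IH.
rewrite (insubT (fun x => x < N)%N (ltn_pmod _ (N_gt0 t m1))) /= IH; congr (_ :: _).
by congr pair; apply: val_inj; rewrite /= -PoszD modz_nat.
Qed.

Lemma sc_dvd_max a b : (Posz (sc t a) %| Posz (scmax t a b))%Z /\ (Posz (sc t b) %| Posz (scmax t a b))%Z.
Proof.
have le c : (sc t c <= rr t)%N by case: (sc_cases t c) => -> //; case: (rr_cases t) => ->.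
have h c d : (Posz (sc t c) %| Posz (scmax t c d))%Z.
  rewrite /scmax; case: (sc_cases t c) => E; first by rewrite E dvd1z.
  by rewrite (maxn_idPl _) ?dvdzz // E.
by split => //; rewrite /scmax maxnC; apply: h.
Qed.

Lemma cyc_tr i z : cyc eQ (tr i z (s_ i) (plen i)).
Proof.
have E := plenE i; split; [exact: tr_uniq | by rewrite size_tr plen_gt1 |].
move=> x y xT yT; rewrite !tr_next //; move: xT yT; rewrite !mem_tr // => /andP [/eqP xi _] /andP [/eqP yi _].
rewrite epsQ_row ?xi ?yi // /sh !vx_eq xi yi eqxx /=; congr (Posz (nat_of_bool _) - Posz (nat_of_bool _)).
  by congr D; ring.
by rewrite -DN; congr D; ring.
Qed.

(** The arrow from [k] to row [i] and the arrow from that row to [k] sit at times that differ by a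
    multiple of the step, [2 s_i] or the larger step, so they meet the same cycle or both miss
    it. *)
Lemma bal_tr i z : bal eQ (tr i z (s_ i) (plen i)).
Proof.
move=> k; have E := plenE i; set T := tr _ _ _ _.
have row x : x \in T -> x.1 = i by rewrite mem_tr // => /andP [/eqP].
have gen w1 w2 : (Posz (s_ i) %| w1 - w2)%Z ->
    (forall x, x \in T -> eQ k x = (D (Posz x.2 - w1))%:Z - (D (Posz x.2 - w2))%:Z) ->
    \sum_(x <- T) eQ k x = 0.
  move=> w12 h; rewrite (eq_big_seq _ h) sumrB !tr_count //.
  rewrite (_ : w1 - z = (w1 - w2) + (w2 - z)); last by ring.
  by rewrite rpredDl // subrr.
have [ki|ki] := eqVneq k.1 i.
  apply: (gen (Posz k.2 + Posz (s_ i)) (Posz k.2 - Posz (s_ i))).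
    by rewrite (_ : _ - _ = Posz (s_ i) * 2); [apply: dvdz_mulr | ring].
  move=> x /row xi; rewrite epsQ_row ?ki ?xi //.
  by congr (Posz (nat_of_bool (D _)) - Posz (nat_of_bool (D _))); ring.
have [h|h] := boolP (adj k.1 i).
  apply: (gen (Posz k.2 + off_ k.1 i) (Posz k.2 + off_ k.1 i + Posz (scmax t k.1.+1 i.+1))).
    rewrite (_ : _ - _ = - Posz (scmax t k.1.+1 i.+1)); last by ring.
    by rewrite rpredN; case: (sc_dvd_max k.1.+1 i.+1).
  move=> x /row xi; rewrite epsQ_adj ?xi //.
  by congr (Posz (nat_of_bool (D _)) - Posz (nat_of_bool (D _))); ring.
by rewrite big1_seq // => x /= /row xi; rewrite epsQ_nadj ?xi.
Qed.

(** On the row with the shorter step, [S] takes only every [s_i / s_j]-th vertex: the ones hit from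
    the cycle of row [i]. *)
Lemma linked_tr i j z : adj i j -> (s_ j <= s_ i)%N ->
  linked eQ (tr i z (s_ i) (plen i)) (tr j (z + off_ i j) (s_ i) (plen i)) (tr j (z + off_ i j) (s_ j) (plen j)).
Proof.
move=> ij sij; have [Ei Ej] := (plenE i, plenE j).
have smax : scmax t i.+1 j.+1 = s_ i by rewrite /scmax (maxn_idPl sij).
have nij : i != j by have := adjacent_neq vt ij; rewrite eqSS (inj_eq val_inj).
have sj : (s_ j %| s_ i)%N by have [_] := sc_dvd_max i.+1 j.+1; rewrite smax.
set A := tr i _ _ _; set S := tr j _ (s_ i) _; set B := tr j _ (s_ j) _.
pose g (v : vert t m) : vert t m := vx j (Posz v.2 + off_ i j).
have SE : S = map g A.
  rewrite /S /A /tr -map_comp; apply: eq_map => k /=; rewrite /g.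
  by apply: vx_mod; have := vx_D i (z + Posz (k * s_ i)); rewrite -DN; congr D; ring.
split; try exact: cyc_tr; try exact: bal_tr.
- by rewrite !size_tr.
- have [c cE] : exists c, s_ i = (c * s_ j)%N by exists (s_ i %/ s_ j)%N; rewrite divnK.
  have c0 : (0 < c)%N by have := sc_gt0 t i.+1; rewrite cE; case: (c).
  have pE : plen j = (c * plen i)%N.
    by apply/eqP; rewrite -(eqn_pmul2r (sc_gt0 t j.+1)) Ej -Ei cE; apply/eqP; lia.
  have sub k n : subseq [seq (l * c)%N | l <- iota k n] (iota (c * k) (c * n)).
    elim: n k => [|n IH] k; first by rewrite muln0.
    rewrite mulnS iotaD [(c * k + c)%N]addnC -mulnS /= -cat1s; apply: cat_subseq => //.
    by rewrite sub1seq mem_iota mulnC leqnn -[X in (X < _)%N]addn0 ltn_add2l.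
  have := map_subseq (fun l => vx j (z + off_ i j + Posz (l * s_ j))) (sub 0%N (plen i)).
  rewrite -map_comp muln0 -pE (_ : map _ _ = S) //; apply: eq_map => l /=.
  by rewrite -mulnA -cE.
- by move=> x; rewrite !mem_tr // => /andP [/eqP -> _]; rewrite (negPf nij).
move=> x y xA yB.
have att_x : att A S x = g x by rewrite /att SE (nth_map x) ?index_mem // nth_index.
have gS : g x \in S by rewrite SE map_f.
rewrite att_x tr_next //; move: xA yB; rewrite !mem_tr // => /andP [/eqP xi _] /andP [/eqP yj _].
rewrite epsQ_adj ?xi ?yj // smax (eq_sym y) (eq_sym y) /g sh_vx !vx_eq yj eqxx /=.
by congr (Posz (nat_of_bool (D _)) - Posz (nat_of_bool (D _))); ring.
Qed.

Variables (K : fieldType) (C : cone K).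
Local Notation "u ~ v" := (eqv C eQ u v) (at level 70).
Local Notation Rc i g := (RP (cycleP m i g)).
Local Notation skQ := (epsQ_skew (t := t) (m := m)).

Lemma Rc_pres i g : eps_seq eQ (Rc i g) = eQ.
Proof. by rewrite cycleP_tr; apply: pres skQ (cyc_tr _ _) (bal_tr _ _). Qed.

Lemma Rc_invol i g : Rc i g ++ Rc i g ~ [::].
Proof. by rewrite cycleP_tr; apply: rp_invol skQ (cyc_tr _ _) (bal_tr _ _). Qed.

(** Arrows within a row, and between rows of equal step, join only cycles with the same residue. *)
Lemma Rc_comm i g j g' : (g < s_ i)%N -> (g' < s_ j)%N ->
  (i == j) && (g != g') || (i != j) && (~~ adj i j || (s_ i == s_ j) && (g != g')) ->
  Rc i g ++ Rc j g' ~ Rc j g' ++ Rc i g.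
Proof.
move=> gi gj h; apply: rp_disc => [|x y]; first exact: skQ.
rewrite !cycleP_tr /= !mem_tr ?plenE // => /andP [/eqP xi hx] /andP [/eqP yj hy].
have mods (s : nat) : (g < s)%N -> (g' < s)%N -> (Posz s %| Posz x.2 - Posz g)%Z -> (Posz s %| Posz y.2 - Posz g')%Z ->
    (Posz s %| Posz y.2 - Posz x.2)%Z -> g = g'.
  move=> lg lg' h1 h2 h3; have : (Posz s %| Posz g - Posz g')%Z.
    rewrite (_ : _ - _ = (Posz y.2 - Posz g') - (Posz x.2 - Posz g) - (Posz y.2 - Posz x.2)); last by ring.
    exact: (rpredB (rpredB h2 h1) h3).
  by rewrite -eqz_mod_dvd !modz_small //= ?ltz_nat // eqz_nat => /eqP.
case/orP: h => [/andP [/eqP ij gg]|/andP [ij /orP [h|/andP [/eqP ss gg]]]].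
- move: gj hy yj; rewrite -ij => gj hy yj; have no k : (Posz (s_ i) %| k)%Z -> D (Posz y.2 - Posz x.2 - k) = false.
    move=> hk; apply: contraNF gg => /(dvd_vx (plenE i)) hD; apply/eqP; apply: (mods _ gi gj hx hy).
    rewrite (_ : _ - _ = (Posz y.2 - Posz x.2 - k) + k); last by ring.
    by rewrite rpredD.
  rewrite epsQ_row ?xi ?yj // no ?dvdzz // -[Posz (s_ i)]opprK no ?rpredN ?dvdzz //.
  split => //; apply: contraNneq gg => xy; apply/eqP; apply: (mods _ gi gj hx hy).
  by rewrite xy subrr dvdz0.
- by rewrite epsQ_nadj ?xi ?yj //; split => //; apply: contraNneq ij => xy; rewrite -xi -yj xy.
have [a|a] := boolP (adj i j); last first.
  by rewrite epsQ_nadj ?xi ?yj //; split => //; apply: contraNneq ij => xy; rewrite -xi -yj xy.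
rewrite -ss in hy gj.
have no k : (Posz (s_ i) %| k)%Z -> D (Posz y.2 - Posz x.2 - k) = false.
  move=> hk; apply: contraNF gg => /(dvd_vx (plenE i)) hD; apply/eqP; apply: (mods _ gi gj hx hy).
  rewrite (_ : _ - _ = (Posz y.2 - Posz x.2 - k) + k); last by ring.
  by rewrite rpredD.
have od := off_dvd vt a ss.
rewrite epsQ_adj ?xi ?yj // no // -[_ - _ - Posz _]addrA -opprD no; last first.
  by rewrite rpredD //; case: (sc_dvd_max i.+1 j.+1).
by split => //; apply: contraNneq ij => xy; rewrite -xi -yj xy.
Qed.

Lemma Rc_braid i g j g' : (g < s_ i)%N -> (g' < s_ j)%N -> adj i j -> (s_ i != s_ j) || (g == g') ->
  Rc i g ++ Rc j g' ++ Rc i g ~ Rc j g' ++ Rc i g ++ Rc j g'.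
Proof.
wlog le : i g j g' / (s_ j <= s_ i)%N.
  move=> H gi gj a h; have [le|/ltnW le] := leqP (s_ j) (s_ i); first exact: H.
  by apply: eqv_sym; apply: H => //; rewrite ?(adjacentC t j.+1) // eq_sym (eq_sym g').
move=> gi gj a h.
have L := linked_tr (Posz g) a le.
have B := braid_linked (C := C) skQ L.
(* Unequal steps force [s_ j] to be 1, and for equal steps the offset is a multiple of the step. So
   the cycle produced by [linked_tr] is a rotation of the prescribed one. *)
have dv : (Posz (s_ j) %| (Posz g + off_ i j) - Posz g')%Z.
  case/orP: h => [h|/eqP->].
    have [->|sj] := sc_cases t j.+1; first by rewrite dvd1z.
    by have [si|si] := sc_cases t i.+1; move: h le; rewrite ?si ?sj ?eqxx //; case: (rr_cases t) => ->.
  have [ss|ss] := eqVneq (s_ i) (s_ j).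
    by rewrite addrAC subrr add0r -ss; apply: off_dvd.
  have [->|sj] := sc_cases t j.+1; first by rewrite dvd1z.
  by have [si|si] := sc_cases t i.+1; move: ss le; rewrite ?si ?sj ?eqxx //; case: (rr_cases t) => ->.
have [P1 [P2 [E1 E2]]] := tr_rot j (plenE j) dv.
have cy := cyc_tr j (Posz g'); have ba := bal_tr j (Posz g').
rewrite E1 in cy ba; have [_ _ rB] := rp_rotn C skQ cy ba.
have pA := Rc_pres i g; have pB := Rc_pres j g'.
rewrite !cycleP_tr in pA pB *; rewrite E2 in B; rewrite E1 in pB *.
have pB' : eps_seq eQ (RP (P2 ++ P1)) = eQ by rewrite -(eqv_eps rB) pB.
apply: (@eqv_trans _ _ _ _ (RP (tr i (Posz g) (s_ i) (plen i)) ++ RP (P2 ++ P1) ++ RP (tr i (Posz g) (s_ i) (plen i)))).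
  by apply: eqv_ctx; rewrite pA.
apply: eqv_trans B _; apply: eqv_sym; apply: (eqv_cat rB (esym pB)).
by apply: eqv_ctxl; rewrite pA.
Qed.

End QuiverCycles.

(** * A rewriting certificate for the rank-two Coxeter relations *)

Section Moves.
Variables (adjb : bool) (si sj : nat).
Local Notation letter := (bool * nat)%type.

Definition sl (b : bool) : nat := if b then si else sj.
Definition vl (x : letter) : bool := x.2 < sl x.1.

(** A letter is a cycle of row [i] ([true]) or [j] ([false]) with its residue. This test and the
    next one are the decidable hypotheses of [Rc_comm] and [Rc_braid]. *)
Definition commb (x y : letter) : bool :=
  [&& vl x, vl y & (x.1 == y.1) && (x.2 != y.2) ||
    (x.1 != y.1) && (~~ adjb || (sl x.1 == sl y.1) && (x.2 != y.2))].

Definition braidb (x y : letter) : bool :=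
  [&& vl x, vl y, x.1 != y.1, adjb & (sl x.1 != sl y.1) || (x.2 == y.2)].

(* One rewriting step at the head of a word: cancellation, braid move or commutation,
   whichever applies first. *)
Definition head_move (w : seq letter) : seq letter :=
  match w with
  | x :: y :: w' =>
    if (x == y) && vl x then w'
    else if w' is z :: w'' then
      if (x == z) && braidb x y then [:: y, x, y & w'']
      else if commb x y then [:: y, x & w'] else w
    else if commb x y then [:: y, x & w'] else w
  | _ => w
  end.

Definition move (w : seq letter) (p : nat) := take p w ++ head_move (drop p w).

Definition block (b : bool) := [seq (b, g) | g <- rev (iota 0 (sl b))].
End Moves.

(** Certificates: the positions at which [move] is applied in turn to reduce the expanded word of
    the relation to the empty word. They need no justification beyond the computation in
    [Ri_coxeter]. *)
Definition move_table (adjb : bool) (si sj : nat) : seq nat :=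
  match adjb, si, sj with
  | false, 1, 1 => [:: 0; 1; 0]
  | false, 2, 2 => [:: 0; 1; 0; 2; 1; 0; 3; 2; 1; 0]
  | false, 3, 3 => [:: 0; 1; 0; 2; 1; 0; 3; 2; 1; 0; 4; 3; 2; 1; 0; 5; 4; 3; 2; 1; 0]
  | false, 1, 2 => [:: 0; 1; 0; 2; 1; 0]
  | false, 2, 1 => [:: 0; 1; 0; 2; 1; 0]
  | false, 1, 3 => [:: 0; 1; 0; 2; 1; 0; 3; 2; 1; 0]
  | false, 3, 1 => [:: 0; 1; 0; 2; 1; 0; 3; 2; 1; 0]
  | true, 1, 1 => [:: 0; 2; 1; 0]
  | true, 2, 2 => [:: 0; 2; 1; 2; 1; 0; 4; 3; 1; 0; 3; 5; 4; 3; 2; 1; 0]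
  | true, 3, 3 => [:: 0; 1; 0; 3; 2; 4; 3; 2; 1; 4; 3; 2; 1; 0; 6; 5; 3; 2; 1; 0; 5; 7; 6; 5; 4; 2; 1; 0; 4; 5; 8; 7; 6; 5; 4; 3; 2; 1; 0]
  | true, 1, 2 => [:: 0; 1; 3; 2; 0; 2; 4; 5; 4; 3; 2; 1; 0]
  | true, 2, 1 => [:: 1; 2; 0; 2; 3; 1; 3; 5; 4; 3; 2; 1; 0]
  | true, 1, 3 => [:: 0; 1; 0; 2; 8; 9; 8; 6; 4; 3; 1; 3; 6; 5; 7; 9; 8; 6; 4; 3; 2; 0; 6; 4; 2; 4; 8; 7; 5; 3; 5; 7; 6; 5; 11; 10; 9; 8; 7; 6; 5; 4; 3; 2; 1; 0]
  | true, 3, 1 => [:: 1; 2; 1; 3; 9; 10; 9; 7; 5; 4; 2; 0; 2; 4; 3; 7; 6; 4; 8; 6; 5; 3; 1; 3; 8; 9; 7; 6; 4; 2; 4; 6; 5; 4; 11; 10; 9; 8; 7; 6; 5; 4; 3; 2; 1; 0]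
  | _, _, _ => [::]
  end.

Definition self_table (s : nat) : seq nat :=
  match s with 1 => [:: 0] | 2 => [:: 0; 1; 0] | 3 => [:: 0; 1; 0; 2; 1; 0] | _ => [::] end.

(** * Coxeter relations for the R_i *)

Section CoxeterRelations.
Local Open Scope ring_scope.
Variables (t : ctype) (m : nat).
Hypotheses (vt : valid_ctype t) (m1 : (1 < m)%N).
Local Notation eQ := (@epsQ t m).
Local Notation s_ i := (sc t (nat_of_ord i).+1).
Local Notation adj i j := (adjacent t (nat_of_ord i).+1 (nat_of_ord j).+1).
Variables (K : fieldType) (C : cone K).
Local Notation "u ~ v" := (eqv C eQ u v) (at level 70).

Lemma coxmE (i j : 'I_(rank t)) : i != j -> coxm t i.+1 j.+1 =
  if adj i j then (match (s_ i, s_ j) with (1, 2) | (2, 1) => 4 | (1, 3) | (3, 1) => 6 | _ => 3 end)%N else 2%N.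
Proof.
move=> ij; have e1 : (i.+1 == j.+1)%N = false by rewrite eqSS (inj_eq val_inj) (negPf ij).
have e2 : (j.+1 == i.+1)%N = false by rewrite eq_sym.
rewrite /coxm /cartan e1 e2 (adjacentC t j.+1); case: (adj i j) => //=.
case: (sc_cases t i.+1) => ->; case: (sc_cases t j.+1) => -> //; by case: (rr_cases t) => ->.
Qed.

Section Pair.
Variables (i j : 'I_(rank t)).
Let idx (b : bool) := if b then i else j.
Let Wd (w : seq (bool * nat)) := flatten [seq RP (cycleP m (idx l.1) l.2) | l <- w].

Let Wd_cat u v : Wd (u ++ v) = Wd u ++ Wd v.
Proof. by rewrite /Wd map_cat flatten_cat. Qed.

Let Wd_pres w : eps_seq eQ (Wd w) = eQ.
Proof. by elim: w => //= l w IH; rewrite eps_seq_cat Rc_pres. Qed.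

Let Wd_nseq c w : Wd (flatten (nseq c w)) = flatten (nseq c (Wd w)).
Proof. by elim: c => //= c IH; rewrite Wd_cat IH. Qed.

Lemma move_sound (adjb : bool) w p : (i != j -> adjb = adj i j) ->
  (i == j -> all (fun l => l.1) w) ->
  Wd w ~ Wd (move adjb (s_ i) (s_ j) w p).
Proof.
move=> ha hij; rewrite /move -[in X in X ~ _](cat_take_drop p w) !Wd_cat.
have hd : i == j -> all (fun l => l.1) (drop p w).
  by move=> /hij /allP h; apply/allP => l /mem_drop /h.
apply: eqv_ctxl; rewrite Wd_pres; move: (drop p w) hd => {hij p w} w.
have slE b : sl (s_ i) (s_ j) b = s_ (idx b) by case: b.
have comm x y w' : (i == j -> x.1 && y.1) -> commb adjb (s_ i) (s_ j) x y -> Wd [:: x, y & w'] ~ Wd [:: y, x & w'].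
  move=> hxy /and3P [vx vy h]; rewrite -[[:: x, y & w']]/([:: x; y] ++ w') -[[:: y, x & w']]/([:: y; x] ++ w') !Wd_cat.
  apply: eqv_ctxr; rewrite /Wd /= !cats0; rewrite /vl !slE in vx vy h.
  apply: Rc_comm => //; have [ij|ij] := eqVneq i j.
    by move: h; have := hxy; rewrite ij eqxx => /(_ isT) /andP [-> ->] /=; rewrite orbF eqxx => ->.
  have ji : (j == i) = false by rewrite eq_sym (negPf ij).
  move: h; rewrite ha //; case: x y {hxy vx vy} => [[] g] [[] g'] /=;
    by rewrite ?eqxx ?ji ?(negPf ij) ?orbF //= ?(adjacentC t j.+1).
have braid x y w' : (i == j -> x.1 && y.1) -> braidb adjb (s_ i) (s_ j) x y -> Wd [:: x, y, x & w'] ~ Wd [:: y, x, y & w'].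
  move=> hxy /and5P [vx vy xy a h]; rewrite -[[:: x, y, x & w']]/([:: x; y; x] ++ w') -[[:: y, x, y & w']]/([:: y; x; y] ++ w') !Wd_cat.
  apply: eqv_ctxr; rewrite /Wd /= !cats0; rewrite /vl !slE in vx vy h.
  have ij : i != j by apply: contra xy => /hxy /andP [-> ->].
  rewrite ha // in a.
  apply: Rc_braid => //; case: x y xy {hxy vx vy h} => [[] g] [[] g'] //= _; by rewrite adjacentC.
case: w => [|x [|y w]] hd //=.
have hxy : i == j -> x.1 && y.1 by move=> /hd /= /and3P [-> ->].
case: ifP => [/andP [/eqP <- _]|_].
  rewrite /Wd /= catA; apply: (@eqv_ctxr _ _ _ _ _ [::]); exact: Rc_invol.
case: w hd => [|z w] hd; first by case: ifP => // /comm h; apply: h.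
case: ifP => [/andP [/eqP <-] /braid h|_]; first exact: h.
by case: ifP => // /comm h; apply: h.
Qed.

Lemma moves_sound (adjb : bool) w ps : (i != j -> adjb = adj i j) ->
  (i == j -> all (fun l => l.1) w) ->
  Wd w ~ Wd (foldl (move adjb (s_ i) (s_ j)) w ps).
Proof.
move=> ha; elim: ps w => //= p ps IH w hij; apply: eqv_trans (@move_sound adjb w p ha hij) _.
apply: IH => /hij /allP h; apply/allP => l; rewrite mem_cat => /orP [/mem_take /h //|].
have hd l' : l' \in drop p w -> l'.1 by move=> /mem_drop /h.
move: (drop p w) hd => [|x [|y w']] hd //=; try exact: hd.
have hx : x.1 by apply: hd; rewrite mem_head.
have hy : y.1 by apply: hd; rewrite !inE eqxx orbT.
have hw l' : l' \in w' -> l'.1 by move=> h'; apply: hd; rewrite !inE h' !orbT.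
case: ifP => _; first exact: hw.
have sw l' : l' \in [:: y, x & w'] -> l'.1.
  by rewrite !inE => /or3P [/eqP->|/eqP->|/hw].
case: w' hw hd sw => [|z w'] hw hd sw; first by case: ifP => _; [apply: sw | apply: hd].
case: ifP => _; last by case: ifP => _; [apply: sw | apply: hd].
rewrite !inE => /or4P [/eqP->|/eqP->|/eqP->|h'] //; by apply: hw; rewrite inE h' orbT.
Qed.

Lemma Ri_block b : Ri m (idx b) = Wd (block (s_ i) (s_ j) b).
Proof.
rewrite /Ri /Wd /block -map_comp (_ : sl _ _ b = s_ (idx b)); last by case: b.
by congr flatten; apply: eq_map.
Qed.

Lemma Ri_coxeter : RiRj_pow m i j ~ [::].
Proof.
have [ij|ij] := eqVneq i j.
  have E : RiRj_pow m i j = Wd (block (s_ i) (s_ j) true ++ block (s_ i) (s_ j) true).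
    by rewrite Wd_cat -!Ri_block /RiRj_pow /coxm -ij eqxx /= cats0.
  rewrite E; apply: eqv_trans (@moves_sound false _ (self_table (s_ i)) _ _) _; rewrite ?ij ?eqxx //.
    move=> _; apply/allP => l; rewrite mem_cat orbb => /mapP [g _ ->]; done.
  set w := foldl _ _ _; suff -> : w = [::] by [].
  by rewrite /w; case: (sc_cases t j.+1) => ->; [|case: (rr_cases t) => ->].
have E : RiRj_pow m i j = Wd (flatten (nseq (coxm t i.+1 j.+1) (block (s_ i) (s_ j) false ++ block (s_ i) (s_ j) true))).
  by rewrite Wd_nseq Wd_cat -!Ri_block.
rewrite E; apply: eqv_trans (@moves_sound (adj i j) _ (move_table (adj i j) (s_ i) (s_ j)) _ _) _ => //.
  by rewrite (negPf ij).
rewrite coxmE //.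
(* The steps are 1, 2 or 3, so each case is a closed computation. *)
set w := foldl _ _ _; suff -> : w = [::] by [].
rewrite /w; case: (adj i j); case: (sc_cases t i.+1) => ->; case: (sc_cases t j.+1) => ->;
  try (by vm_compute); by case: (rr_cases t) => ->; vm_compute.
Qed.

End Pair.

Lemma Ri_pres i : eps_seq eQ (Ri m i) = eQ.
Proof.
rewrite /Ri; elim: (rev _) => //= g gs IH; by rewrite eps_seq_cat Rc_pres.
Qed.

Lemma Rword_pres ws : eps_seq eQ (Rword m ws) = eQ.
Proof. by rewrite /Rword; elim: (rev ws) => //= i is_ IH; rewrite eps_seq_cat Ri_pres. Qed.

Lemma Rword_cat u v : Rword m (u ++ v) = @Rword t m v ++ @Rword t m u.
Proof. by rewrite /Rword rev_cat map_cat flatten_cat. Qed.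

Lemma Rword_cox (i j : 'I_(rank t)) : Rword m (coxrel i j) = RiRj_pow m i j.
Proof.
rewrite /coxrel /RiRj_pow; elim: (coxm _ _ _) => //= c IH.
rewrite -[[:: i, j & _]]/([:: i; j] ++ _) Rword_cat IH.
have -> : Rword m [:: i; j] = Ri m j ++ Ri m i by rewrite /Rword /= cats0.
by move: (Ri m j ++ Ri m i) => X; elim: (c) => [|c' IH'] /=; rewrite ?cats0 // -catA IH'.
Qed.

Lemma Rword_eqv (u v : seq 'I_(rank t)) : wequiv u v -> Rword m u ~ Rword m v.
Proof.
elim=> {u v} [u|u v _ IH|u v w _ IH1 _ IH2|u v i j] //.
- exact: eqv_sym.
- exact: eqv_trans IH1 IH2.
rewrite !Rword_cat -!catA Rword_cox; apply: (@eqv_ctx _ _ _ _ _ _ [::]).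
rewrite Rword_pres; exact: Ri_coxeter.
Qed.

End CoxeterRelations.

(** * The dihedral case on sequences indexed by integer time *)

Section RankTwo.
Local Open Scope ring_scope.
Variables (si sj ci cj S : nat).
Implicit Types (f : (int -> int) * (int -> int)).

(** Effect of R_i on one coordinate of the tropical variables of rows [i] and [j], taken as
    functions of time. Row [j] is indexed so that its offset to row [i] is 0; the offset back is
    then [- S]. *)
Definition stI f : (int -> int) * (int -> int) :=
  (fun n => - f.1 (n - Posz si), fun n => f.2 n + \sum_(r <- iota 0 ci) f.1 (n + Posz (r * si))).

Definition stJ f : (int -> int) * (int -> int) :=
  (fun n => f.1 n + \sum_(r <- iota 0 cj) f.2 (n - Posz S + Posz (r * sj)), fun n => - f.2 (n - Posz sj)).

Fixpoint stk k f := if k is k'.+1 then (if odd k' then stJ else stI) (stk k' f) else f.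

Definition stnext k f := if odd k then (stk k f).2 else (stk k f).1.

(** At each of the first [mm] stages of the alternating word, the row about to be reflected is
    nonnegative. *)
Definition stpos mm := forall F G k n, (forall z, 0 <= F z) -> (forall z, 0 <= G z) -> (k < mm)%N ->
  0 <= stnext k (F, G) n.
End RankTwo.

(** Arguments are brought to the form [n] plus a numeral, so that equal values are generalised to
    one unknown. What remains is linear arithmetic in finitely many nonnegative integers. *)
Ltac shift_args F n HF :=
  repeat match goal with
  | |- context [F ?a] =>
    lazymatch a with
    | (n + Posz _)%R => fail
    | (n + Negz _)%R => fail
    | _ => idtac
    end;
    match (eval pattern n in a) with
    | ?g _ => let k := eval vm_compute in (g (Posz 0)) in
        replace (F a) with (F (n + k)%R) by (congr F; lia)
    end
  end;
  repeat match goal with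
  | |- context [F ?a] => let h := fresh in have h := HF a; move: (F a) h => ? ?
  end.

Section RankTwoCases.
Local Open Scope ring_scope.

Lemma stpos2 si sj S : stpos si sj 0 0 S 2.
Proof.
move=> F G [|[|k]] n HF HG //= _; rewrite /stnext /= ?big_nil ?addr0 //.
Qed.

Lemma stpos3 s : stpos s s 1 1 s 3.
Proof.
move=> F G [|[|[|k]]] n HF HG //= _; rewrite /stnext /= /stI /stJ /= ?big_cons ?big_nil /= ?mul0n ?addr0 //.
  exact: addr_ge0.
by rewrite addrCA addNr addr0.
Qed.

Lemma stpos4a : stpos 2 1 1 2 2 4.
Proof.
move=> F G [|[|[|[|k]]]] n HF HG // _; rewrite /stnext /= /stI /stJ /= ?big_cons ?big_nil /=;
  shift_args F n HF; shift_args G n HG; lia.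
Qed.

Lemma stpos4b : stpos 1 2 2 1 2 4.
Proof.
move=> F G [|[|[|[|k]]]] n HF HG // _; rewrite /stnext /= /stI /stJ /= ?big_cons ?big_nil /=;
  shift_args F n HF; shift_args G n HG; lia.
Qed.

Lemma stpos6a : stpos 3 1 1 3 3 6.
Proof.
move=> F G [|[|[|[|[|[|k]]]]]] n HF HG // _; rewrite /stnext /= /stI /stJ /= ?big_cons ?big_nil /=;
  shift_args F n HF; shift_args G n HG; lia.
Qed.

Lemma stpos6b : stpos 1 3 3 1 3 6.
Proof.
move=> F G [|[|[|[|[|[|k]]]]]] n HF HG // _; rewrite /stnext /= /stI /stJ /= ?big_cons ?big_nil /=;
  shift_args F n HF; shift_args G n HG; lia.
Qed.


End RankTwoCases.

(** * The green action of R_i on tropical variables *)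

Section GreenReflection.
Local Open Scope ring_scope.
Variables (t : ctype) (m : nat).
Hypotheses (vt : valid_ctype t) (m1 : (1 < m)%N).
Local Notation N := (rr t * m)%N.
Local Notation D := (D t m).
Local Notation eQ := (@epsQ t m).
Local Notation s_ i := (sc t (nat_of_ord i).+1).
Local Notation adj i j := (adjacent t (nat_of_ord i).+1 (nat_of_ord j).+1).
Local Notation off_ i j := (off t (nat_of_ord i).+1 (nat_of_ord j).+1).
Local Notation vx := (vx m1).
Local Notation skQ := (epsQ_skew (t := t) (m := m)).
Implicit Types (i j : 'I_(rank t)) (x : vert t m -> trop (vert t m)).

(* The number of vertices of row i on an arc cut out by the two neighbours of a vertex of row j. *)
Definition arcs j i : nat := if adj j i then (scmax t j.+1 i.+1 %/ s_ i)%N else 0%N.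

(** Indicator of the arc that starts at the target of the arrow from [k] and stops just before the
    source of the arrow to [k]: its jumps are precisely the entries of [k]. *)
Definition arc_pot j i (k : vert t m) (v : vert t m) : int :=
  \sum_(r <- iota 0 (arcs j i)) (D (Posz v.2 - (Posz k.2 + off_ j i + Posz (r * s_ i))))%:Z.

Lemma telescope_iota (a : nat -> int) c :
  \sum_(r <- iota 0 c) a r - \sum_(r <- iota 0 c) a r.+1 = a 0%N - a c.
Proof.
elim: c => [|c IH]; first by rewrite !big_nil !subrr.
rewrite -(addn1 c) iotaD !big_cat /= !big_cons !big_nil add0n addn1 !addr0.
by rewrite opprD addrACA IH; ring.
Qed.

Lemma mem_cycleP i g v : (v \in cycleP m i g) = (v.1 == i) && (Posz (s_ i) %| Posz v.2 - Posz g)%Z.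
Proof. by rewrite (cycleP_tr m1) mem_tr ?plenE. Qed.

Lemma next_cycleP i g v : v \in cycleP m i g -> next (cycleP m i g) v = vx v.1 (Posz v.2 + Posz (s_ i)).
Proof. by rewrite (cycleP_tr m1) => h; rewrite tr_next ?plenE. Qed.

Lemma arc_potential i j g (k : vert t m) : k.1 = j -> j != i -> potential eQ (cycleP m i g) k (arc_pot j i k).
Proof.
move=> kj ji; have s0 := sc_gt0 t i.+1.
have DE (a b : int) : a = b -> D a = D b by move=> ->.
split.
- move=> v vP; have nvP : next (cycleP m i g) v \in cycleP m i g by rewrite mem_next.
  move: (vP) nvP; rewrite !mem_cycleP => /andP [/eqP vi _] /andP [/eqP ni _].
  have nv := next_cycleP vP; rewrite vi in nv.
  have nD w : D (Posz (next (cycleP m i g) v).2 - w) = D (Posz v.2 + Posz (s_ i) - w).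
    rewrite nv; apply/idP/idP => h; first by apply: Dsub h; rewrite -DN opprB vx_D.
    exact: Dsub (vx_D _ _ _) h.
  pose a r : int := (D (Posz v.2 + Posz (s_ i) - (Posz k.2 + off_ j i + Posz (r * s_ i))))%:Z.
  have -> : arc_pot j i k (next (cycleP m i g) v) = \sum_(r <- iota 0 (arcs j i)) a r.
    by apply: eq_bigr => r _; rewrite nD.
  have -> : arc_pot j i k v = \sum_(r <- iota 0 (arcs j i)) a r.+1.
    apply: eq_bigr => r _; congr (Posz (nat_of_bool _)); apply: DE; rewrite mulSn PoszD; ring.
  rewrite telescope_iota /arcs; have [h|h] := boolP (adj j i); last first.
    by rewrite subrr epsQ_nadj ?kj ?ni.
  have [_ sd] := sc_dvd_max t j.+1 i.+1.
  rewrite epsQ_adj ?kj ?ni // /a !mul0n addr0 divnK //.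
  congr (Posz (nat_of_bool _) - Posz (nat_of_bool _)).
    by rewrite -nD; apply: DE; ring.
  by rewrite -nD; apply: DE; ring.
- by move=> v _; apply: sumr_ge0.
pose W := Posz k.2 + off_ j i.
have [h|h] := boolP (Posz (s_ i) %| W - Posz g)%Z.
  (* The vertex just before the arc. The arc spans at most [rr t], which is less than N because
     [m > 1], so it does not wrap round to this vertex. *)
  exists (vx i (W - Posz (s_ i))).
    rewrite mem_cycleP eqxx /= (_ : _ - Posz g = (Posz (vx i (W - Posz (s_ i))).2 - (W - Posz (s_ i))) + (W - Posz g) - Posz (s_ i)); last by ring.
    by rewrite rpredB ?dvdzz // rpredD // (dvd_vx (plenE m i)) // vx_D.
  rewrite /arc_pot big1_seq // => r /= ; rewrite mem_iota add0n => /andP [_ rc].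
  rewrite (_ : D _ = false) //; apply/negP => hD.
  have : D (Posz (r.+1 * s_ i)).
    rewrite -DN; have := Dsub (y := Posz (vx i (W - Posz (s_ i))).2) _ hD => h1.
    have := h1 (W - Posz (s_ i)); rewrite -DN opprB vx_D => /(_ isT).
    by congr D; rewrite /W mulSn PoszD; ring.
  have [_ sd] := sc_dvd_max t j.+1 i.+1.
  have le : (r.+1 * s_ i < N)%N.
    have rS : (r.+1 * s_ i <= scmax t j.+1 i.+1)%N.
      move: rc; rewrite /arcs; case: ifP => // _ rc.
      by rewrite -(divnK (sd : (s_ i %| scmax t j.+1 i.+1)%N)) leq_pmul2r.
    have Sr : (scmax t j.+1 i.+1 <= rr t)%N.
      have le c : (sc t c <= rr t)%N by case: (sc_cases t c) => -> //; case: (rr_cases t) => ->.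
      by rewrite /scmax geq_max !le.
    have r0 : (0 < rr t)%N by case: (rr_cases t) => ->.
    by apply: leq_ltn_trans (leq_trans rS Sr) _; rewrite -[X in (X < _)%N]muln1 ltn_pmul2l.
  rewrite /D dvdzE /= gtnNdvd // muln_gt0 s0 //.
(* Otherwise the arc misses this cycle and any of its vertices will do. *)
have [v vP] : exists v, v \in cycleP m i g.
  by exists (vx i (Posz g)); rewrite mem_cycleP eqxx (dvd_vx (plenE m i)) // vx_D.
exists v => //; move: vP; rewrite mem_cycleP => /andP [_ hv].
rewrite /arc_pot big1 // => r _; rewrite (_ : D _ = false) //; apply: contraNF h => /(dvd_vx (plenE m i)) h.
rewrite (_ : W - Posz g = (Posz v.2 - Posz g) - (Posz v.2 - (W + Posz (r * s_ i))) - Posz (r * s_ i)); last by ring.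
by rewrite rpredB ?PoszM ?dvdz_mull // rpredB.
Qed.

Lemma row_disc i g g' u v : (g < s_ i)%N -> (g' < s_ i)%N -> g != g' ->
  u \in cycleP m i g -> v \in cycleP m i g' -> (u != v) /\ eQ u v = 0.
Proof.
move=> lg lg' gg; rewrite !mem_cycleP => /andP [/eqP ui hu] /andP [/eqP vi hv].
have key k : (Posz (s_ i) %| k)%Z -> ~~ D (Posz v.2 - Posz u.2 - k).
  move=> hk; apply: contra gg => /(dvd_vx (plenE m i)) h.
  have : (Posz (s_ i) %| Posz g - Posz g')%Z.
    rewrite (_ : _ - _ = (Posz v.2 - Posz g') - (Posz u.2 - Posz g) - (Posz v.2 - Posz u.2 - k) - k); last by ring.
    exact: (rpredB (rpredB (rpredB hv hu) h) hk).
  by rewrite -eqz_mod_dvd !modz_small //= ?ltz_nat // eqz_nat.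
split; first by apply: contraNneq (key 0 (dvdz0 _)) => ->; rewrite subrr subr0; apply: dvdz0.
rewrite epsQ_row ?ui ?vi // (negPf (key _ _)) ?dvdzz //.
have -> // : D (Posz v.2 - Posz u.2 + Posz (s_ i)) = false.
by rewrite -[Posz (s_ i)]opprK; apply/negbTE/key; rewrite rpredN dvdzz.
Qed.

Lemma green_cycles i (L : seq nat) x : uniq L -> (forall g, g \in L -> (g < s_ i)%N) ->
  (forall v w, v.1 = i -> 0 <= x v w) ->
  exists x', [/\ green_run (TSeed eQ x) (flatten [seq RP (cycleP m i g) | g <- L]) = Some (TSeed eQ x'),
    forall g v w, g \in L -> v \in cycleP m i g -> x' (next (cycleP m i g) v) w = - x v w,
    forall g v w, (g < s_ i)%N -> g \notin L -> v \in cycleP m i g -> x' v w = x v w &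
    forall k h w, k.1 != i -> (forall g, potential eQ (cycleP m i g) k h) ->
      x' k w = x k w + \sum_(g <- L) \sum_(v <- cycleP m i g) h v * x v w].
Proof.
move=> uL lL x0.
have cy g : cyc eQ (cycleP m i g) by rewrite (cycleP_tr m1); apply: cyc_tr.
have ba g : bal eQ (cycleP m i g) by rewrite (cycleP_tr m1); apply: bal_tr.
(* Generalised for the induction: when a cycle is reached, other variables have changed already, but
   those on the cycles still to come are the original ones. *)
suff main (y : vert t m -> trop (vert t m)) : (forall g v w, g \in L -> v \in cycleP m i g -> y v w = x v w) ->
  exists x', [/\ green_run (TSeed eQ y) (flatten [seq RP (cycleP m i g) | g <- L]) = Some (TSeed eQ x'),
    forall g v w, g \in L -> v \in cycleP m i g -> x' (next (cycleP m i g) v) w = - x v w,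
    forall g v w, (g < s_ i)%N -> g \notin L -> v \in cycleP m i g -> x' v w = y v w &
    forall k h w, k.1 != i -> (forall g, potential eQ (cycleP m i g) k h) ->
      x' k w = y k w + \sum_(g <- L) \sum_(v <- cycleP m i g) h v * x v w] by apply: main.
elim: L uL lL y => [|g L IH] uL lL y yx.
  by exists y; split => // k h w _ _; rewrite big_nil addr0.
case/andP: uL => gL uL.
have lg : (g < s_ i)%N by apply: lL; rewrite mem_head.
have row v : v \in cycleP m i g -> v.1 = i by rewrite mem_cycleP => /andP [/eqP].
have y0 v : v \in cycleP m i g -> forall w, 0 <= y v w.
  by move=> vP w; rewrite (yx g) ?mem_head //; apply: x0; apply: row.
have [x1 [G1 N1 K1]] := green_RP skQ (cy g) (ba g) y0.
(* Different cycles of a row are disconnected, so the zero potential applies. *)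
have same g' v w : (g' < s_ i)%N -> g' != g -> v \in cycleP m i g' -> x1 v w = y v w.
  move=> lg' gg vP; rewrite (K1 v (fun=> 0)).
  - by rewrite big1 ?addr0 // => u _; rewrite mul0r.
  - apply/negP => vP'; have [] := row_disc lg' lg gg vP vP'; by rewrite eqxx.
  split => // [u uP|]; last by case: (cycleP m i g) (cy g) => [[]|u l _] //; exists u => //; rewrite mem_head.
  have nP : next (cycleP m i g) u \in cycleP m i g by rewrite mem_next.
  by have [_ ->] := row_disc lg' lg gg vP nP.
have lL' g' : g' \in L -> (g' < s_ i)%N by move=> h; apply: lL; rewrite inE h orbT.
have ne g' : g' \in L -> g' != g by apply: contraTneq => ->.
have yx1 g' v w : g' \in L -> v \in cycleP m i g' -> x1 v w = x v w.
  by move=> gl vP; rewrite (same g') ?lL' ?ne // (yx g') // inE gl orbT.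
have [x' [G' N' S' K']] := IH uL lL' x1 yx1.
exists x'; split.
- by rewrite /= green_cat G1.
- move=> g' v w; rewrite inE => /orP [/eqP-> vP|gl vP]; last exact: N'.
  have nP : next (cycleP m i g) v \in cycleP m i g by rewrite mem_next.
  by rewrite (S' g) // N1 // (yx g) ?mem_head.
- move=> g' v w lg'; rewrite inE negb_or => /andP [gg gl] vP.
  by rewrite (S' g') // (same g').
move=> k h w ki ph; rewrite (K' k h w) // big_cons addrA; congr (_ + _).
rewrite (K1 k h) //; last by apply: contra ki => /row ->.
by congr (_ + _); apply: eq_big_seq => v vP; rewrite (yx g) ?mem_head.
Qed.

Lemma cycle_sum i g (F : vert t m -> int) W : \sum_(v <- cycleP m i g) (D (Posz v.2 - W))%:Z * F v =
  (Posz (s_ i) %| W - Posz g)%Z%:Z * F (vx i W).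
Proof.
rewrite (cycleP_tr m1) (eq_big_seq (fun v : vert t m => (D (Posz v.2 - W))%:Z * F (vx i W))) => [|v].
  by rewrite -mulr_suml tr_count // plenE.
rewrite mem_tr ?plenE // => /andP [/eqP vi _].
have [h|_] := boolP (D _); last by rewrite !mul0r.
by congr (_ * F _); apply/esym/eqP; rewrite vx_eq vi eqxx.
Qed.

Lemma residue_sum (s : nat) W : (0 < s)%N -> \sum_(g <- rev (iota 0 s)) (Posz s %| W - Posz g)%Z%:Z = 1.
Proof.
move=> s0; have s0' : Posz s != 0 by rewrite eqz_nat -lt0n.
have gE : Posz `|(W %% Posz s)%Z| = (W %% Posz s)%Z by rewrite gez0_abs // modz_ge0.
have gs : (`|(W %% Posz s)%Z| < s)%N by rewrite -ltz_nat gE ltz_pmod // ltz_nat.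
rewrite (bigD1_seq `|(W %% Posz s)%Z|%N) ?rev_uniq ?iota_uniq ?mem_rev ?mem_iota //=.
rewrite gE -eqz_mod_dvd modz_mod eqxx big1_seq ?addr0 // => g /andP [gn]; rewrite mem_rev mem_iota add0n => /= lg.
rewrite -eqz_mod_dvd [(Posz g %% _)%Z]modz_small //= ?ltz_nat // -gE eqz_nat eq_sym.
by rewrite (negPf gn).
Qed.

(** Each vertex of an arc lies on exactly one cycle of the row, so the sum over all cycles reduces
    to a sum along the arc. *)
Lemma green_Ri i x : (forall z w, 0 <= x (vx i z) w) ->
  exists x', [/\ green_run (TSeed eQ x) (Ri m i) = Some (TSeed eQ x'),
    forall z w, x' (vx i z) w = - x (vx i (z - Posz (s_ i))) w &
    forall j z w, j != i -> x' (vx j z) w = x (vx j z) w +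
      \sum_(r <- iota 0 (arcs j i)) x (vx i (z + off_ j i + Posz (r * s_ i))) w].
Proof.
move=> x0; have s0 := sc_gt0 t i.+1.
have x0' v w : v.1 = i -> 0 <= x v w by move=> vi; rewrite -(vxK m1 v) vi.
have [||x' [G' N' _ K']] := @green_cycles i (rev (iota 0 (s_ i))) x _ _ x0'.
- by rewrite rev_uniq iota_uniq.
- by move=> g; rewrite mem_rev mem_iota add0n.
exists x'; split => //.
- move=> z w; pose v := vx i (z - Posz (s_ i)); pose g := (v.2 %% s_ i)%N.
  have gL : g \in rev (iota 0 (s_ i)) by rewrite mem_rev mem_iota add0n /= ltn_mod.
  have vP : v \in cycleP m i g.
    by rewrite mem_cycleP eqxx /= -eqz_mod_dvd /g -modz_nat modz_mod.
  rewrite -(N' g v w gL vP) next_cycleP //; congr (x' _ w).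
  by apply: vx_mod; have := vx_D m1 i (z - Posz (s_ i)); rewrite -DN; congr D; rewrite /v /=; ring.
move=> j z w ji; rewrite (K' (vx j z) (arc_pot j i (vx j z))) //; last by move=> g; apply: arc_potential.
congr (_ + _).
pose W r := Posz (vx j z).2 + off_ j i + Posz (r * s_ i).
transitivity (\sum_(g <- rev (iota 0 (s_ i))) \sum_(r <- iota 0 (arcs j i))
   (Posz (s_ i) %| W r - Posz g)%Z%:Z * x (vx i (W r)) w).
  apply: eq_bigr => g _; under eq_bigr do rewrite mulr_suml.
  by rewrite exchange_big /=; apply: eq_bigr => r _; rewrite cycle_sum.
rewrite exchange_big /=; apply: eq_bigr => r _; rewrite -mulr_suml residue_sum // mul1r.
congr (x _ w); apply: vx_mod; have := vx_D m1 j z; congr D; rewrite /W; ring.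
Qed.

End GreenReflection.

(** * Reduced words and dihedral factors *)

Section CoxeterWords.
Variable t : ctype.
Implicit Types (u v w : seq 'I_(rank t)) (a b i j : 'I_(rank t)).

Lemma we_ctx p q u v : wequiv u v -> wequiv (p ++ u ++ q) (p ++ v ++ q).
Proof.
elim=> {u v} [u|u v _ IH|u v w _ IH1 _ IH2|u v i j].
- exact: we_refl.
- exact: we_sym.
- exact: we_trans IH1 IH2.
rewrite (_ : p ++ (u ++ coxrel i j ++ v) ++ q = (p ++ u) ++ coxrel i j ++ (v ++ q)) ?catA //.
by rewrite -!catA [p ++ u ++ v ++ q]catA; have := we_rel (p ++ u) (v ++ q) i j; rewrite -!catA.
Qed.

Lemma we_odd u v : wequiv u v -> odd (size u) = odd (size v).
Proof.
elim=> {u v} [u|u v _ ->|u v w _ -> _ ->|u v i j] //.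
rewrite !size_cat !oddD (_ : odd (size (coxrel i j)) = false) ?addFb //.
by rewrite /coxrel; elim: (coxm _ _ _) => //= c ->.
Qed.

Lemma we_ii i w : wequiv [:: i, i & w] w.
Proof. by have := we_rel [::] w i i; rewrite /coxrel /coxm eqxx. Qed.

Lemma we_rev u : wequiv (u ++ rev u) [::].
Proof.
elim: u => [|a u IH]; first exact: we_refl.
rewrite rev_cons -cats1 catA; apply: we_trans (we_ii a [::]).
exact: (we_ctx [:: a] [:: a] IH).
Qed.

Lemma we_inv u v : wequiv (u ++ v) [::] -> wequiv u (rev v).
Proof.
move=> h; have := we_ctx u [::] (we_rev v); rewrite !cats0 => /we_sym h1.
apply: we_trans h1 _; have := we_ctx [::] (rev v) h; by rewrite /= -catA.
Qed.

Lemma not_reduced w : ~ reduced w -> exists2 w', wequiv w' w & size w' < size w.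
Proof.
move=> h; apply: NNPP => h'; apply: h => w' ww; rewrite leqNgt; apply/negP => lt.
by apply: h'; exists w'.
Qed.

Lemma reduced_infix p u q : reduced (p ++ u ++ q) -> reduced u.
Proof.
move=> h w wu; have := h _ (we_ctx p q wu); rewrite !size_cat leq_add2l leq_add2r; exact.
Qed.

Lemma reduced_eq u v : reduced u -> wequiv v u -> size v = size u -> reduced v.
Proof. by move=> h vu s w wv; rewrite s; apply: h; apply: we_trans wv vu. Qed.

Lemma not_reduced_ii i w : ~ reduced [:: i, i & w].
Proof. by move=> /(_ w (we_sym (we_ii i w))) /=; rewrite ltnNge leqnSn. Qed.

(** The alternating word ending in [a]; as words are performed from the right, extending it by one
    letter on the left is the next step of the process. *)
Fixpoint pw a b k := if k is k'.+1 then (if odd k' then b else a) :: pw a b k' else [::].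

Lemma size_pw a b k : size (pw a b k) = k.
Proof. by elim: k => //= k ->. Qed.

Lemma pw_split a b k n : exists2 u, pw a b (k + n) = u ++ pw a b n & size u = k.
Proof.
elim: k => [|k [u E s]]; first by exists [::].
by exists ((if odd (k + n) then b else a) :: u); rewrite /= ?E ?s.
Qed.

Lemma pw_cox a b : pw a b (2 * coxm t a.+1 b.+1) = coxrel b a.
Proof.
rewrite /coxrel (_ : coxm t b.+1 a.+1 = coxm t a.+1 b.+1); last first.
  by rewrite /coxm eq_sym mulrC.
elim: (coxm _ _ _) => [|c IH]; first by rewrite muln0.
by rewrite mulnS /= IH mul2n odd_double.
Qed.

Lemma coxm_gt0 (a b : nat) : 0 < coxm t a b.
Proof. by rewrite /coxm; case: ifP => // _; case: absz => [|[|[|]]]. Qed.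

(** With [c] the order, the alternating word of length [2 c] is trivial; its last [c + 1] letters
    are the inverse of the first [c - 1], hence equivalent to a shorter word. *)
Lemma pw_long a b : ~ reduced (pw a b (coxm t a.+1 b.+1).+1).
Proof.
set c := coxm _ _ _; have c0 : 0 < c by apply: coxm_gt0.
have [u E s] := pw_split a b c.-1 c.+1.
have cc : c.-1 + c.+1 = 2 * c by rewrite addnS -addSn prednK // mul2n addnn.
rewrite cc pw_cox in E.
have h0 : wequiv (u ++ pw a b c.+1) [::] by rewrite -E; have := we_rel [::] [::] b a; rewrite cats0.
have h3 : wequiv (pw a b c.+1) (rev u).
  have := we_ctx [::] (pw a b c.+1) (we_rev (rev u)); rewrite revK /= -catA => h4.
  apply: we_trans (we_sym h4) _; have := we_ctx (rev u) [::] h0; by rewrite !cats0.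
move=> /(_ _ (we_sym h3)); rewrite size_pw size_rev s => h4.
by have := leq_trans h4 (leq_pred c); rewrite ltnn.
Qed.

Lemma pw_alt i j u v : i != j -> (forall c, c \in u -> c = i \/ c = j) -> reduced ((i :: u) ++ v) ->
  exists a b, (a = i /\ b = j \/ a = j /\ b = i) /\ i :: u = pw a b (size u).+1.
Proof.
elim: u i j => [|c u IH] i j ij hu red; first by exists i, j; split; [left|].
have [ci|cj] := hu c (mem_head _ _); first by rewrite ci in red; case: (not_reduced_ii red).
subst c; have red' : reduced ((j :: u) ++ v).
  by apply: (@reduced_infix [:: i] _ [::]); rewrite cats0.
have [||a [b [ab E]]] := IH j i _ _ red'.
- by rewrite eq_sym.
- move=> c cu; have : c = i \/ c = j by apply: hu; rewrite inE cu orbT.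
  by case=> ->; [right | left].
exists a, b; split; first by case: ab; auto.
have Ej : j = if odd (size u) then b else a by case: E.
rewrite [in LHS]E /=; congr (_ :: _); move: Ej; clear E IH.
by case: (odd (size u)); case: ab => -[-> ->] //= ->.
Qed.

(* Take all of a maximal {i,j}-prefix off a word: what remains has both i and j as ascents. *)
Lemma dihedral_factor ws i j u v : reduced ws -> wequiv (u ++ v) ws -> size u + size v = size ws ->
  (forall c, c \in u -> c = i \/ c = j) ->
  exists u' v', [/\ wequiv (u' ++ v') ws, size u' + size v' = size ws, size v' <= size v,
    forall c, c \in u' -> c = i \/ c = j & reduced (i :: v') /\ reduced (j :: v')].
Proof.
move=> red; elim: {v}(size v) {-2}v (leqnn (size v)) u => [|n IH] v sv u uv suv hu.
  have v0 : v = [::] by case: (v) sv.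
  have r1 c : reduced ([:: c] : seq 'I_(rank t)) by move=> w /we_odd; case: w.
  by exists u, v; split => //; rewrite v0.
have key c : c = i \/ c = j -> ~ reduced (c :: v) ->
  exists u' v', [/\ wequiv (u' ++ v') ws, size u' + size v' = size ws, size v' <= size v,
    forall c, c \in u' -> c = i \/ c = j & reduced (i :: v') /\ reduced (j :: v')].
  move=> cij /not_reduced [w wcv sw].
  have vcw : wequiv (c :: w) v.
    apply: we_trans (we_ii c v); have := we_ctx [:: c] [::] wcv; by rewrite !cats0.
  have lw : size (u ++ c :: w) >= size ws.
    apply: red; apply: we_trans uv; have := we_ctx u [::] vcw; by rewrite !cats0.
  have od := we_odd wcv; rewrite size_cat /= -suv addnS in lw.
  (* By parity [w] cannot be as long as [v], and minimality of [ws] forbids it to be shorter by more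
     than one letter. *)
  have sw' : (size w).+1 = size v.
    move: sw od lw; rewrite /= ltnS leq_eqVlt => /orP [/eqP ->|lt _ lw]; first by case: (odd _).
    by apply/eqP; rewrite eqn_leq lt -(leq_add2l (size u)) addnS.
  have [||||u' [v' [h1 h2 h3 h4 h5]]] := IH w _ (u ++ [:: c]).
  - by rewrite -ltnS sw'.
  - apply: we_trans uv; rewrite -catA /=; have := we_ctx u [::] vcw; by rewrite !cats0.
  - by rewrite size_cat /= addn1 addSnnS sw'.
  - by move=> d; rewrite mem_cat inE => /orP [/hu|/eqP->].
  by exists u', v'; split => //; apply: leq_trans h3 _; rewrite -sw'.
have [ri|ni] := classic (reduced (i :: v)); last by apply: (key i) => //; left.
have [rj|nj] := classic (reduced (j :: v)); last by apply: (key j) => //; right.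
by exists u, v.
Qed.

End CoxeterWords.

(** * Green sequences of reduced words *)

Section GreenWords.
Local Open Scope ring_scope.
Variables (t : ctype) (m : nat).
Hypotheses (vt : valid_ctype t) (m1 : (1 < m)%N).
Local Notation eQ := (@epsQ t m).
Local Notation s_ i := (sc t (nat_of_ord i).+1).
Local Notation adj i j := (adjacent t (nat_of_ord i).+1 (nat_of_ord j).+1).
Local Notation off_ i j := (off t (nat_of_ord i).+1 (nat_of_ord j).+1).
Local Notation vx := (vx m1).
Implicit Types (a b i j : 'I_(rank t)) (x : vert t m -> trop (vert t m)).

Lemma trun_cat (V : finType) (s : tseed V) u v : trun s (u ++ v) = trun (trun s u) v.
Proof. exact: foldl_cat. Qed.

Lemma teps_trun (V : finType) (s : tseed V) u : teps (trun s u) = eps_seq (teps s) u.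
Proof. by elim: u s => //= -[k|p] u IH s; rewrite IH. Qed.

Lemma green_trun (V : finType) (s s' : tseed V) u : green_run s u = Some s' -> trun s u = s'.
Proof. by elim: u s => [|[k|p] u IH] s /=; [case | case: ifP => // _ /IH | move/IH]. Qed.

Lemma trun_Rword x ws : trun (TSeed eQ x) (Rword m ws) = TSeed eQ (tx (trun (TSeed eQ x) (Rword m ws))).
Proof.
have := teps_trun (TSeed eQ x) (Rword m ws); rewrite /= Rword_pres //.
by case: (trun _ _) => e y /= ->.
Qed.

Lemma Rword_cons i ws : Rword m (i :: ws) = @Rword t m ws ++ Ri m i.
Proof. by rewrite -cat1s Rword_cat {2}/Rword /= cats0. Qed.

Lemma stpos_pair a b : a != b ->
  stpos (s_ a) (s_ b) (arcs b a) (arcs a b) (scmax t a.+1 b.+1) (coxm t a.+1 b.+1).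
Proof.
move=> ab; rewrite coxmE // /arcs (adjacentC t b.+1) [scmax t b.+1 _]/scmax maxnC -/(scmax t a.+1 b.+1) /scmax.
case: (adj a b); last exact: stpos2.
case: (sc_cases t a.+1) => ->; case: (sc_cases t b.+1) => ->; try exact: stpos3.
- by case: (rr_cases t) => ->; [apply: stpos3 | apply: stpos4b | apply: stpos6b].
- by case: (rr_cases t) => ->; [apply: stpos3 | apply: stpos4a | apply: stpos6a].
by case: (rr_cases t) => ->; apply: stpos3.
Qed.

Lemma rank_two_run a b x k : a != b ->
  (forall z w, 0 <= x (vx a z) w) -> (forall z w, 0 <= x (vx b z) w) -> (k < coxm t a.+1 b.+1)%N ->
  forall z w, 0 <= tx (trun (TSeed eQ x) (Rword m (pw a b k))) (vx (if odd k then b else a) z) w.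
Proof.
move=> ab xa xb.
have ba : b != a by rewrite eq_sym.
pose o := off_ b a.
(* The shift of row [b] by [o] removes the offset in [stI] and turns the one in [stJ] into minus the
   larger step. *)
pose F w n := x (vx a n) w; pose G w n := x (vx b (n - o)) w.
pose st k w := stk (s_ a) (s_ b) (arcs b a) (arcs a b) (scmax t a.+1 b.+1) k (F w, G w).
have P l n w : (l < coxm t a.+1 b.+1)%N -> 0 <= if odd l then (st l w).2 n else (st l w).1 n.
  move=> lc; have := @stpos_pair a b ab (F w) (G w) l n; rewrite /stnext -/(st l w).
  by case: (odd l); apply => // z; rewrite /F /G.
have inv l : (l <= coxm t a.+1 b.+1)%N -> let x' := tx (trun (TSeed eQ x) (Rword m (pw a b l))) in
    forall w z, x' (vx a z) w = (st l w).1 z /\ x' (vx b (z - o)) w = (st l w).2 z.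
  elim: l => [|l IH] lc //=.
  have {}IH := IH (ltnW lc); rewrite Rword_cons trun_cat trun_Rword.
  set y := tx _ in IH *.
  have pos z w : 0 <= y (vx (if odd l then b else a) z) w.
    have := P l (if odd l then z + o else z) w lc; case: (odd l) => /=; first by rewrite -(IH w _).2 addrK.
    by rewrite -(IH w z).1.
  have [x' [G' A' B']] := green_Ri vt pos; rewrite (green_trun G') /= => w z.
  rewrite /st /= -/(st l w); case: (odd l) A' B' {G' pos} => A' B'.
    split; rewrite /=; last by rewrite A' (_ : z - o - _ = (z - Posz (s_ b)) - o) ?(IH w _).2 //; ring.
    rewrite (B' a z w ab) (IH w z).1; congr (_ + _); rewrite /arcs; case: ifP => h; last by rewrite !big_nil.
    apply: eq_bigr => r _; rewrite -(IH w _).2; congr (y (vx b _) w).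
    by rewrite /o (offC vt h); ring.
  split; rewrite /=; first by rewrite A' (IH w _).1.
  rewrite (B' b (z - o) w ba) (IH w z).2; congr (_ + _); apply: eq_bigr => r _.
  by rewrite -/o subrK (IH w _).1.
move=> kc z w; have [h1 h2] := inv k (ltnW kc) w (if odd k then z + o else z).
have := P k (if odd k then z + o else z) w kc; case: (odd k) h1 h2 => h1 h2.
  by rewrite -h2 addrK.
by rewrite -h1.
Qed.

Local Notation X ws := (tx (trun (trop_init eQ) (Rword m ws))).

Lemma X_equiv u v : wequiv u v -> X u = X v.
Proof.
move=> uv; have h := Rword_eqv (C := poly_cone) vt m1 uv.
by rewrite /trop_init (trop_eqv _ h).
Qed.

Lemma trun_X ws : trun (trop_init eQ) (Rword m ws) = TSeed eQ (X ws).
Proof. exact: trun_Rword. Qed.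

(** Both claims go together: greenness of the last R_j needs row [j] nonnegative after a shorter
    word, and this is the second claim for that word. *)
Lemma green_reduced ws : reduced ws ->
  green_run (trop_init eQ) (Rword m ws) = Some (TSeed eQ (X ws)) /\
  forall i, reduced (i :: ws) -> forall z w, 0 <= X ws (vx i z) w.
Proof.
elim: {ws}(size ws) {-2}ws (leqnn (size ws)) => [|n IH] [|j ws] // sz red; try by split => //= i _ z w; case: (_ == _).
have redw : reduced ws by apply: (@reduced_infix _ [:: j] _ [::]); rewrite cats0.
have [Gw Pw] := IH ws sz redw; split.
  rewrite trun_X Rword_cons green_cat Gw /=; have [x' [G' _ _]] := green_Ri vt (Pw j red).
  by rewrite G' trun_cat trun_X (green_trun G').
move=> i redi z w; have ij : i != j by apply/eqP => ij; rewrite ij in redi; apply: not_reduced_ii redi.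
(* The given word starts with [j], so its [{i, j}]-factor is not empty and [v] is short enough for
   the induction hypothesis. *)
have [||u [v [uv suv sv hu [ri rj]]]] := @dihedral_factor _ (j :: ws) i j [:: j] ws red (we_refl _).
- by [].
- by move=> c; rewrite inE => /eqP->; right.
have redv : reduced v by apply: (@reduced_infix _ [:: i] _ [::]); rewrite cats0.
have [_ Pv] := IH v (leq_trans sv sz) redv.
have redu : reduced ((i :: u) ++ v).
  apply: (reduced_eq redi); first by have := we_ctx [:: i] [::] uv; rewrite !cats0.
  by rewrite /= size_cat suv.
have [a [b [ab E]]] := pw_alt ij hu redu.
have ab' : a != b by case: ab => -[-> ->] //; rewrite eq_sym.
(* The word [i :: u] is alternating and reduced, so its length is at most the order; thus [u] stays
   within the range of the dihedral check. *)
have lt : (size u < coxm t a.+1 b.+1)%N.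
  rewrite ltnNge; apply/negP => le.
  have [q Eq sq] := pw_split a b ((size u).+1 - (coxm t a.+1 b.+1).+1) (coxm t a.+1 b.+1).+1.
  rewrite subnK ?ltnS // -E in Eq; rewrite Eq -catA in redu.
  exact: pw_long (reduced_infix redu).
have Eu : u = pw a b (size u) by case: E => _.
have Ei : i = if odd (size u) then b else a by case: E.
rewrite -(X_equiv uv) Rword_cat trun_cat trun_X {1}Eu {1}Ei.
have [ra rb] : reduced (a :: v) /\ reduced (b :: v) by case: ab => -[-> ->].
by apply: rank_two_run => // z' w'; apply: Pv.
Qed.

End GreenWords.

Theorem theorem3p7 (t : ctype) (m : nat) :
  valid_ctype t -> 1 < m ->
  (* (1) Coxeter relations (R_i R_j)^{m_ij} = 1 in Gamma_{Q_m(g)} *)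
  ((forall i j : 'I_(rank t), trivial_in_Gamma (@epsQ t m) (RiRj_pow m i j))
   (* ... hence s_i |-> R_i is a well-defined action of W(g) *)
   /\ (forall u v : seq 'I_(rank t), wequiv u v ->
         same_in_Gamma (@epsQ t m) (Rword m u) (Rword m v)))
  /\
  (* (2) green / maximal green sequences *)
  (forall ws : seq 'I_(rank t), reduced ws ->
     green (@epsQ t m) (Rword m ws) /\
     (is_longest ws -> maximal_green (@epsQ t m) (Rword m ws))).
Proof.
move=> vt m1.
have se (u v : seq (mstep (vert t m))) : eqv (mpoly_cone (nvars (vert t m))) (@epsQ t m) u v -> same_in_Gamma (@epsQ t m) u v.
  by move=> h; rewrite /same_in_Gamma (h (generic_seed (@epsQ t m)) erefl (generic_pos _)).
split; first split.
- by move=> i j; apply: (se _ [::]); apply: Ri_coxeter.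
- by move=> u v uv; apply: se; apply: Rword_eqv.
move=> ws red; have [G _] := green_reduced vt m1 red; split; first by rewrite /green G.
move=> long; exists (TSeed (@epsQ t m) (tx (trun (trop_init (@epsQ t m)) (Rword m ws)))) => // v.
(* For the longest element every row is a descent: the word is equivalent to [i :: w'] with [w'] one
   letter shorter. Row [i] is nonnegative after [w'], and the last R_i negates it up to a shift. *)
pose i := v.1.
have [w' ww sw] : exists2 w', wequiv w' (i :: ws) & size w' < (size ws).+1.
  by have [w' ? ?] := long (i :: ws); exists w'.
have od := we_odd ww.
have wi : wequiv (i :: w') ws.
  by apply: we_trans (we_ii i ws); have := we_ctx [:: i] [::] ww; rewrite !cats0.
have sw' : (size w').+1 = size ws.
  have := red _ wi => /=; rewrite ltnS in sw; move=> le.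
  move: sw od; rewrite /= leq_eqVlt => /orP [/eqP ->|lt _]; first by case: (odd _).
  by apply/eqP; rewrite eqn_leq le lt.
have redi : reduced (i :: w') by apply: (reduced_eq red wi).
have redw : reduced w' by apply: (@reduced_infix _ [:: i] _ [::]); rewrite cats0.
have [_ P] := green_reduced vt m1 redw.
have [x' [G' A' _]] := green_Ri vt (P i redi).
apply/forallP => w; rewrite /= -(X_equiv vt m1 wi) Rword_cons trun_cat trun_X // (green_trun G') /=.
by rewrite -(vxK m1 v) A' oppr_le0; apply: P.
Qed.
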